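(* Let $M$ be a connected, closed (compact, without boundary), smooth manifold endowed with a Riemannian metric. Let $H=H(x,u,p):T^*M\times\mathbb{R}\to\mathbb{R}$ be of class $C^3$ and satisfy (H1)-(H4), and let $F:M\times\mathcal{P}(M)\to\mathbb{R}$ satisfy (F1) and (F2) (all conditions are spelled out in the context). Then there exists a pair $(u,m)\in C(M)\times\mathcal{P}(M)$ which is a solution of the contact mean field games system $$\begin{cases} H(x,u,Du)=F(x,m) & \text{in } M,\\ \mathrm{div}\Big(m\,\frac{\partial H}{\partial p}(x,u,Du)\Big)=0 & \text{in } M,\\ \int_M m\,dx=1,\end{cases}$$ that is, $u$ is a viscosity solution of $H(x,u,Du)=F(x,m)$ on $M$, and $m$ satisfies the continuity equation in the sense of distributions: $Du(x)$ exists for $m$-a.e. $x\in M$ and $$\int_M\Big\langle D\varphi(x),\frac{\partial H}{\partial p}(x,u(x),Du(x))\Big\rangle_x\,dm(x)=0,\qquad\forall\varphi\in C^1(M).$$ Moreover, $(u,m)$ can be chosen so that there is a Mather measure $\mu_m$ for the contact Hamiltonian system of $H_m(x,u,p):=H(x,u,p)-F(x,m)$ with $m=\pi_x\sharp\mu_m$, where $\pi_x:T^*M\times\mathbb{R}\to M$ is the canonical projection and $\pi_x\sharp\mu_m$ is the push-forward of $\mu_m$ by $\pi_x$.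
   Context: Assumptions on $H$: (H1) for every $(x,u,p)\in T^*M\times\mathbb{R}$, $\frac{\partial^2H}{\partial p^2}(x,u,p)$ is positive definite as a quadratic form; (H2) for every $(x,u)\in M\times\mathbb{R}$, $H(x,u,p)$ is superlinear in $p$; (H3) there are constants $\delta>0$, $\lambda>0$ such that $\delta<\frac{\partial H}{\partial u}(x,u,p)\le\lambda$ for all $(x,u,p)\in T^*M\times\mathbb{R}$; (H4) $H(x,u,p)=H(x,u,-p)$ for all $(x,u,p)\in T^*M\times\mathbb{R}$. $\mathcal{P}(M)$ is the set of Borel probability measures on $M$ with the weak-* topology; $d_1(m_1,m_2)=\sup_h\int_Mh\,d(m_1-m_2)$, the supremum being over all 1-Lipschitz $h:M\to\mathbb{R}$. Assumptions on $F:M\times\mathcal{P}(M)\to\mathbb{R}$: (F1) for every $m\in\mathcal{P}(M)$, $x\mapsto F(x,m)$ is of class $C^2(M)$ and $F_\infty:=\sup_{m\in\mathcal{P}(M)}\sum_{|\alpha|\le1}\|D^\alpha F(\cdot,m)\|_\infty<+\infty$; (F2) for every $x\in M$, $m\mapsto F(x,m)$ is Lipschitz and $\sup_{x\in M,\ m_1\ne m_2\in\mathcal{P}(M)}\frac{|F(x,m_1)-F(x,m_2)|}{d_1(m_1,m_2)}<+\infty$. Mather measures: for $m\in\mathcal{P}(M)$, the contact Hamiltonian system of $H_m$ is $$\dot x=\tfrac{\partial H_m}{\partial p}(x,u,p),\quad \dot p=-\tfrac{\partial H_m}{\partial x}(x,u,p)-\tfrac{\partial H_m}{\partial u}(x,u,p)\,p,\quad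 \dot u=\tfrac{\partial H_m}{\partial p}(x,u,p)\cdot p-H_m(x,u,p),$$ with local flow $\Phi^{H_m}_t$ on $T^*M\times\mathbb{R}$. Under the assumptions above, the equation $H_m(x,u,Du)=0$ on $M$ has a unique viscosity solution $u_m$, and it is Lipschitz. Let $G_{u_m}$ be the closure in $T^*M\times\mathbb{R}$ of $\{(x,u,p): u_m\text{ is differentiable at }x,\ u=u_m(x),\ p=Du_m(x)\}$. The Aubry set is $\tilde{\mathcal{A}}_{H_m}:=\bigcap_{t\ge0}\Phi^{H_m}_{-t}(G_{u_m})$; it is non-empty, compact and $\Phi^{H_m}_t$-invariant. A Mather measure is a Borel $\Phi^{H_m}_t$-invariant probability measure supported in $\tilde{\mathcal{A}}_{H_m}$. *)

(* Defs.v *)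
From HB Require Import structures.
From mathcomp Require Import all_boot all_order all_algebra.
From mathcomp Require Import all_classical all_reals all_analysis.

Set Implicit Arguments.
Unset Strict Implicit.
Unset Printing Implicit Defensive.

Import Order.TTheory GRing.Theory Num.Theory.
Import numFieldNormedType.Exports.

Local Open Scope classical_set_scope.
Local Open Scope ring_scope.

(* For open U in a finite-dimensional V: f is of class C^k on U. *)
Fixpoint Ck (R : realType) (V W : normedModType R) (k : nat) (U : set V)
    (f : V -> W) : Prop :=
  match k with
  | 0 => forall x, U x -> {for x, continuous f}
  | k'.+1 => (forall x, U x -> differentiable f x) /\
             forall v, Ck k' U (fun x => 'D_v f x)
  end.

Definition grad (R : realType) (n : nat) (f : 'rV[R]_n -> R) (y : 'rV[R]_n)
  : 'rV[R]_n := \row_j 'D_(delta_mx 0 j) f y.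

Definition dotr (R : realType) (n : nat) (a b : 'rV[R]_n) : R :=
  (a *m b^T) 0 0.

(* [chart i] and [ichart i] are total functions; they are meaningful only on
   [dom i] and on its image.  [chart_at] selects a chart around each point: as
   usual, it serves only to name (co)vectors by their coordinates. *)
Record atlas (R : realType) (n : nat) (M : ptopologicalType) := Atlas {
  index : Type;
  dom : index -> set M;
  chart : index -> M -> 'rV[R]_n;
  ichart : index -> 'rV[R]_n -> M;
  chart_at : M -> index;
  dom_chart_at : forall x, dom (chart_at x) x;
  open_dom : forall i, open (dom i);
  open_codom : forall i, open (chart i @` dom i);
  chartK : forall i x, dom i x -> ichart i (chart i x) = x;
  chart_continuous : forall i x, dom i x -> {for x, continuous (chart i)};
  ichart_continuous : forall i x, dom i x ->
    {for chart i x, continuous (ichart i)};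
  transition_smooth : forall i j k,
    Ck k (chart i @` (dom i `&` dom j)) (chart j \o ichart i)
}.

(* Second countability follows from compactness and the existence of charts. *)
Definition closed_connected_manifold (R : realType) (n : nat)
    (M : ptopologicalType) (A : atlas R n M) : Prop :=
  [/\ hausdorff_space M, compact [set: M] & connected [set: M]].

Section Manifold.
Variables (R : realType) (n : nat) (M : ptopologicalType) (A : atlas R n M).
Implicit Types (i j : index A) (x : M) (f : M -> R).

Definition codom i : set 'rV[R]_n := chart i @` dom i.

(* Row vectors: a tangent vector with coordinates [v] in the chart [i] has
   coordinates [v *m transition_jacobian i j x] in the chart [j], and a covector
   with coordinates [p] in [j] has coordinates
   [p *m (transition_jacobian i j x)^T] in [i]. *)
Definition transition_jacobian i j x : 'M[R]_n :=
  'J (chart j \o ichart i) (chart i x).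

Definition CkM (k : nat) f : Prop :=
  forall i, Ck k (codom i) (f \o @ichart _ _ _ A i).

Definition differentiableM f x : Prop :=
  differentiable (f \o ichart (chart_at A x)) (chart (chart_at A x) x).

(* Coordinates of the covector Df(x) in the chart [chart_at A x]. *)
Definition diffM f x : 'rV[R]_n :=
  grad (f \o ichart (chart_at A x)) (chart (chart_at A x) x).

End Manifold.

Arguments codom {R n M A} i.

(* [(x, p)] is the covector at [x] with coordinates [p] in [chart_at A x].  The
   topology is not the product one: it is the one making all the bundle charts
   homeomorphisms onto their open images. *)
Definition cotangent (R : realType) (n : nat) (M : ptopologicalType)
  & atlas R n M : Type := (M * 'rV[R]_n)%type.

Section Cotangent.
Variables (R : realType) (n : nat) (M : ptopologicalType) (A : atlas R n M).

Definition covector (x : M) (p : 'rV[R]_n) : cotangent A := (x, p).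
Definition base (xi : cotangent A) : M := xi.1.
Definition fiber (xi : cotangent A) : 'rV[R]_n := xi.2.

Definition cov_coord (i : index A) (xi : cotangent A) : 'rV[R]_n :=
  fiber xi *m (transition_jacobian i (chart_at A (base xi)) (base xi))^T.

Definition cov_of_coord (i : index A) (y q : 'rV[R]_n) : cotangent A :=
  let x := ichart i y in
  covector x (q *m (transition_jacobian (chart_at A x) i x)^T).

Definition cotangent_open (U : set (cotangent A)) : Prop :=
  forall i, open [set yq : 'rV[R]_n * 'rV[R]_n |
                  codom i yq.1 /\ U (cov_of_coord i yq.1 yq.2)].

HB.instance Definition _ := Choice.copy (cotangent A) (M * 'rV[R]_n)%type.

Fact cotangent_openT : cotangent_open setT.
Proof.
move=> i; rewrite (_ : mkset _ = fst @^-1` codom i).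
  by apply: open_comp => [yq _|]; [exact: cvg_fst|exact: open_codom].
by apply/seteqP; split => [yq []|yq].
Qed.

Fact cotangent_openI : setI_closed cotangent_open.
Proof.
move=> U V oU oV i.
rewrite (_ : mkset _ = [set yq | codom i yq.1 /\ U (cov_of_coord i yq.1 yq.2)]
  `&` [set yq | codom i yq.1 /\ V (cov_of_coord i yq.1 yq.2)]).
  by apply: openI; [exact: oU|exact: oV].
by apply/seteqP; split => [yq [? []]//|yq [[? ?] [_ ?]]].
Qed.

Fact cotangent_open_bigU (I : Type) (U : I -> set (cotangent A)) :
  (forall k, cotangent_open (U k)) -> cotangent_open (\bigcup_k U k).
Proof.
move=> oU i.
rewrite (_ : mkset _ = \bigcup_k
  [set yq | codom i yq.1 /\ U k (cov_of_coord i yq.1 yq.2)]).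
  by apply: bigcup_open => k _; exact: oU.
by apply/seteqP; split => [yq [? [k]]|yq [k _ [? ?]]]; [exists k|split=> //; exists k].
Qed.

HB.instance Definition _ := @isOpenTopological.Build (cotangent A) cotangent_open
  cotangent_openT cotangent_openI cotangent_open_bigU.
HB.instance Definition _ := isPointed.Build (cotangent A) (covector point 0).

End Cotangent.

Arguments base {R n M A} xi.
Arguments fiber {R n M A} xi.
Arguments cov_coord {R n M A} i xi.
Arguments cov_of_coord {R n M A} i y q.
Arguments diffM {R n M} A f x.
Arguments differentiableM {R n M} A f x.
Arguments CkM {R n M} A k f.
Arguments covector {R n M} A x p.

Record riemannian_metric (R : realType) (n : nat) (M : ptopologicalType)
    (A : atlas R n M) := RiemannianMetric {
  (* Gram matrix at [x] in the chart [chart_at A x] *)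
  gram : M -> 'M[R]_n;
  gram_sym : forall x, (gram x)^T = gram x;
  gram_posdef : forall x (v : 'rV[R]_n), v != 0 -> 0 < dotr (v *m gram x) v;
  gram_smooth : forall (i : index A) k, Ck k (codom i) (fun y =>
    let x := ichart i y in
    let J := transition_jacobian i (chart_at A x) x in J *m gram x *m J^T)
}.

(* Measures of the library are functions on all sets; two of them represent the
   same Borel measure as soon as they agree on Borel sets. *)
Notation borel T := (g_sigma_algebraType (@open T)).
Notation borel_probability T R := (probability (borel T) R).

Section Riemannian.
Variables (R : realType) (n : nat) (M : ptopologicalType) (A : atlas R n M).
Variable g : riemannian_metric A.
Local Open Scope ereal_scope.

Definition tangent_norm (x : M) (v : 'rV[R]_n) : R :=
  Num.sqrt (dotr (v *m gram g x) v).

(* Norm dual to [tangent_norm x]. *)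
Definition cotangent_norm (x : M) (p : 'rV[R]_n) : R :=
  Num.sqrt (dotr (p *m invmx (gram g x)) p).

Definition C1_curve (c : R -> M) : Prop :=
  continuous c /\
  forall i : index A, Ck 1 (c @^-1` dom i) (chart i \o c : R^o -> 'rV[R]_n).

Definition velocity (c : R -> M) (t : R) : 'rV[R]_n :=
  (chart (chart_at A (c t)) \o c)^`()%classic t.

Definition curve_length (c : R -> M) : \bar R :=
  \int[@lebesgue_measure R]_(t in `[0%R, 1%R])
    (tangent_norm (c t) (velocity c t))%:E.

Definition riemannian_dist (x y : M) : \bar R :=
  ereal_inf [set curve_length c |
             c in [set c | [/\ C1_curve c, c 0%R = x & c 1%R = y]]].

Definition one_lipschitz (h : M -> R) : Prop :=
  forall x y, `|h x - h y|%:E <= riemannian_dist x y.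

Definition d1 (m1 m2 : borel_probability M R) : \bar R :=
  ereal_sup [set \int[m1]_x (h x)%:E - \int[m2]_x (h x)%:E |
             h in one_lipschitz].

End Riemannian.

Section Assumptions.
Variables (R : realType) (n : nat) (M : ptopologicalType) (A : atlas R n M).
Variable g : riemannian_metric A.
Implicit Types (H : cotangent A * R -> R) (F : M -> borel_probability M R -> R).

(* H in the bundle chart over [chart i] *)
Definition local_ham H (i : index A) (y : 'rV[R]_n) (u : R) (q : 'rV[R]_n) : R :=
  H (cov_of_coord i y q, u).

Definition CkH (k : nat) H : Prop := forall i,
  Ck k [set z : 'rV[R]_n * R * 'rV[R]_n | codom i z.1.1]
       (fun z => local_ham H i z.1.1 z.1.2 z.2 : R^o).

(* Since H is C^3, 'D_v 'D_v is the Hessian in p evaluated at (v, v). *)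
Definition ham_convex H : Prop := forall x u (p v : 'rV[R]_n), v != 0 ->
  0 < 'D_v (fun q => 'D_v (fun q' => H (covector A x q', u)) q : R^o) p.

Definition ham_superlinear H : Prop := forall x u (K : R), exists r : R,
  forall p, r < cotangent_norm g x p ->
    K * cotangent_norm g x p <= H (covector A x p, u).

Definition ham_monotone H : Prop := exists delta lambda : R,
  [/\ 0 < delta, 0 < lambda &
      forall xi u, delta < (fun s => H (xi, s))^`()%classic u <= lambda].

Definition ham_even H : Prop := forall x u p,
  H (covector A x p, u) = H (covector A x (- p), u).

(* The sum of the sup norms of the derivatives of order at most 1 is read as
   |F(., m)|_oo + |D F(., m)|_oo, with the Riemannian norm of the differential. *)
Definition coupling_regular F : Prop :=
  (forall m, CkM A 2 (F^~ m)) /\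
  (ereal_sup [set ereal_sup [set `|F x m|%:E | x in setT] +
                  ereal_sup [set (cotangent_norm g x (diffM A (F^~ m) x))%:E
                            | x in setT]
             | m in setT] < +oo)%E.

(* The first clause also says that [F x m] depends only on the Borel measure
   represented by [m], since [d1 g m1 m2 = 0] when [m1] and [m2] agree on Borel
   sets; such pairs contribute 0 to the supremum. *)
Definition coupling_lipschitz F : Prop :=
  (forall x, exists K : R, forall m1 m2,
     (`|F x m1 - F x m2|%:E <= K%:E * d1 g m1 m2)%E) /\
  (ereal_sup [set r | exists x m1 m2, m1 <> m2 /\
     r = (`|F x m1 - F x m2| / fine (d1 g m1 m2))%:E] < +oo)%E.

End Assumptions.

Section WeakKAM.
Variables (R : realType) (n : nat) (M : ptopologicalType) (A : atlas R n M).
Implicit Types (H : cotangent A * R -> R) (u phi : M -> R).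
Implicit Types (z w : cotangent A * R).

Definition viscosity_subsolution H u : Prop := forall phi x, CkM A 1 phi ->
  (\forall y \near x, u y - phi y <= u x - phi x) ->
  H (covector A x (diffM A phi x), u x) <= 0.

Definition viscosity_supersolution H u : Prop := forall phi x, CkM A 1 phi ->
  (\forall y \near x, u x - phi x <= u y - phi y) ->
  0 <= H (covector A x (diffM A phi x), u x).

(* Viscosity solution of H(x, u, Du) = 0. *)
Definition viscosity_solution H u : Prop :=
  [/\ continuous u, viscosity_subsolution H u & viscosity_supersolution H u].

(* dH/dp, a tangent vector at [x], in coordinates of [chart_at A x] *)
Definition dHdp H x (s : R) (p : 'rV[R]_n) : 'rV[R]_n :=
  grad (fun q => H (covector A x q, s)) p.

Definition contact_ode H (c : R -> cotangent A * R) (t : R) : Prop :=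
  forall i, dom i (base (c t).1) ->
  let L := local_ham H i in
  let y s := chart i (base (c s).1) in
  let q s := cov_coord i (c s).1 in
  let u s := (c s).2 in
  let Lp := grad (L (y t) (u t)) (q t) in
  let Lx := grad (fun y' => L y' (u t) (q t)) (y t) in
  let Lu := (fun s => L (y t) s (q t))^`()%classic (u t) in
  [/\ is_derive (t : R^o) 1 y Lp,
      is_derive (t : R^o) 1 q (- Lx - Lu *: q t) &
      is_derive (t : R^o) 1 (u : R^o -> R^o)
        (dotr Lp (q t) - L (y t) (u t) (q t))].

(* Graph of the local flow: [contact_flow H t z w] means that the time-[t] map
   is defined at [z] and sends it to [w]. *)
Definition contact_flow H (t : R) z w : Prop :=
  exists c : R -> cotangent A * R, [/\ c 0 = z, c t = w &
    exists2 e : R, 0 < e & forall s,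
      Num.min 0 t - e < s < Num.max 0 t + e ->
      {for s, continuous c} /\ contact_ode H c s].

Definition proj_base (z : borel (cotangent A * R)%type) : borel M := base z.1.

Definition one_jet_closure u : set (cotangent A * R) :=
  closure [set z | [/\ differentiableM A u (base z.1),
                       z.2 = u (base z.1) &
                       fiber z.1 = diffM A u (base z.1)]].

Definition aubry_set H u : set (cotangent A * R) :=
  [set w | forall t, 0 <= t ->
     exists2 z, one_jet_closure u z & contact_flow H (- t) z w].

(* [u] is the viscosity solution of H = 0, unique for the Hamiltonians of
   interest.  The preimage under the time-[t] map is that of a partial map. *)
Definition mather_measure H
    (mu : borel_probability (cotangent A * R)%type R) : Prop :=
  exists2 u, viscosity_solution H u &
    mu.-negligible (~` aubry_set H u) /\
    forall (t : R) (B : set (borel (cotangent A * R)%type)), measurable B ->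
      mu [set z | exists2 w, B w & contact_flow H t z w] = mu B.

(* div(m dH/dp(x, u, Du)) = 0 in the sense of distributions *)
Definition continuity_equation H u (m : borel_probability M R) : Prop :=
  {ae m, forall x, differentiableM A u x} /\
  forall phi, CkM A 1 phi ->
    (\int[m]_x (dotr (diffM A phi x) (dHdp H x (u x) (diffM A u x)))%:E = 0)%E.

Definition ham_minus H (F : M -> borel_probability M R -> R)
    (m : borel_probability M R) : cotangent A * R -> R :=
  fun z => H z - F (base z.1) m.

End WeakKAM.

(* Main.v *)
(* Convexity and evenness in p give H(x,u,0) <= H(x,u,p).  For a measure m let c_m(x)
   be the unique solution of H(x, c_m(x), 0) = F(x,m); it is continuous in x and
   Lipschitz in m.  The measure m is chosen as an equilibrium of the game with payoff
   -c_m: m-almost every x minimizes c_m.  On a finite set of points this is a fixed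
   point statement; it passes to the Cantor space by weak compactness along an
   ultrafilter, and to M through a continuous surjection from the Cantor space.

   Let v = min c_m and K = {c_m = v}.  The constant v is a subsolution and Perron's
   method gives a solution u with v <= u <= c_m, which equals v on K.  By monotonicity in u,
   delta (u - v) <= F(x,m) - H(x,v,0), and the right-hand side has a minimum 0 at the
   points of K, so u is differentiable there with Du = 0.  Since dH/dp vanishes at
   p = 0, the continuity equation is trivial, and every (x, v, 0) with x in K is
   a fixed point of the contact flow: the image of m under x |-> (x, v, 0) is
   a Mather measure. *)

From HB Require Import structures.
From mathcomp Require Import all_boot.

Set Implicit Arguments.
Unset Strict Implicit.
Unset Printing Implicit Defensive.

(** * A combinatorial fixed point lemma *)

(** The equilibrium condition is a fixed point condition for the multivalued map that sends m to the
    probabilities carried by the minimizers of c_m. The minimum is used twice: v <= c_m makes the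
    constant v a subsolution, and it makes the nonpositive function x |-> H(x,v,0) - F(x,m) maximal
    on K, which kills both Du and the x-derivative in the equation for p.

    Compactness in the space of measures is reached by elementary means: Scarf's parity argument
    gives approximate equilibria on finite sets, and the limit is taken on the Cantor space because
    a finitely additive content on its clopen sets is sigma-additive by compactness, so that the
    limit probability is a Caratheodory extension. Costs pass to the limit because d1 is a supremum
    over an equicontinuous family, on which weak convergence is uniform.

    Invariance of the Mather measure concerns preimages under a partially defined flow. It is
    therefore not enough that a rest point is a constant orbit: no other orbit may pass through it,
    which is a uniqueness argument of Gronwall type. *)

Section NoBullying.
Variables (X I : finType) (r : I -> X -> nat) (l : X -> I) (i0 : I).
Hypothesis r_inj : forall i, injective (r i).
Local Notation cell := ({set X} * {set I})%type.

(** Scarf's dominance: no point lies strictly above the minimum of [s] in all the orders of [C] at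
    once. *)
Definition dominant (s : {set X}) (C : {set I}) :=
  [forall y, exists i in C, forall x in s, r i y <= r i x].

Definition room (e : cell) := dominant e.1 e.2 && (#|e.1| == #|e.2|).

(* Scarf's pivoting argument: a labelled door lies in an even number of rooms,
   except [(set0, [set i0])], which lies in one; a room [e] with [l @: e.1 != e.2]
   has an even number of labelled doors.  By parity some room has [l @: e.1 = e.2]. *)
Definition labelled_door (d : cell) :=
  [&& dominant d.1 d.2, #|d.2| == #|d.1|.+1, i0 \in d.2 &
      l @: d.1 == d.2 :\ i0].

(** A door has one index more than it has points, so it arises from a room by adding an index or by
    removing a point. *)
Definition incident (d e : cell) :=
  [|| (d.1 == e.1) && [exists i, (i \notin e.2) && (d.2 == i |: e.2)]
    | (d.2 == e.2) && [exists x, (x \notin d.1) && (e.1 == x |: d.1)]].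

Lemma dominantP (s : {set X}) (C : {set I}) :
  reflect (forall y, exists2 i, i \in C & forall x, x \in s -> r i y <= r i x)
          (dominant s C).
Proof.
apply: (iffP forallP) => [h y|h y].
  by have /exists_inP[i iC /forall_inP hi] := h y; exists i.
by have [i iC hi] := h y; apply/exists_inP; exists i => //; apply/forall_inP.
Qed.

Lemma incidentP (d e : cell) :
  incident d e ->
  (exists2 i, i \notin e.2 & d = (e.1, i |: e.2)) \/
  (exists2 x, x \notin d.1 & e = (x |: d.1, d.2)).
Proof.
case: d e => s C [t D] /= /orP[] /andP[/eqP/= <-].
  by move=> /existsP[i /andP[iD /eqP ->]]; left; exists i.
by move=> /existsP[x /andP[xs /eqP ->]]; right; exists x.
Qed.

Lemma incident_index (s : {set X}) (D : {set I}) i : i \notin D -> incident (s, i |: D) (s, D).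
Proof.
by move=> iD; apply/orP; left; rewrite /= eqxx; apply/existsP; exists i; rewrite iD eqxx.
Qed.

Lemma incident_point (s : {set X}) x (C : {set I}) : x \notin s -> incident (s, C) (x |: s, C).
Proof.
by move=> iD; apply/orP; right; rewrite /= eqxx; apply/existsP; exists x; rewrite iD eqxx.
Qed.

Section Door.
Variables (s : {set X}) (C : {set I}) (x0 : X).
Hypotheses (domC : dominant s C) (cardC : #|C| = #|s|.+1) (x0s : x0 \in s).

Let mn i := [arg min_(x < x0 in s) r i x].

Let mn_in i : mn i \in s.
Proof. by rewrite /mn; case: arg_minnP. Qed.

Let mn_le i x : x \in s -> r i (mn i) <= r i x.
Proof. by rewrite /mn; case: arg_minnP => // y ys h; exact: h. Qed.

Let mnP i x : x \in s -> (forall y, y \in s -> r i x <= r i y) -> x = mn i.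
Proof.
move=> xs h; apply: (r_inj (i := i)); apply/eqP; rewrite eqn_leq h//=.
exact: mn_le.
Qed.

Let mn_surj : mn @: C = s.
Proof.
apply/setP => y; apply/imsetP/idP => [[i _ ->]//|ys].
by have [i iC hi] := dominantP _ _ domC y; exists i => //; exact: mnP.
Qed.

(** The obstructions to the dominance of [(s, C :\ j)]. *)
Let A j := [set y | [forall i in C :\ j, r i (mn i) < r i y]].

(** The door is left through the index [j]. If [(s, C :\ j)] is dominant, [j] is dropped; otherwise
    the obstruction that is highest for [j] is added, since with a lower one the highest would
    violate dominance. *)
Let other j : cell :=
  match [pick x in A j] with
  | Some x => ([arg max_(y > x in A j) r j y] |: s, C)
  | None => (s, C :\ j)
  end.

(** [mn] maps [C] onto [s] and [C] has one index more, so exactly two indices [i1] and [i2] share a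
    minimizer. A room through the door is obtained at an index [j] off which [mn] is injective,
    hence is [other i1] or [other i2]. *)
Lemma door_rooms : odd #|[set e | room e && incident (s, C) e]| = false.
Proof.
have [i1 [i2 [i1C i2C i12 mn12]]] : exists i1 i2,
    [/\ i1 \in C, i2 \in C, i1 != i2 & mn i1 = mn i2].
  have : ~~ [forall i in C, forall j in C, (mn i == mn j) ==> (i == j)].
    apply/negP => /forall_inP h.
    have /card_in_imset : {in C &, injective mn}.
      by move=> i j iC jC /eqP e; move/forall_inP: (h i iC) => /(_ j jC); rewrite e /= => /eqP.
    by rewrite mn_surj cardC => /eqP; rewrite ltn_eqF.
  rewrite negb_forall_in => /exists_inP[i iC]; rewrite negb_forall_in => /exists_inP[j jC].
  by rewrite negb_imply => /andP[/eqP e ij]; exists i, j.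
have surjD (j : I) : j \in C -> (j == i1) || (j == i2) -> mn @: (C :\ j) = s.
  move=> jC hj; apply/eqP; rewrite eqEsubset; apply/andP; split.
    by apply/subsetP => y /imsetP[i _ ->].
  apply/subsetP => y; rewrite -mn_surj => /imsetP[i iC ->].
  have [->|ij] := eqVneq i j; last by apply: imset_f; rewrite !inE ij.
  case/orP: hj => /eqP ->.
    by rewrite mn12; apply: imset_f; rewrite !inE eq_sym i12.
  by rewrite -mn12; apply: imset_f; rewrite !inE i12.
have cardD (j : I) : j \in C -> #|C :\ j| = #|s|.
  by move=> jC; move: cardC; rewrite (cardsD1 j) jC => -[].
have injD (j : I) : j \in C -> mn @: (C :\ j) = s -> {in C :\ j &, injective mn}.
  by move=> jC e; apply/imset_injP; rewrite e cardD.
have inj12 (j : I) : {in C :\ j &, injective mn} -> (j == i1) || (j == i2).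
  move=> h; apply/negPn/negP; rewrite negb_or => /andP[j1 j2].
  move/eqP: i12; apply; apply: h => //; rewrite !inE ?i1C ?i2C andbT eq_sym //.
have AP j y : reflect (forall i, i \in C -> i != j -> r i (mn i) < r i y) (y \in A j).
  rewrite inE; apply: (iffP forall_inP) => h i.
    by move=> iC ij; apply: h; rewrite !inE ij.
  by rewrite !inE => /andP[ij iC]; exact: h.
(* An obstruction fails dominance at every index but [j], so the dominance of [(s, C)] places it
   below [s] in the order [j]. *)
have Adom j x : j \in C -> x \in A j -> forall y, y \in s -> r j x <= r j y.
  move=> jC /AP xA y ys; have [i iC hi] := dominantP _ _ domC x.
  have [<-|ij] := eqVneq i j; first exact: hi.
  by have := xA i iC ij; rewrite ltnNge hi // mn_in.
have As j x : (j == i1) || (j == i2) -> j \in C -> x \in A j -> x \notin s.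
  move=> hj jC /AP xA; apply/negP; rewrite -(surjD j jC hj) => /imsetP[i].
  by rewrite !inE => /andP[ij iC] xE; have := xA i iC ij; rewrite xE ltnn.
have otherP j : (j == i1) || (j == i2) -> j \in C ->
    room (other j) && incident (s, C) (other j).
  move=> hj jC; rewrite /other; case: pickP => [x xA|A0].
    case: arg_maxnP => // z zA zmax.
    have zs := As j z hj jC zA.
    rewrite incident_point // andbT /room /= cardsU1 zs cardC eqxx andbT.
    apply/dominantP => y; have [yA|yA] := boolP (y \in A j).
      exists j => // t; rewrite !inE => /predU1P[->|ts]; first exact: zmax.
      exact: leq_trans (zmax _ yA) (Adom _ _ jC zA _ ts).
    move: yA; rewrite inE negb_forall_in => /exists_inP[i].
    rewrite !inE => /andP[ij iC]; rewrite -leqNgt => yi; exists i => // t.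
    rewrite !inE => /predU1P[->|ts]; last exact: leq_trans yi (mn_le _ ts).
    by apply: leq_trans yi _; apply: ltnW; exact: (elimT (AP j z) zA).
  have jD : j \notin C :\ j by rewrite !inE eqxx.
  rewrite -[X in incident (s, X)](setD1K jC) incident_index // andbT.
  rewrite /room /= cardD // eqxx andbT; apply/dominantP => y.
  move: (A0 y); rewrite inE => /negbT; rewrite negb_forall_in => /exists_inP[i iC].
  by rewrite -leqNgt => yi; exists i => // t ts; exact: leq_trans yi (mn_le _ ts).
have otherI e : room e && incident (s, C) e -> exists2 j, (j == i1) || (j == i2) & e = other j.
  case: e => t D /andP[/andP[/= domt /eqP cardt]] /incidentP[[i iD [st CE]]|[x xs [tE DE]]].
    rewrite /= in iD st CE; subst t.
    have iC : i \in C by rewrite CE setU11.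
    have DE : D = C :\ i by rewrite CE setU1K.
    have sD : mn @: D = s.
      apply/setP => y; apply/imsetP/idP => [[k _ ->]//|ys].
      by have [k kC hk] := dominantP _ _ domt y; exists k => //; exact: mnP.
    have hi : (i == i1) || (i == i2) by apply: inj12; apply: injD => //; rewrite -DE.
    exists i => //; rewrite /other; case: pickP => [y /AP yA|]; last by rewrite DE.
    have [k] := dominantP _ _ domt y; rewrite DE !inE => /andP[ki kC] hk.
    by have := yA k kC ki; rewrite ltnNge hk.
  rewrite /= in xs tE DE; subst t D.
  have xns y : y \in s -> y != x by apply: contraTneq => ->.
  (* At this index the added point [x] is the strict minimum of the room, so each point of [s] must
     be the minimizer for one of the remaining indices. *)
  have [j jC hj] := dominantP _ _ domt x.
  have xj y : y \in s -> r j x < r j y.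
    move=> ys; rewrite ltn_neqAle hj ?inE ?ys ?orbT // andbT.
    by apply/eqP => /r_inj xy; have := xns _ ys; rewrite xy eqxx.
  have key y : y \in s -> exists2 k, k \in C :\ j & y = mn k /\ r k y < r k x.
    move=> ys; have [k kC hk] := dominantP _ _ domt y.
    have yx : r k y <= r k x by apply: hk; rewrite !inE eqxx.
    exists k; last split.
    - rewrite !inE kC andbT; apply: contraTneq yx => ->.
      by rewrite -ltnNge xj.
    - by apply: mnP => // z zs; apply: hk; rewrite !inE zs orbT.
    - by rewrite ltn_neqAle yx andbT; apply/eqP => /r_inj yxE; have := xns _ ys; rewrite yxE eqxx.
  have sE : mn @: (C :\ j) = s.
    apply/setP => y; apply/imsetP/idP => [[k _ ->]//|ys].
    by have [k kC [-> _]] := key y ys; exists k.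
  have inj := injD _ jC sE.
  have hj' : (j == i1) || (j == i2) by apply: inj12.
  have xA : x \in A j.
    apply/AP => i iC ij; have iD : i \in C :\ j by rewrite !inE ij.
    have [k kD [e lt]] := key (mn i) (mn_in i).
    by move: lt; rewrite -(inj i k iD kD e).
  exists j => //; rewrite /other; case: pickP => [y yA|/(_ x)]; last by rewrite xA.
  case: arg_maxnP => // z zA zmax; congr (_ |: _, _).
  apply: (r_inj (i := j)); apply/eqP; rewrite eqn_leq; apply/andP; split; first exact: zmax.
  have [i iC hi] := dominantP _ _ domt z.
  have [ij|ij] := eqVneq i j; first by rewrite -ij; apply: hi; rewrite !inE eqxx.
  have := elimT (AP _ _) zA i iC ij; rewrite ltnNge hi // !inE mn_in orbT //.
have -> : [set e | room e && incident (s, C) e] = [set other i1; other i2].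
  apply/setP => e; rewrite !inE; apply/idP/idP.
    by move=> /otherI[j /orP[]/eqP -> ->]; rewrite eqxx ?orbT.
  by case/orP => /eqP ->; apply: otherP; rewrite ?eqxx ?orbT.
rewrite cards2; suff -> : other i1 != other i2 by [].
apply/eqP; rewrite /other.
case: pickP => [x xA|_]; case: pickP => [y yA|_].
- case: arg_maxnP => // z zA _; case: arg_maxnP => // t tA _ [] /setP zt.
  have /eqP zs : z == t.
    have := zt z; rewrite !inE eqxx /=.
    by rewrite (negbTE (As i1 z _ i1C zA)) ?eqxx // orbF => /esym.
  (* A point added on both sides would lie strictly above the minimum of [s] in every order of
     [C]. *)
  rewrite -zs in tA; have [i iC hi] := dominantP _ _ domC z.
  have [ii1|ii1] := eqVneq i i1.
    by have := elimT (AP _ _) tA i iC; rewrite ii1 i12 => /(_ isT); rewrite ltnNge -ii1 hi.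
  by have := elimT (AP _ _) zA i iC ii1; rewrite ltnNge hi.
- case: arg_maxnP => // z zA _ [] _ /setP/(_ i2); rewrite !inE eqxx i2C //.
- case: arg_maxnP => // z zA _ [] _ /setP/(_ i1); rewrite !inE eqxx i1C //.
- by move=> [] /setP/(_ i1); rewrite !inE eqxx i12 i1C.
Qed.

End Door.

(** The candidates are the empty cell, which is not dominant since [X] is inhabited, and the cells
    [([set x], [set i0])], which are dominant only for the highest [x] in the order [i0]. *)
Lemma empty_door_rooms (x0 : X) : odd #|[set e | room e && incident (set0, [set i0]) e]|.
Proof.
pose z := [arg max_(y > x0) r i0 y].
have zmax y : r i0 y <= r i0 z by rewrite /z; case: arg_maxnP => // t _; exact.
suff -> : [set e | room e && incident (set0, [set i0]) e] = [set ([set z], [set i0])].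
  by rewrite cards1.
apply/setP => -[t D]; rewrite !inE; apply/idP/idP => [|/eqP[-> ->]].
  move=> /andP[/andP[/= domt /eqP cardt]] /incidentP[[i /= iD [tE DE]]|[x /= _ [tE DE]]].
    have [k kD _] := dominantP _ _ domt x0.
    by move: cardt; rewrite -tE cards0 => /esym/cards0_eq D0; rewrite D0 inE in kD.
  rewrite setU0 in tE; rewrite tE DE in domt *; apply/eqP; congr (_, _); congr [set _].
  apply: (r_inj (i := i0)); apply/eqP; rewrite eqn_leq zmax /=.
  by have [k] := dominantP _ _ domt z; rewrite inE => /eqP -> /(_ x); rewrite inE eqxx; apply.
rewrite /room /= !cards1 eqxx andbT; apply/andP; split.
  apply/dominantP => y; exists i0; rewrite ?inE // => x; rewrite inE => /eqP ->; exact: zmax.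
by have := @incident_point set0 z [set i0]; rewrite setU0 inE; exact.
Qed.

(** When a labelled door exists, the labels of the room are [D :\ i0] and at most one more. If there
    is an extra label [i] outside [D], then [l] is injective on the room and the two doors add [i]
    to [D] or remove the point labelled [i]. If there is none, exactly one label occurs twice and
    the two doors remove either of its points. *)
Lemma room_doors (e : cell) : room e -> l @: e.1 != e.2 ->
  odd #|[set d | labelled_door d && incident d e]| = false.
Proof.
case: e => t D /andP[/= domt /eqP cardt] lt.
have [i0D|i0D] := boolP (i0 \in D); last first.
  suff -> : [set d | labelled_door d && incident d (t, D)] = set0 by rewrite cards0.
  apply/setP => -[s C]; rewrite !inE; apply/negP.
  move=> /andP[/and4P[/= _ _ i0C /eqP ls]] /incidentP[[i /= iD [tE DE]]|[x /= _ [tE DE]]].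
    subst s C; move: i0C; rewrite !inE (negbTE i0D) orbF => /eqP ii.
    by move/eqP: lt; apply; rewrite ls -ii setU1K.
  by rewrite DE i0C in i0D.
have doorI i : i \notin D -> l @: t = i |: D :\ i0 ->
    labelled_door (t, i |: D) && incident (t, i |: D) (t, D).
  move=> iD lE; rewrite incident_index // andbT; apply/and4P; split => /=.
  - apply/dominantP => y; have [k kD hk] := dominantP _ _ domt y.
    by exists k; rewrite ?inE ?kD ?orbT.
  - by rewrite cardsU1 iD cardt.
  - by rewrite !inE i0D orbT.
  - rewrite lE; apply/eqP/setP => k; rewrite !inE.
    by have [->|] := eqVneq k i; rewrite //= andbT; apply/esym; apply: contraNneq iD => ->.
have doorX x : x \in t -> l @: (t :\ x) = D :\ i0 ->
    labelled_door (t :\ x, D) && incident (t :\ x, D) (t, D).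
  move=> xt lE; rewrite -{3}(setD1K xt) incident_point ?andbT ?inE ?eqxx //.
  apply/and4P; split => //=; last by rewrite lE.
    apply/dominantP => y; have [k kD hk] := dominantP _ _ domt y.
    by exists k => // z; rewrite !inE => /andP[_ zt]; exact: hk.
  by rewrite -cardt (cardsD1 x) xt.
have cardD : #|t| = #|D :\ i0|.+1 by rewrite cardt (cardsD1 i0) i0D.
have doorP d : labelled_door d && incident d (t, D) ->
    (exists i, [/\ i \notin D, l @: t = i |: D :\ i0 & d = (t, i |: D)]) \/
    (exists x, [/\ x \in t, l @: (t :\ x) = D :\ i0 & d = (t :\ x, D)]).
  case: d => s C /andP[/and4P[/= _ _ i0C /eqP ls]].
  move=> /incidentP[[i /= iD [tE DE]]|[x /= xs [tE DE]]].
    left; exists i; subst s C; split => //; rewrite ls; apply/setP => k; rewrite !inE.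
    by have [->|] := eqVneq k i; rewrite //= andbT; apply: contraNneq iD => ->.
  right; exists x; subst t C; rewrite setU1K //; split => //.
  by rewrite !inE eqxx.
have [/existsP[i /andP[iD /eqP lE]]|noi] :=
    boolP [exists i, (i \notin D) && (l @: t == i |: D :\ i0)].
  have iD0 : i \notin D :\ i0 by rewrite inE negb_and iD orbT.
  have linj : {in t &, injective l} by apply/imset_injP; rewrite lE cardsU1 iD0 cardD.
  have /imsetP[x xt xi] : i \in l @: t by rewrite lE setU11.
  have lx : l @: (t :\ x) = D :\ i0.
    apply/setP => k; apply/imsetP/idP => [[y]|kD].
      rewrite inE => /andP[yx yt] ->; have : l y \in i |: D :\ i0 by rewrite -lE imset_f.
      rewrite inE => /orP[]; rewrite // inE xi => /eqP/linj yxE.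
      by move: yx; rewrite inE yxE ?eqxx.
    have : k \in l @: t by rewrite lE inE kD orbT.
    move=> /imsetP[y yt kE]; exists y => //; rewrite !inE yt andbT.
    by apply: contraNneq iD0 => yx; rewrite xi -yx -kE.
  suff -> : [set d | labelled_door d && incident d (t, D)] = [set (t, i |: D); (t :\ x, D)].
    rewrite cards2; suff -> : (t, i |: D) != (t :\ x, D) by [].
    by apply/eqP => -[/setP/(_ x)]; rewrite !inE eqxx xt.
  apply/setP => d; rewrite in_set in_set2; apply/idP/idP; last first.
    by case/orP => /eqP ->; [exact: doorI|exact: doorX].
  case/doorP => [[k [kD kE ->]]|[y [yt yE ->]]]; apply/orP; [left|right].
    have : i \in k |: D :\ i0 by rewrite -kE lE setU11.
    by rewrite !inE (negbTE iD) andbF orbF => /eqP ->.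
  suff -> : y = x by [].
  apply/eqP/negPn/negP => yx; move/negP: iD0; apply; rewrite -yE xi imset_f //.
  by rewrite !inE xt eq_sym yx.
have [d0 hd0|no] := pickP (fun d => labelled_door d && incident d (t, D)); last first.
  suff -> : [set d | labelled_door d && incident d (t, D)] = set0 by rewrite cards0.
  by apply/setP => d; rewrite !inE no.
have noi' i : i \notin D -> l @: t = i |: D :\ i0 -> False.
  by move=> iD lE; move/negP: noi; apply; apply/existsP; exists i; rewrite iD lE eqxx.
case/doorP: hd0 => [[i [iD lE _]]|[x [xt xE _]]]; first by case: (noi' i).
have lt1 : l @: t = l x |: D :\ i0 by rewrite -xE -imsetU1 setD1K.
have lxD : l x \in D :\ i0.
  rewrite !inE; apply/andP; split.
    by apply: contraNneq lt => lx; rewrite lt1 lx setD1K.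
  by apply/negPn/negP => /noi'; apply.
have inj y : y \in t -> l @: (t :\ y) = D :\ i0 -> {in t :\ y &, injective l}.
  move=> yt yE; apply/imset_injP; rewrite yE.
  by move: cardD; rewrite (cardsD1 y t) yt => /eqP; rewrite add1n eqSS eq_sym.
have /imsetP[x'] : l x \in l @: (t :\ x) by rewrite xE.
rewrite !inE => /andP[x'x x't] lxx'.
have x'E : l @: (t :\ x') = D :\ i0.
  rewrite -xE; apply/setP => k; apply/imsetP/imsetP => -[y];
    rewrite !inE => /andP[yx yt] ->.
    have [->|yx'] := eqVneq y x; first by exists x' => //; rewrite !inE x'x.
    by exists y => //; rewrite !inE yx'.
  have [->|yx'] := eqVneq y x'; first by exists x; rewrite ?inE ?xt 1?eq_sym ?x'x.
  by exists y => //; rewrite !inE yx'.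
suff -> : [set d | labelled_door d && incident d (t, D)] = [set (t :\ x', D); (t :\ x, D)].
  rewrite cards2; suff -> : (t :\ x', D) != (t :\ x, D) by [].
  by apply/eqP => -[/setP/(_ x)]; rewrite !inE eqxx xt eq_sym x'x.
apply/setP => d; rewrite in_set in_set2; apply/idP/idP; last first.
  by case/orP => /eqP ->; exact: doorX.
case/doorP => [[k [kD kE _]]|[y [yt yE ->]]]; first by case: (noi' k).
have [->|yx] := eqVneq y x; first by rewrite eqxx orbT.
have [->|yx'] := eqVneq y x'; first by rewrite eqxx.
move/eqP: x'x; case; apply: (inj y yt yE); rewrite ?inE ?x't ?xt 1?eq_sym ?yx' ?yx //.
Qed.

(** A discrete substitute for Brouwer's fixed point theorem. The sum [N] counts incident pairs of a
    labelled door and a room, by doors and by rooms. *)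
Theorem no_bullying (x0 : X) : exists (s : {set X}) (C : {set I}),
  [/\ C != set0, l @: s = C &
    forall y, exists2 i, i \in C & forall x, x \in s -> r i y <= r i x].
Proof.
have [e /andP[re /eqP le]|no] := pickP (fun e => room e && (l @: e.1 == e.2)).
  exists e.1, e.2; move: re => /andP[/dominantP dome _]; split => //.
  by apply/set0Pn; have [i iC _] := dome x0; exists i.
pose N := \sum_(d | labelled_door d) #|[set e | room e && incident d e]|.
have NE : N = \sum_(e | room e) #|[set d | labelled_door d && incident d e]|.
  rewrite /N; under eq_bigr do rewrite -sum1dep_card big_mkcondr.
  rewrite exchange_big /=; apply: eq_bigr => e _.
  by rewrite -sum1dep_card [RHS]big_mkcondr.
have oddsum (J : finType) (P : pred J) (f : J -> nat) :
    odd (\sum_(j | P j) f j) = \big[addb/false]_(j | P j) odd (f j).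
  by apply: (big_morph odd oddD).
have : odd N = false.
  rewrite NE oddsum; apply: big1 => e re; apply: room_doors => //.
  by have := no e; rewrite re /= => ->.
have d0 : labelled_door (set0, [set i0]).
  apply/and4P; split => //=; last 2 first.
  - by rewrite inE.
  - by rewrite imset0 eq_sym setD_eq0.
  - by apply/dominantP => y; exists i0; rewrite ?inE // => x; rewrite inE.
  - by rewrite cards1 cards0.
rewrite oddsum (bigD1 _ d0) /= (empty_door_rooms x0) big1 //.
case=> s C /andP[/and4P[/= domC /eqP cardC i0C lE]] ne.
(* If [s] is empty, then [C] is a singleton containing [i0]: this is the exceptional door, which is
   excluded here. *)
have [s0|/set0Pn[x xs]] := eqVneq s set0; last exact: (@door_rooms s C x).
move/eqP: ne; case; congr (_, _) => //; move: cardC; rewrite s0 cards0 => /eqP/cards1P[i CE].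
by move: i0C; rewrite CE inE => /eqP ->.
Qed.

End NoBullying.

From mathcomp Require Import all_order all_algebra.
From mathcomp Require Import zify ring lra.

Import Order.TTheory GRing.Theory Num.Theory.

Local Open Scope ring_scope.

(** * Approximate equilibria on finite sets *)

Section ApproximateEquilibrium.
Variables (R : archiRealFieldType) (n : nat).
Implicit Types (a b : 'I_n.+1 -> R).

Definition in_simplex a := (forall i, 0 <= a i) /\ \sum_i a i = 1.

Variables (V : 'I_n.+1 -> ('I_n.+1 -> R) -> R) (L : R).
Hypothesis L0 : 0 <= L.
Hypothesis V_lip : forall i a b, in_simplex a -> in_simplex b ->
  `|V i a - V i b| <= L * \sum_j `|a j - b j|.

Section Grid.
Variable m : nat.
Hypothesis m0 : (0 < m)%N.

Definition grid := {f : {ffun 'I_n.+1 -> 'I_m.+1} | (\sum_i f i == m)%N}.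
Implicit Types x y : grid.

Let coord x (i : 'I_n.+1) : nat := val x i.
Let weight x (i : 'I_n.+1) : R := (coord x i)%:R / m%:R.

Let coord_sum x : (\sum_i coord x i = m)%N.
Proof. exact: (eqP (valP x)). Qed.

Let weight_simplex x : in_simplex (weight x).
Proof.
split=> [i|]; first by rewrite divr_ge0.
by rewrite /weight -mulr_suml -natr_sum coord_sum divff // pnatr_eq0 -lt0n.
Qed.

Lemma grid_point (y : 'I_n.+1 -> nat) : (\sum_i y i = m)%N -> exists x, forall i, coord x i = y i.
Proof.
move=> ym; have ylt i : (y i < m.+1)%N by rewrite ltnS -ym (bigD1 i) //= leq_addr.
have h : (\sum_i [ffun i => Ordinal (ylt i)] i == m)%N.
  by apply/eqP; rewrite -[RHS]ym; apply: eq_bigr => i _; rewrite ffunE.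
by exists (exist _ [ffun i => Ordinal (ylt i)] h) => i; rewrite /coord /= ffunE.
Qed.

(* Ties in a coordinate are broken by the enumeration of the grid, which makes
   each of the preference orders injective. *)
Let rank (i : 'I_n.+1) x : nat := (coord x i * #|{: grid}| + enum_rank x)%N.

Let rank_inj i : injective (rank i).
Proof.
move=> x y; rewrite /rank => h; apply: enum_rank_inj; apply: val_inj => /=.
have hx := ltn_ord (enum_rank x); have hy := ltn_ord (enum_rank y); move: h hx hy.
move: (coord x i) (coord y i) (enum_rank x : nat) (enum_rank y : nat) => a b c d h hc hd.
have : ((a * #|{: grid}| + c) %% #|{: grid}| = (b * #|{: grid}| + d) %% #|{: grid}|)%N by rewrite h.
by rewrite !modnMDl !modn_small.
Qed.

Let rank_coord i x y : (rank i y <= rank i x)%N -> (coord y i <= coord x i)%N.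
Proof.
rewrite /rank => h; rewrite leqNgt; apply/negP => lt; move: h; rewrite leqNgt => /negP; apply.
have hx := ltn_ord (enum_rank x); apply: leq_trans (leq_addr _ _).
apply: leq_trans (_ : (coord x i).+1 * #|{: grid}| <= _)%N; last by rewrite leq_mul2r lt orbT.
by rewrite mulSn addnC ltn_add2r.
Qed.

(** A grid point is labelled by an index of least cost. In the set [s] given by [no_bullying], the
    minimal coordinates over [C] sum to [m] up to [n.+1] units, so the points of [s] agree up to
    [n.+1] units in each coordinate. An index in [C] has least cost at some point of [s], hence
    almost least cost at [z]; an index outside [C] has small weight at [z]. *)
Lemma grid_equilibrium : exists a, in_simplex a /\
  forall i j, V i a <= V j a + 2 * L * (n.+1 * n.+1)%:R / m%:R \/ a i <= n.+1%:R / m%:R.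
Proof.
pose l x := [arg min_(i < ord0) V i (weight x)]%O.
have lP x j : V (l x) (weight x) <= V j (weight x).
  by rewrite /l; case: arg_minP => // i _ h; exact: h.
have y0m : (\sum_(i < n.+1) (if i == ord0 then m else 0) = m)%N.
  by rewrite -big_mkcond big_pred1_eq.
have [x0 _] := grid_point y0m.
have [s [C [C0 lC dom]]] := no_bullying l ord0 rank_inj x0.
have [i1 i1C] : exists i, i \in C by exact/set0Pn.
have [z zs] : exists z, z \in s by move: i1C; rewrite -lC => /imsetP[z zs _]; exists z.
pose mn i := coord [arg min_(x < z in s) coord x i] i.
have mnP i x : x \in s -> (mn i <= coord x i)%N.
  by rewrite /mn; case: arg_minnP => // t _ h; exact: h.
have mnE i : exists2 x, x \in s & coord x i = mn i.
  by rewrite /mn; case: arg_minnP => // t ts _; exists t.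
(* Otherwise one could raise all the minima over [C] by one unit, give the remaining mass [e] to
   [i1], and get a grid point above [s] in every order of [C]. *)
have sumC : (m < \sum_(i in C) (mn i).+1)%N.
  rewrite ltnNge; apply/negP => le.
  pose e := (m - \sum_(i in C) (mn i).+1)%N.
  have [y yE] : exists y, forall i, coord y i =
      ((if i \in C then (mn i).+1 else 0) + (if i == i1 then e else 0))%N.
    apply: grid_point; rewrite big_split /= -big_mkcond -[X in (_ + X)%N]big_mkcond /=.
    by rewrite big_pred1_eq subnKC.
  have [i iC hi] := dom y; have [x xs xE] := mnE i.
  have := rank_coord (hi x xs); rewrite yE iC xE addSn.
  by rewrite ltnNge leq_addr.
have cardC : (#|C| <= n.+1)%N by rewrite -[X in (_ <= X)%N]card_ord max_card.
have {}sumC : (m < \sum_(i in C) mn i + n.+1)%N.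
  apply: leq_trans sumC _; under eq_bigr do rewrite -addn1.
  by rewrite big_split /= sum1_card leq_add2l.
have excess x : x \in s -> (\sum_(i in C) (coord x i - mn i) + \sum_(i in ~: C) coord x i < n.+1)%N.
  move=> xs; have := coord_sum x; rewrite (bigID (fun i => i \in C)) /=.
  have -> : (\sum_(i | i \in C) coord x i =
      \sum_(i in C) (coord x i - mn i) + \sum_(i in C) mn i)%N.
    by rewrite -big_split /=; apply: eq_bigr => i _; rewrite subnK // mnP.
  have -> : (\sum_(i | i \notin C) coord x i = \sum_(i in ~: C) coord x i)%N.
    by apply: eq_bigl => i; rewrite inE.
  move: sumC; move: (\sum_(i in C) mn i)%N (\sum_(i in C) (coord x i - mn i))%N.
  by move: (\sum_(i in ~: C) coord x i)%N => a b c h; lia.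
have inC x i : x \in s -> i \in C -> (coord x i <= mn i + n)%N.
  move=> xs iC; have := excess x xs; rewrite (bigD1 i iC) /=; lia.
have outC x i : x \in s -> i \notin C -> (coord x i <= n)%N.
  move=> xs iC; have := excess x xs; rewrite [X in (_ + X)%N](bigD1 i) ?inE //=; lia.
have close x y i : x \in s -> y \in s -> `|weight x i - weight y i| <= n.+1%:R / m%:R.
  move=> xs ys; rewrite /weight -mulrBl normrM normfV (ger0_norm (ler0n R m)) ler_wpM2r ?invr_ge0 //.
  have hx : (coord x i <= coord y i + n.+1)%N.
    have [iC|iC] := boolP (i \in C); last by have := outC x i xs iC; lia.
    by have := inC x i xs iC; have := mnP i y ys; lia.
  have hy : (coord y i <= coord x i + n.+1)%N.
    have [iC|iC] := boolP (i \in C); last by have := outC y i ys iC; lia.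
    by have := inC y i ys iC; have := mnP i x xs; lia.
  have hx' : (coord x i)%:R <= (coord y i)%:R + n.+1%:R :> R by rewrite -natrD ler_nat.
  have hy' : (coord y i)%:R <= (coord x i)%:R + n.+1%:R :> R by rewrite -natrD ler_nat.
  rewrite ler_norml; lra.
exists (weight z); split; first exact: weight_simplex.
move=> i j; have [iC|iC] := boolP (i \in C); last first.
  right; rewrite /weight ler_wpM2r ?invr_ge0 // ler_nat.
  by apply: leq_trans (outC z i zs iC) _.
left; have /imsetP[x xs il] : i \in l @: s by rewrite lC.
(* There are [n.+1] coordinates, each changing by at most [n.+1%:R / m%:R]. The bound is used for
   [V i] and for [V j], whence the factor 2 in the statement. *)
have hsum : L * \sum_k `|weight z k - weight x k| <= L * (n.+1 * n.+1)%:R / m%:R.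
  rewrite -mulrA ler_wpM2l //.
  apply: le_trans (ler_sum _ (fun k _ => close z x k zs xs)) _.
  by rewrite sumr_const card_ord -[X in X <= _]mulr_natl natrM mulrA.
have h1 := V_lip i (weight_simplex z) (weight_simplex x).
have h2 := V_lip j (weight_simplex z) (weight_simplex x).
have := lP x j; rewrite -il; move: h1 h2; rewrite !ler_norml; lra.
Qed.

End Grid.

Theorem approximate_equilibrium eta : 0 < eta -> exists a, in_simplex a /\
  forall i j, V i a <= V j a + eta \/ a i <= eta.
Proof.
move=> eta0.
(* [K / m] bounds both error terms of [grid_equilibrium]. *)
pose K := 2 * L * (n.+1 * n.+1)%:R + n.+1%:R.
have K0 : 0 < K by rewrite ltr_wpDl ?ltr0n // mulr_ge0 // mulr_ge0.
pose m := Num.bound (K / eta).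
have Km : K / eta < m%:R by apply: archi_boundP; rewrite divr_ge0 ?ltW.
have m0 : 0 < m%:R :> R by apply: le_lt_trans Km; rewrite divr_ge0 ?ltW.
have mn0 : (0 < m)%N by rewrite -(ltr0n R).
have [a [aS ha]] := grid_equilibrium mn0.
have Keta : K / m%:R <= eta by rewrite ler_pdivrMr // mulrC -ler_pdivrMr // ltW.
have h1 : 2 * L * (n.+1 * n.+1)%:R / m%:R <= eta.
  by apply: le_trans Keta; rewrite ler_pM2r ?invr_gt0 // lerDl.
have h2 : n.+1%:R / m%:R <= eta.
  by apply: le_trans Keta; rewrite ler_pM2r ?invr_gt0 // lerDr mulr_ge0 // mulr_ge0.
exists a; split => // i j; have [h|h] := ha i j; [left|right]; last exact: le_trans h h2.
by apply: le_trans h _; rewrite lerD2l.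
Qed.

End ApproximateEquilibrium.

From mathcomp Require Import all_classical all_reals all_analysis.
From mathcomp Require Import measurable_realfun.
Require Import Defs.

Import numFieldNormedType.Exports.

Local Open Scope classical_set_scope.
Local Open Scope ring_scope.

(** * Weak compactness on the Cantor space *)

Lemma ultralimit (R : realType) (I : Type) (U : set_system I) (f : I -> R) a b :
  UltraFilter U -> (forall i, a <= f i <= b) ->
  exists l : R, f @ U --> l.
Proof.
move=> UU fab; have UP : ProperFilter U by exact: ultra_proper.
have fF : (f @ U) `[a, b]%classic by apply: (@filterE _ U) => i; rewrite /= in_itv; exact: fab.
have [l [_ lc]] := @segment_compact R a b _ (fmap_proper_filter f UP) fF.
exists l => N lN; have [//|nN] := in_ultra_setVsetC (f @^-1` N) UU.
by have [x [xN /xN]] := lc (~` N) N nN lN.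
Qed.

Lemma cvgr_unique (R : realType) (I : Type) (F : set_system I) {FF : ProperFilter F}
    (f : I -> R) (a b : R) : f @ F --> a -> f @ F --> b -> a = b.
Proof.
by move=> fa fb; rewrite -(cvg_lim (@Rhausdorff R) fa) -(cvg_lim (@Rhausdorff R) fb).
Qed.

(** A copy of the Cantor space whose algebra of sets consists of the clopen ones; contents live here
    before they are extended to the generated sigma-algebra. *)
Definition clopen_space : Type := cantor_space.
HB.instance Definition _ := Pointed.on clopen_space.

Lemma clopen_setC (T : topologicalType) : setC_closed (@clopen T).
Proof. by move=> B; exact: clopenC. Qed.

HB.instance Definition _ := @isAlgebraOfSets.Build default_measure_display
  clopen_space (@clopen cantor_space) clopen0 (@clopenU _) (@clopen_setC _).

Notation cantor_measurable := (g_sigma_algebraType (@measurable _ clopen_space)).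

(** The same product seen as a pseudometric space over [R], the form in which second countability
    follows from compactness. *)
Definition cantor_metric (R : realType) : Type :=
  prod_topology (fun _ : nat => (bool : pseudoPMetricType R)).
HB.instance Definition _ (R : realType) := Pointed.copy (cantor_metric R) cantor_space.
HB.instance Definition _ (R : realType) := PseudoMetric.copy (cantor_metric R)
  (prod_topology (fun _ : nat => (bool : pseudoPMetricType R))).

Lemma cantor_second_countable (R : realType) : @second_countable cantor_space.
Proof. by apply: (@compact_second_countable R (cantor_metric R)); exact: cantor_space_compact. Qed.

Lemma clopen_measurable (B : set cantor_space) :
  clopen B -> measurable (B : set cantor_measurable).
Proof. by move=> cB; exact: sub_sigma_algebra. Qed.

Lemma clopen_nbhs (b : cantor_space) (O : set cantor_space) : nbhs b O ->
  exists D, [/\ clopen D, D b & D `<=` O].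
Proof.
move=> bO; have [D [Db cD] DO] := zero_dimensional_cvg cantor_space_hausdorff
  cantor_zero_dimensional cantor_space_compact bO.
by exists D.
Qed.

(** There are countably many clopen sets and they form a basis, so an open set is a countable union
    of clopen ones. *)
Lemma open_cantor_measurable (R : realType) (O : set cantor_space) : open O ->
  measurable (O : set cantor_measurable).
Proof.
move=> oO; have cc := clopen_countable cantor_space_compact (@cantor_second_countable R).
pose D := [set B : set cantor_space | clopen B /\ B `<=` O].
have cD : countable D by apply: sub_countable cc; apply: subset_card_le => B [].
have -> : O = \bigcup_(B in D) B.
  apply/seteqP; split => [b Ob|b [B [_ BO] /BO//]].
  have [B [cB Bb BO]] := clopen_nbhs (open_nbhs_nbhs (conj oO Ob)).
  by exists B.
have /countable_injP[f finj] := cD.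
have -> : \bigcup_(B in D) B = \bigcup_k \bigcup_(B in D `&` [set B | f B = k]) B.
  apply/seteqP; split => [b [B DB Bb]|b [k _ [B [DB _] Bb]]]; last by exists B.
  by exists (f B) => //; exists B.
apply: bigcupT_measurable => k.
have [[B [DB fB]]|no] := pselect (exists B, D B /\ f B = k); last first.
  rewrite (_ : \bigcup_(B in _) B = set0); first exact: measurable0.
  by apply/seteqP; split => // b [B [DB fB] _]; apply: no; exists B.
rewrite (_ : \bigcup_(B in _) B = B).
  by apply: clopen_measurable; case: DB.
apply/seteqP; split => [b [B' [DB' fB'] B'b]|b Bb]; last by exists B.
by rewrite -(finj B' B) ?inE // fB fB'.
Qed.

Lemma open_preimage_measurable_fun (R : realType) (d : measure_display)
    (T : measurableType d) (f : T -> R) :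
  (forall O : set R, open O -> measurable (f @^-1` O)) -> measurable_fun setT f.
Proof.
move=> h; apply: (measurability _ (measurable_realfun.RGenOpens.measurableE R)) => _ [_ [x [y ->]] <-].
by rewrite setTI; apply: h; exact: interval_open.
Qed.

Lemma continuous_cantor_measurable (R : realType) (f : cantor_space -> R) :
  continuous f -> measurable_fun setT (f : cantor_measurable -> R).
Proof.
move=> cf; apply: open_preimage_measurable_fun => O oO.
by apply: (@open_cantor_measurable R); apply: open_comp => // b _; exact: cf.
Qed.

(** * Limits of probabilities along an ultrafilter *)

Section LimitMeasure.
Variables (R : realType) (I : Type) (U : set_system I).
Hypothesis UU : UltraFilter U.
Variable P : I -> probability cantor_measurable R.

Let UP : ProperFilter U := ultra_proper.

Lemma prob_ultralimit (B : set cantor_measurable) : measurable B ->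
  exists l : R, fine (P i B) @[i --> U] --> l.
Proof.
move=> mB; apply: (@ultralimit R I U _ 0 1) => i; have le1 := probability_le1 (P i) mB.
have f : P i B \is a fin_num by rewrite ge0_fin_numE // (le_lt_trans le1) ?ltry.
by rewrite fine_ge0 //= -lee_fin fineK.
Qed.

(** The value 0 off the clopen sets only makes the function total. On a clopen set the limit exists
    because masses lie in [0, 1]. *)
Definition content_lim (B : set clopen_space) : \bar R :=
  if `[< clopen (B : set cantor_space) >] then (lim (fine (P i B) @[i --> U]))%:E else 0%E.

Lemma content_lim_cvg (B : set cantor_space) : clopen B ->
  fine (P i B) @[i --> U] --> fine (content_lim B).
Proof.
move=> cB; rewrite /content_lim asboolT //=.
have [l hl] := prob_ultralimit (clopen_measurable cB).
exact: cvgP hl.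
Qed.

Lemma content_limE (B : set cantor_space) : clopen B ->
  content_lim B = (fine (content_lim B))%:E.
Proof. by move=> cB; rewrite /content_lim asboolT. Qed.

Lemma content_lim0 : content_lim set0 = 0%E.
Proof.
rewrite content_limE; last exact: clopen0; congr (_%:E).
have := content_lim_cvg clopen0; under eq_fun do rewrite measure0.
by move=> h; apply: (cvgr_unique h); exact: cvg_cst.
Qed.

Lemma content_lim_ge0 (B : set clopen_space) : (0 <= content_lim B)%E.
Proof.
have [cB|cB] := pselect (clopen (B : set cantor_space)); last first.
  by rewrite /content_lim asboolF.
rewrite content_limE // lee_fin; apply: (cvgr_to_ge (content_lim_cvg cB)).
by apply: nearW => i; rewrite fine_ge0.
Qed.

(** A disjoint sequence of clopen sets with clopen, hence compact, union has only finitely many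
    nonempty members. Sigma-additivity thus reduces to finite additivity, which passes to the
    limit. *)
Lemma content_lim_sigma_additive : semi_sigma_additive (content_lim : set clopen_space -> _).
Proof.
move=> F mF tF mUF.
have cUF : clopen (\bigcup_i F i : set cantor_space) by [].
have [N hN] : exists N, forall k, (N <= k)%N -> F k = set0.
  have : compact (\bigcup_i F i : set cantor_space).
    by apply: subclosed_compact cantor_space_compact _ => //; case: cUF.
  rewrite compact_cover => /(_ nat setT F) [i _|//|D _ Dcov].
    by have [] : clopen (F i : set cantor_space) by exact: mF.
  exists (\max_(i <- finmap.enum_fset D) i).+1 => k kD; apply/seteqP; split => // b Fkb.
  have [i /= iD Fib] := Dcov b (ex_intro2 _ _ k Logic.I Fkb).
  have ik : i = k by apply: (tF i k) => //; exists b.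
  move: kD; rewrite -ik ltnNge => /negP; apply.
  exact: (@leq_bigmax_seq _ (finmap.enum_fset D) xpredT id i).
apply: cvg_near_cst; exists N => // n /= Nn.
rewrite big_mkord.
have cF i : clopen (F i : set cantor_space) by exact: mF.
rewrite content_limE //; under eq_bigr do rewrite content_limE //.
rewrite sumEFin; congr (_%:E).
have h1 := content_lim_cvg cUF.
have h2 : (\sum_(i < n) fine (P j (F i))) @[j --> U] --> \sum_(i < n) fine (content_lim (F i)).
  by apply: (@cvg_big _ _ +%R 0 xpredT add_continuous _ U) => i _; exact: content_lim_cvg.
apply: (cvgr_unique h2); apply: cvg_trans h1; apply: near_eq_cvg; apply: nearW => j.
have -> : \bigcup_i F i = \big[setU/set0]_(i < n) F i.
  rewrite -bigcup_mkord; apply/seteqP; split => b [i _ Fib]; exists i => //=.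
  by rewrite ltnNge; apply/negP => ni; move: Fib; rewrite hN // (leq_trans Nn).
have mF' i : measurable (F i : set cantor_measurable) by exact: clopen_measurable.
rewrite measure_bigsetU // sum_fine // => i _.
rewrite ge0_fin_numE //; apply: le_lt_trans (probability_le1 (P j) (mF' i)) _.
by rewrite ltry.
Qed.

HB.instance Definition _ := isMeasure.Build _ _ _ content_lim
  content_lim0 content_lim_ge0 content_lim_sigma_additive.

Definition limit_measure : set cantor_measurable -> \bar R := measure_extension content_lim.

HB.instance Definition _ := Measure.on limit_measure.

Lemma limit_measureE (B : set cantor_space) : clopen B -> limit_measure B = content_lim B.
Proof. by move=> cB; rewrite /limit_measure /measure_extension /= measurable_mu_extE. Qed.

Lemma limit_measureT : limit_measure setT = 1%E.
Proof.
rewrite limit_measureE; last exact: clopenT.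
rewrite content_limE; last exact: clopenT; congr (_%:E).
have := content_lim_cvg clopenT; under eq_fun do rewrite probability_setT.
by move=> h; apply: (cvgr_unique h); exact: cvg_cst.
Qed.

HB.instance Definition _ := Measure_isProbability.Build _ _ _ limit_measure limit_measureT.

Theorem cantor_weak_compactness : exists Q : probability cantor_measurable R,
  forall B : set cantor_space, clopen B -> fine (P i B) @[i --> U] --> fine (Q B).
Proof.
exists (limit_measure : probability cantor_measurable R) => B cB.
have := content_lim_cvg cB; congr (_ --> _); exact: (congr1 fine (esym (limit_measureE cB))).
Qed.

End LimitMeasure.

Section Expectation.
Context (d : measure_display) (T : measurableType d) (R : realType).
Implicit Types (P : probability T R) (h : T -> R).

Lemma prob_fin_num P (B : set T) : measurable B -> P B \is a fin_num.
Proof.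
move=> mB; rewrite ge0_fin_numE //; apply: le_lt_trans (probability_le1 P mB) _.
by rewrite ltry.
Qed.

Lemma bounded_integrable P (D : set T) h b : measurable D -> measurable_fun setT h ->
  (forall x, `|h x| <= b) -> P.-integrable D (EFin \o h).
Proof.
move=> mD mh hb; apply: measurable_bounded_integrable => //.
- by apply: le_lt_trans (probability_le1 P mD) _; rewrite ltry.
- exact: measurable_funS mh.
- by exists b; split; [rewrite num_real|move=> M bM x _ /=; exact: le_trans (hb x) (ltW bM)].
Qed.

Lemma Rintegral_bigsetU P n (C : nat -> set T) h b : (forall k, measurable (C k)) ->
  trivIset setT C -> measurable_fun setT h -> (forall x, `|h x| <= b) ->
  Rintegral P (\big[setU/set0]_(k < n) C k) h = \sum_(k < n) Rintegral P (C k) h.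
Proof.
move=> mC tC mh hb; elim: n => [|n IH]; first by rewrite !big_ord0 Rintegral_set0.
have mU : measurable (\big[setU/set0]_(k < n) C k) by exact: bigsetU_measurable.
rewrite !big_ord_recr /= Rintegral_setU ?IH //.
- by apply: bounded_integrable hb => //; exact: measurableU.
- apply/disj_setPS => x [+ Cx]; rewrite -bigcup_mkord => -[k /= kn Ckx].
  have kE : k = n by apply: (tC k n) => //; exists x.
  by rewrite kE ltnn in kn.
Qed.

Lemma Rintegral_near_step P n (C : nat -> set T) (v : nat -> R) h b e :
  (forall k, measurable (C k)) -> trivIset setT C -> \big[setU/set0]_(k < n) C k = setT ->
  measurable_fun setT h -> (forall x, `|h x| <= b) ->
  (forall k x, C k x -> `|h x - v k| <= e) ->
  `|Rintegral P setT h - \sum_(k < n) v k * fine (P (C k))| <= e.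
Proof.
move=> mC tC CT mh hb hv.
have sP : \sum_(k < n) fine (P (C k)) = 1.
  rewrite sum_fine; last by move=> k _; exact: prob_fin_num.
  by rewrite -measure_bigsetU // CT; exact: (congr1 fine (probability_setT P)).
rewrite -CT (Rintegral_bigsetU P n mC tC mh hb) -sumrB.
apply: le_trans (ler_norm_sum _ _ _) _.
rewrite -[leRHS]mulr1 -sP mulr_sumr; apply: ler_sum => k _.
have ih : P.-integrable (C k) (EFin \o h) by exact: bounded_integrable hb.
have ic (a : R) : P.-integrable (C k) (EFin \o cst a).
  exact: (@bounded_integrable P _ (cst a) `|a|).
rewrite -Rintegral_cst // -RintegralB //; last exact: ic.
have mhv : measurable_fun setT (fun x => h x - v k) by exact: measurable_funB.
have ihv : P.-integrable (C k) (EFin \o (fun x => h x - v k)).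
  apply: (@bounded_integrable P _ _ (b + `|v k|)) => // x.
  by apply: le_trans (ler_normB _ _) _; rewrite lerD2r.
apply: le_trans (le_normr_Rintegral _ ihv) _ => //.
rewrite -Rintegral_cst //; apply: le_Rintegral => //; [|exact: (ic e)|exact: hv].
apply: (@bounded_integrable P _ (fun x => `|h x - v k|) (b + `|v k|)) => // [|x].
  exact: measurableT_comp.
by rewrite normr_id; apply: le_trans (ler_normB _ _) _; rewrite lerD2r.
Qed.

End Expectation.

(** * Uniform weak convergence on equicontinuous families *)

Section WeakConvergence.
Variable R : realType.
Implicit Types (H : set (cantor_space -> R)).

Definition equicontinuous_family (T : topologicalType) (H : set (T -> R)) :=
  forall x e, 0 < e -> \forall y \near x, forall h, H h -> `|h y - h x| <= e.

Lemma equicontinuous_continuous (T : topologicalType) (H : set (T -> R)) h :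
  equicontinuous_family H -> H h -> continuous h.
Proof.
move=> eH Hh x; apply/cvgrPdist_le => e e0; apply: filterS (eH x e e0) => y /(_ h Hh).
by rewrite distrC.
Qed.

(** One finite partition serves the whole family: equicontinuity gives a clopen neighbourhood of
    each point on which all members are nearly constant, and compactness leaves finitely many of
    them. *)
Lemma clopen_partition H e : 0 < e -> equicontinuous_family H ->
  exists n (C : nat -> set cantor_space) (c : nat -> cantor_space),
    [/\ forall k, clopen (C k), trivIset setT C, \big[setU/set0]_(k < n) C k = setT
      & forall k b, C k b -> forall h, H h -> `|h b - h (c k)| <= e].
Proof.
move=> e0 eH.
have hD b : exists D : set cantor_space, [/\ clopen D, D b &
    forall b', D b' -> forall h, H h -> `|h b' - h b| <= e].
  by have [D [cD Db DO]] := clopen_nbhs (eH b e e0); exists D.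
have [D /all_and3[cD Db DO]] := choice hD.
have := cantor_space_compact; rewrite compact_cover => /(_ _ setT D).
case=> [b _|b _|S _ Scov]; [by have [] := cD b|by exists b|].
pose s := finmap.enum_fset S.
(* The sets are empty past the end of the list, so that they form a sequence, which [seqDU] then
   makes disjoint. *)
pose F k := if (k < size s)%N then D (nth point s k) else set0.
have cF k : clopen (F k) by rewrite /F; case: ifP => _; [exact: cD|exact: clopen0].
have cC k : clopen (seqDU F k).
  rewrite /seqDU setDE; apply: clopenI; first exact: cF.
  apply: (clopenC setT); elim: k => [|k IH]; first by rewrite big_ord0; exact: clopen0.
  by rewrite big_ord_recr; exact: clopenU.
exists (size s), (seqDU F), (nth point s); split => //.
- rewrite -bigsetU_seqDU; apply/seteqP; split => // b _.
  have [a aS Dab] := Scov b Logic.I; rewrite -bigcup_mkord.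
  have /(nthP point)[k ks ak] : a \in s by exact: aS.
  by exists k => //=; rewrite /F ks ak.
- move=> k b [Fkb _]; apply: DO; move: Fkb; rewrite /F; case: ifP => //.
Qed.

(** All members of the family are close to step functions on the same partition, so uniformity only
    asks that finitely many clopen masses be close. *)
Lemma family_weak_convergence (I : Type) (U : set_system I) (FU : ProperFilter U)
    (P : I -> probability cantor_measurable R) (Q : probability cantor_measurable R) H b e :
  (forall B : set cantor_space, clopen B -> fine (P i B) @[i --> U] --> fine (Q B)) ->
  equicontinuous_family H -> (forall h x, H h -> `|h x| <= b) -> 0 < e ->
  \forall i \near U, forall h, H h -> `|Rintegral (P i) setT h - Rintegral Q setT h| <= e.
Proof.
move=> PQ eH Hb e0.
have e3 : 0 < e / 3 by lra.
have [n [C [c [cC tC CT hC]]]] := clopen_partition e3 eH.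
have mC k : measurable (C k : set cantor_measurable) by exact: clopen_measurable.
pose s i := \sum_(k < n) `|fine (P i (C k)) - fine (Q (C k))|.
have sE : s i @[i --> U] --> (0 : R).
  have -> : (0 : R) = \sum_(k < n) 0 by rewrite big1.
  apply: (@cvg_big _ _ +%R 0 xpredT add_continuous _ U) => k _.
  have h : fine (P i (C k)) - fine (Q (C k)) @[i --> U] --> (0 : R).
    by rewrite -(subrr (fine (Q (C k)))); apply: cvgB; [exact: PQ|exact: cvg_cst].
  by have hn := cvg_norm h; rewrite normr0 in hn; exact: hn.
(* One third of [e] goes to the change of masses, weighted by values of [h] of size at most [b]; the
   two others go to the step approximations under [P i] and [Q]. *)
have d0 : 0 < e / 3 / (`|b| + 1) by rewrite divr_gt0 // ltr_wpDl.
have sU : \forall i \near U, s i < e / 3 / (`|b| + 1) by apply: (cvgr_lt _ sE).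
apply: filterS sU => i si h Hh.
have mh : measurable_fun setT (h : cantor_measurable -> R).
  by apply: continuous_cantor_measurable; exact: equicontinuous_continuous Hh.
have hb x : `|h x| <= b by exact: Hb.
have step (P' : probability cantor_measurable R) :
    `|Rintegral P' setT h - \sum_(k < n) h (c k) * fine (P' (C k))| <= e / 3.
  exact: (@Rintegral_near_step _ cantor_measurable R P' n C (fun k => h (c k)) h b (e / 3)
    mC tC CT mh hb (fun k x Ckx => hC k x Ckx h Hh)).
have st : `|\sum_(k < n) h (c k) * fine (P i (C k)) - \sum_(k < n) h (c k) * fine (Q (C k))| <= e / 3.
  rewrite -sumrB; apply: le_trans (ler_norm_sum _ _ _) _.
  apply: (@le_trans _ _ (\sum_(k < n) (`|b| + 1) * `|fine (P i (C k)) - fine (Q (C k))|)).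
    apply: ler_sum => k _; rewrite -mulrBr normrM ler_wpM2r //.
    by apply: le_trans (hb _) _; apply: le_trans (ler_norm b) _; rewrite lerDl.
  rewrite -mulr_sumr -ler_pdivlMl; last by rewrite ltr_wpDl.
  by rewrite mulrC ltW.
have := step (P i); have := step Q; move: st; rewrite !ler_norml; lra.
Qed.

End WeakConvergence.

(** * Equilibria on the Cantor space *)

Section Discrete.
Context (d : measure_display) (T : measurableType d) (R : realType).

Lemma Rintegral_shift (P : probability T R) (h : T -> R) b : measurable_fun setT h ->
  (forall x, `|h x| <= b) ->
  Rintegral P setT (fun x => h x + b) = Rintegral P setT h + b.
Proof.
move=> mh hb; rewrite RintegralD //; last 2 first.
- exact: bounded_integrable hb.
- exact: (@bounded_integrable _ _ _ P setT (cst b) `|b|).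
rewrite Rintegral_cst //; congr (_ + _).
have -> : fine (P setT) = 1 by exact: (congr1 fine (probability_setT P)).
by rewrite mulr1.
Qed.

Lemma discrete_probability n (x : 'I_n.+1 -> T) (a : 'I_n.+1 -> R) : in_simplex a ->
  exists P : probability T R, forall (h : T -> R) (b : R), measurable_fun setT h -> (forall t, `|h t| <= b) ->
    Rintegral P setT h = \sum_i a i * h (x i).
Proof.
move=> [a0 a1].
pose m (k : nat) : {measure set T -> \bar R} :=
  mscale (NngNum (a0 (inord k))) (dirac (x (inord k))).
pose mu : {measure set T -> \bar R} := msum m n.+1.
have muT : mu setT = 1%E.
  rewrite /mu /= /msum /=; under eq_bigr => k _.
    rewrite /m /= /mscale /= diracT mule1; over.
  rewrite sumEFin; congr (_%:E); rewrite -a1; apply: eq_bigr => k _.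
  by rewrite inord_val.
(* The total mass is already 1: normalization leaves [mu] unchanged and supplies the structure of a
   probability. *)
exists (mnormalize mu (dirac (x ord0))) => h b mh hb.
have PE : (mnormalize mu (dirac (x ord0)) : set T -> \bar R) = mu.
  by apply/funext => B; rewrite /mnormalize muT /= onee_eq0 /= invr1 mule1.
have key (f : T -> R) : measurable_fun setT f -> (forall t, 0 <= f t) ->
    Rintegral (mnormalize mu (dirac (x ord0))) setT f = \sum_i a i * f (x i).
  move=> mf f0; rewrite /Rintegral.
  have -> : (\int[mnormalize mu (dirac (x ord0))]_t (f t)%:E)%E = (\int[mu]_t (f t)%:E)%E.
    by rewrite PE.
  have mf' : measurable_fun setT (fun t => (f t)%:E) by exact/measurable_EFinP.
  rewrite ge0_integral_measure_sum //; last by move=> t _; rewrite lee_fin.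
  rewrite (eq_bigr (fun k : 'I_n.+1 => (a k * f (x k))%:E)) ?sumEFin // => k _.
  rewrite ge0_integral_mscale //; last by move=> t _; rewrite lee_fin.
  by rewrite integral_dirac //= diracT mul1e inord_val.
(* The formula is known for nonnegative functions; the bounded function [h] is shifted by [b]. *)
have := Rintegral_shift (mnormalize mu (dirac (x ord0))) mh hb.
rewrite key; last 2 first.
- by apply: measurable_funD.
- by move=> t; have := hb t; rewrite ler_norml; lra.
under eq_bigr do rewrite mulrDr.
by rewrite big_split /= -mulr_suml a1 mul1r => /addIr ->.
Qed.

End Discrete.

Lemma Rintegral_eq0_null (d : measure_display) (T : measurableType d) (R : realType)
    (P : probability T R) (f : T -> R) b : measurable_fun setT f -> (forall x, 0 <= f x) ->
  (forall x, f x <= b) -> Rintegral P setT f <= 0 -> P [set x | 0 < f x] = 0%E.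
Proof.
move=> mf f0 fb hI.
have fi : P.-integrable setT (EFin \o f).
  by apply: (@bounded_integrable _ _ _ P setT f b) => // x; rewrite ger0_norm.
have I0 : Rintegral P setT f = 0.
  by apply/eqP; rewrite eq_le hI /=; exact: Rintegral_ge0.
have mf' : measurable_fun setT (EFin \o f) by exact/measurable_EFinP.
have : (\int[P]_x `|(EFin \o f) x| = 0)%E.
  rewrite (eq_integral (EFin \o f)); last by move=> x _ /=; rewrite ger0_norm.
  have fn : (\int[P]_x (EFin \o f) x)%E \is a fin_num by exact: integrable_fin_num.
  by rewrite -(fineK fn); congr (_%:E).
move=> /(ae_eq_integral_abs P measurableT mf') [N [mN PN fN]].
have mS : measurable [set x | 0 < f x].
  rewrite (_ : mkset _ = f @^-1` `]0, +oo[%classic).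
    by rewrite -[X in measurable X]setTI; exact: mf.
  by apply/seteqP; split => x /=; rewrite in_itv /= andbT.
apply/eqP; rewrite eq_le measure_ge0 andbT -PN; apply: le_measure; rewrite ?inE //.
move=> x /= fx; apply: fN => /(_ Logic.I) [e]; by rewrite e ltxx in fx.
Qed.

Section CantorEquilibrium.
Variables (R : realType) (V : cantor_space -> probability cantor_measurable R -> R).
Variables (H : set (cantor_space -> R)) (b K : R).
Hypothesis V_continuous : forall P, continuous (V^~ P).
Hypothesis H_equi : equicontinuous_family H.
Hypothesis H_bounded : forall h x, H h -> `|h x| <= b.
Hypotheses (b0 : 0 <= b) (K0 : 0 <= K).
Hypothesis V_lipschitz : forall (P Q : probability cantor_measurable R) e, 0 <= e ->
  (forall h, H h -> `|Rintegral P setT h - Rintegral Q setT h| <= e) ->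
  forall x, `|V x P - V x Q| <= K * e.

(** The game restricted to probabilities on a finite list. Light atoms weigh at most [eta / n.+1%:R]
    each, so that together they weigh at most [eta]. *)
Lemma finite_equilibrium (s : seq cantor_space) (eta : R) : 0 < eta ->
  exists n (x : 'I_n.+1 -> cantor_space) (a : 'I_n.+1 -> R) (P : probability cantor_measurable R),
  [/\ in_simplex a,
      forall (h : cantor_space -> R) (c : R), continuous h -> (forall t, `|h t| <= c) ->
        Rintegral P setT h = \sum_i a i * h (x i)
    & forall y, y \in s -> forall i, V (x i) P <= V y P + eta \/ a i <= eta / n.+1%:R].
Proof.
(* Prepending [point] makes the list of atoms nonempty. *)
move=> eta0; pose n := size s; pose x (i : 'I_n.+1) := nth point (point :: s) i.
(* Weights outside the simplex get a dummy Dirac mass, so that [choice] yields a total function of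
   the weights. *)
have D (a : 'I_n.+1 -> R) : exists P : probability cantor_measurable R, in_simplex a ->
    forall (h : cantor_space -> R) (c : R), continuous h -> (forall t, `|h t| <= c) ->
    Rintegral P setT h = \sum_i a i * h (x i).
  have [aS|aS] := pselect (in_simplex a); last by exists (dirac point).
  have [P hP] := @discrete_probability _ cantor_measurable R n x a aS.
  by exists P => _ h c ch; apply: hP; exact: continuous_cantor_measurable.
have [P hP] := choice D.
have lip i (a a' : 'I_n.+1 -> R) : in_simplex a -> in_simplex a' ->
    `|V (x i) (P a) - V (x i) (P a')| <= K * b * \sum_j `|a j - a' j|.
  move=> aS aS'; rewrite -mulrA; apply: V_lipschitz.
    by rewrite mulr_ge0 // sumr_ge0.
  move=> h Hh; have ch := equicontinuous_continuous H_equi Hh.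
  have hb t : `|h t| <= b by exact: H_bounded.
  rewrite (hP a aS h b ch hb) (hP a' aS' h b ch hb) -sumrB.
  apply: le_trans (ler_norm_sum _ _ _) _; rewrite mulr_sumr; apply: ler_sum => j _.
  by rewrite -mulrBl normrM mulrC ler_wpM2r.
have eta' : 0 < eta / n.+1%:R by rewrite divr_gt0.
have [a [aS ha]] := @approximate_equilibrium R n (fun i a => V (x i) (P a)) (K * b)
  (mulr_ge0 K0 b0) lip _ eta'.
exists n, x, a, (P a); split => // [|y ys i]; first exact: hP.
have /(nthP point)[k ks yk] := ys.
have kn : (k.+1 < n.+1)%N by [].
have [h|h] := ha i (Ordinal kn); [left|by right].
apply: le_trans h _; rewrite {1}/x /= yk lerD2l ler_pdivrMr ?ltr0n //.
by rewrite ler_peMr ?ler1n // ltW.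
Qed.

(** Approximate equilibria are indexed by a list and a precision, and [Q] is their limit along an
    ultrafilter of growing indices. A minimizer [z] of [V^~ Q] eventually belongs to the list, so
    heavy atoms cost little more than [z]; hence the excess cost has integral 0 under [Q]. *)
Theorem cantor_equilibrium : exists (Q : probability cantor_measurable R) (v : R),
  (forall x, v <= V x Q) /\ Q [set x | v < V x Q] = 0%E.
Proof.
pose I := (seq cantor_space * nat)%type.
have fin (i : I) : exists P : probability cantor_measurable R, exists n
    (x : 'I_n.+1 -> cantor_space) (a : 'I_n.+1 -> R),
  [/\ in_simplex a,
      forall (h : cantor_space -> R) (c : R), continuous h -> (forall t, `|h t| <= c) ->
        Rintegral P setT h = \sum_j a j * h (x j)
    & forall y, y \in i.1 -> forall j, V (x j) P <= V y P + i.2.+1%:R^-1 \/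
        a j <= i.2.+1%:R^-1 / n.+1%:R].
  have e0 : (0 : R) < i.2.+1%:R^-1 by rewrite invr_gt0.
  by have [n [x [a [P h]]]] := finite_equilibrium i.1 e0; exists P, n, x, a.
have [P hP] := choice fin.
(* The sections of the directed set of lists and precisions: a set is large if it contains all
   indices beyond some [(s, k)]. *)
pose F : set_system I := [set S | exists (s : seq cantor_space) (k : nat), forall i : I,
  (forall y, y \in s -> y \in i.1) ->
  (k <= i.2)%N -> S i].
have FP : ProperFilter F.
  apply: Build_ProperFilter.
    by move=> [s [k h]]; exact: (h (s, k)).

  split.
  - by exists [::], 0%N.
  - move=> S S' [s [k h]] [s' [k' h']]; exists (s ++ s'), (maxn k k') => i si.
    rewrite geq_max => /andP[ki ki']; split; [apply: h|apply: h'] => // y ys;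
      by apply: si; rewrite mem_cat ys ?orbT.
  - by move=> S S' SS' [s [k h]]; exists s, k => i si ki; apply: SS'; exact: h.
have [U [UU FU]] := ultraFilterLemma FP.
have UP : ProperFilter U by exact: ultra_proper.
have [Q PQ] := cantor_weak_compactness UU P.
have [z _ zmin] := @compact_EVT_min cantor_space R (V^~ Q) setT (ex_intro _ point Logic.I)
  cantor_space_compact (continuous_subspaceT (@V_continuous Q)).
have [t _ tmax] := @compact_EVT_max cantor_space R (V^~ Q) setT (ex_intro _ point Logic.I)
  cantor_space_compact (continuous_subspaceT (@V_continuous Q)).
have {}zmin x : V z Q <= V x Q by apply: zmin; rewrite inE.
have {}tmax x : V x Q <= V t Q by apply: tmax; rewrite inE.
exists Q, (V z Q); split => //.
pose f x := V x Q - V z Q; pose c := V t Q - V z Q.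
have f0 x : 0 <= f x by rewrite subr_ge0.
have fc x : f x <= c by rewrite lerD2r.
have cf : continuous f by move=> x; apply: cvgB; [exact: V_continuous|exact: cvg_cst].
have fn x : `|f x| <= c by rewrite ger0_norm.
have -> : [set x | V z Q < V x Q] = [set x | 0 < f x].
  by apply/seteqP; split => x /=; rewrite subr_gt0.
apply: (@Rintegral_eq0_null _ cantor_measurable R Q f c) => //.
  exact: continuous_cantor_measurable.
have c0 : 0 <= c by exact: le_trans (f0 z) (fc z).
(* The constant collects [2 * K] for replacing [P i] by [Q] at [x j] and at [z], 1 for the precision
   of the equilibrium, [c] for the light atoms, and 1 for the weak convergence of the integral of
   [f]. *)
suff h e : 0 < e -> Rintegral Q setT f <= (2 * K + c + 2) * e.
  apply/ler_addgt0Pl => e e0; rewrite addr0.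
  have k0 : 0 < 2 * K + c + 2 by rewrite ltr_wpDl // addr_ge0 // mulr_ge0.
  by have := h (e / (2 * K + c + 2)) (divr_gt0 e0 k0); rewrite mulrC divfK // gt_eqF.
move=> e0.
have w1 : \forall i \near U, forall h, H h -> `|Rintegral (P i) setT h - Rintegral Q setT h| <= e.
  exact: (@family_weak_convergence R I U UP P Q H b e PQ H_equi H_bounded e0).
have w2 : \forall i \near U, forall h, [set f] h ->
    `|Rintegral (P i) setT h - Rintegral Q setT h| <= e.
  apply: (@family_weak_convergence R I U UP P Q [set f] c e PQ) => //; last by move=> h x ->.
  move=> x e' e'0; have /cvgrPdist_le/(_ _ e'0) := cf x; apply: filterS => y hy h ->.
  by rewrite distrC.
have w3 : \forall i \near U, z \in i.1 /\ i.2.+1%:R^-1 <= e.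
  apply: FU; exists [:: z], (Num.bound e^-1) => i si ki; split; first by apply: si; rewrite inE.
  rewrite -[leRHS]invrK lef_pV2 ?posrE ?invr_gt0 ?ltr0n //.
  apply: le_trans (_ : (Num.bound e^-1)%:R <= _); last by rewrite ler_nat ltnW.
  by apply/ltW/archi_boundP; rewrite invr_ge0 ltW.
have [i [h1 [h2 [zi ie]]]] := filter_ex (filterI w1 (filterI w2 w3)).
have [n [x [a [[a0 a1] Ea good]]]] := hP i.
have dV y : `|V y (P i) - V y Q| <= K * e by apply: V_lipschitz => //; exact: ltW.
have hf := h2 f erefl; rewrite (Ea f c cf fn) in hf.
have term j : a j * f (x j) <= a j * ((2 * K + 1) * e) + e / n.+1%:R * c.
  have [g|g] := good z zi j.
    have {}g : V (x j) (P i) <= V z (P i) + e by apply: le_trans g _; rewrite lerD2l.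
    have fj : f (x j) <= (2 * K + 1) * e.
      by have := dV (x j); have := dV z; rewrite /f !ler_norml; lra.
    apply: le_trans (ler_wpM2l (a0 j) fj) _; rewrite lerDl.
    by rewrite mulr_ge0 // divr_ge0 // ltW.
  apply: le_trans (_ : e / n.+1%:R * c <= _); last first.
    by rewrite lerDr mulr_ge0 // mulr_ge0 ?(ltW e0) // addr_ge0 // mulr_ge0.
  apply: ler_pM => //; apply: le_trans g _.
  by rewrite ler_pM2r ?invr_gt0 ?ltr0n.
have : \sum_j a j * f (x j) <= \sum_j (a j * ((2 * K + 1) * e) + e / n.+1%:R * c).
  by apply: ler_sum => j _; exact: term.
rewrite big_split /= -mulr_suml a1 mul1r sumr_const card_ord.
have -> : e / n.+1%:R * c *+ n.+1 = e * c.
  by rewrite -mulr_natr mulrAC divfK // pnatr_eq0.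
by move: hf; rewrite ler_norml; lra.
Qed.

End CantorEquilibrium.

(** * Calculus of C^k maps *)

Lemma continuous_at_comp (U V W : topologicalType) (f : U -> V) (g : V -> W) x :
  {for x, continuous f} -> {for f x, continuous g} ->
  {for x, continuous (fun y => g (f y))}.
Proof. by move=> fx gx; exact: (cvg_comp _ _ fx gx). Qed.

Section Calculus.
Variable R : realType.

Lemma near_eq_is_diff (V W : normedModType R) (f g : V -> W) (df : V -> W) x :
  (\forall y \near x, f y = g y) -> is_diff x f df -> is_diff x g df.
Proof.
move=> fg [dfx <-].
have gE : g \o shift x = cst (g x) + 'd f x +o_ 0 id.
  apply/eqaddoP => _/posnumP[e].
  have [_ /eqaddoP fE] := (diff_locallyP x f).1 dfx.
  have {}fE := fE _ (gt0 e).
  rewrite -(nbhs_singleton fg); near=> h.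
  have gh : f (h + x) = g (h + x).
    near: h; have := fg; rewrite (near_shift 0 x) /=.
    by apply: filterS => h; rewrite /= subr0.
  suff : `|(f \o shift x - (cst (f x) + 'd f x)) h| <= e%:num * `|id h|.
    by rewrite !fctE /= gh.
  by near: h; exact: fE.
have dgE := diff_unique (diff_continuous dfx) gE.
have dg : differentiable g x.
  by apply/diff_locallyP; rewrite dgE; split; [exact: diff_continuous|exact: gE].
exact: DiffDef dg dgE.
Unshelve. all: by end_near. Qed.

Lemma near_eq_differentiable (V W : normedModType R) (f g : V -> W) x :
  (\forall y \near x, f y = g y) -> differentiable f x -> differentiable g x.
Proof.
by move=> fg /differentiableP df; have [] := near_eq_is_diff fg df.
Qed.

Lemma eq_Ck (V W : normedModType R) k (U : set V) (f g : V -> W) :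
  open U -> (forall x, U x -> f x = g x) -> Ck k U f -> Ck k U g.
Proof.
move=> oU; elim: k f g => [|k IH] f g fg /=.
  move=> cf x Ux; have fgx : f @ x --> g x by rewrite -fg //; exact: cf.
  apply: cvg_trans fgx; apply: near_eq_cvg.
  by near=> y; apply: fg; near: y; exact: open_nbhs_nbhs.
move=> [df Df]; split=> [x Ux|v].
  apply: near_eq_differentiable (df x Ux).
  by near=> y; apply: fg; near: y; exact: open_nbhs_nbhs.
apply: (IH _ _ _ (Df v)) => x Ux; apply: near_eq_derive.
by near=> y; apply: fg; near: y; exact: open_nbhs_nbhs.
Unshelve. all: by end_near. Qed.

Lemma Ck_sub (V W : normedModType R) k (U U' : set V) (f : V -> W) :
  U `<=` U' -> Ck k U' f -> Ck k U f.
Proof.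
move=> UU'; elim: k f => [|k IH] f /=; first by move=> cf x /UU'; exact: cf.
by move=> [df Df]; split=> [x /UU'|v]; [exact: df|exact: IH].
Qed.

Lemma CkS (V W : normedModType R) k (U : set V) (f : V -> W) :
  Ck k.+1 U f -> Ck k U f.
Proof.
elim: k f => [|k IH] f /=.
  by move=> [df _] x Ux; apply: differentiable_continuous; exact: df.
by move=> [df Df]; split => // v; apply: IH; exact: Df.
Qed.

Lemma Ck0 (V W : normedModType R) k (U : set V) (f : V -> W) :
  Ck k U f -> forall x, U x -> {for x, continuous f}.
Proof. by elim: k => [//|k IH] /CkS. Qed.

Lemma Ck_cst (V W : normedModType R) k (U : set V) (a : W) :
  Ck k U (fun _ : V => a).
Proof.
elim: k a => [|k IH] a /=; first by move=> x _; exact: cst_continuous.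
split=> [x _|v]; first exact: differentiable_cst.
have -> : (fun x : V => 'D_v (fun _ => a) x) = (fun _ => 0); last exact: IH.
by apply/funext => x; exact: derive_cst.
Qed.

Lemma Ck_add (V W : normedModType R) k (U : set V) (f g : V -> W) :
  open U -> Ck k U f -> Ck k U g -> Ck k U (fun x => f x + g x).
Proof.
move=> oU; elim: k f g => [|k IH] f g /=.
  by move=> cf cg x Ux; apply: cvgD; [exact: cf|exact: cg].
move=> [df Df] [dg Dg]; split=> [x Ux|v].
  by apply: (@differentiableD _ _ _ f g); [exact: df|exact: dg].
apply: (eq_Ck oU _ (IH _ _ (Df v) (Dg v))) => x Ux.
by rewrite [RHS](@deriveD _ _ _ f g) //; apply: diff_derivable; [exact: df|exact: dg].
Qed.

Lemma Ck_scale (V W : normedModType R) k (U : set V) (a : R) (f : V -> W) :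
  open U -> Ck k U f -> Ck k U (fun x => a *: f x).
Proof.
move=> oU; elim: k f => [|k IH] f /=.
  move=> cf x Ux; have fx : f @ x --> f x by exact: cf.
  exact: cvgZl_tmp fx.
move=> [df Df]; split=> [x Ux|v].
  by apply: (@differentiableZ _ _ _ f a); exact: df.
apply: (eq_Ck oU _ (IH _ (Df v))) => x Ux.
by rewrite [RHS](@deriveZ _ _ _ f a) //; apply: diff_derivable; exact: df.
Qed.

Lemma Ck_sum (V W : normedModType R) k (U : set V) n (f : 'I_n -> V -> W) :
  open U -> (forall i, Ck k U (f i)) -> Ck k U (fun x => \sum_i f i x).
Proof.
move=> oU; elim: n f => [|n IH] f hf.
  by under eq_fun do rewrite big_ord0; exact: Ck_cst.
under eq_fun do rewrite big_ord_recr.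
by apply: Ck_add => //; apply: IH => i; exact: hf.
Qed.

Lemma Ck_mul (V : normedModType R) k (U : set V) (f g : V -> R) :
  open U -> Ck k U f -> Ck k U g -> Ck k U (fun x => f x * g x : R).
Proof.
move=> oU; elim: k f g => [|k IH] f g.
  by move=> cf cg x Ux; apply: cvgM; [exact: cf|exact: cg].
move=> hf hg; have [df Df] := hf; have [dg Dg] := hg; split=> [x Ux|v].
  by apply: (@derive.differentiableM _ _ f g); [exact: df|exact: dg].
apply: (@eq_Ck _ _ _ _ (fun x => f x * 'D_v g x + 'D_v f x * g x)) => //.
  move=> x Ux; rewrite [RHS](@deriveM _ _ f g) //.
  - by rewrite [in RHS]/GRing.scale/= (mulrC (g x)).
  - by apply: diff_derivable; exact: df.
  - by apply: diff_derivable; exact: dg.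
by apply: Ck_add => //; apply: IH; by [exact: Df|exact: Dg|exact: CkS].
Qed.

Lemma derive_gradE n (f : 'rV[R]_n -> R) y v :
  differentiable f y -> 'D_v f y = \sum_j v 0 j * grad f y 0 j.
Proof.
move=> df; rewrite deriveE // {1}(row_sum_delta v) linear_sum /=.
by apply: eq_bigr => j _; rewrite linearZ /= mxE deriveE.
Qed.

Lemma diff_comp_derive (U V W : normedModType R) (f : U -> V) (g : V -> W) x v :
  differentiable f x -> differentiable g (f x) ->
  'D_v (g \o f) x = 'D_('D_v f x) g (f x).
Proof.
move=> df dg; rewrite deriveE; last exact: differentiable_comp.
by rewrite diff_comp // /= -!deriveE.
Qed.

Lemma differentiable_mx (V : normedModType R) m n (f : V -> 'M[R]_(m, n)) x :
  differentiable f x <-> forall i j, differentiable (fun y => f y i j) x.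
Proof.
split=> [df i j|df].
  exact: (differentiable_comp df (differentiable_coord (f x) i j)).
have -> : f = (fun y => \sum_i \sum_j (f y i j *: delta_mx i j : 'M[R]_(m, n))).
  by apply/funext => y; rewrite -matrix_sum_delta.
have -> : (fun y => \sum_i \sum_j (f y i j *: delta_mx i j : 'M[R]_(m, n))) =
  \sum_i \sum_j (fun y => f y i j *: (delta_mx i j : 'M[R]_(m, n))).
  by apply/funext => y; rewrite fct_sumE; apply: eq_bigr => i _; rewrite fct_sumE.
apply: differentiable_sum => i; apply: differentiable_sum => j.
exact: differentiableZl.
Qed.

Lemma Ck_coord (V : normedModType R) m n k (U : set V) (f : V -> 'M[R]_(m, n)) i j :
  open U -> Ck k U f -> Ck k U (fun y => f y i j : R).
Proof.
move=> oU; elim: k f => [|k IH] f /=.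
  move=> cf x Ux; have fx : f @ x --> f x by exact: cf.
  exact: (cvg_comp _ _ fx (@coord_continuous _ _ _ i j (f x))).
move=> [df Df]; split=> [x Ux|v].
  by have /differentiable_mx := df x Ux; exact.
apply: (eq_Ck oU _ (IH _ (Df v))) => x Ux.
by rewrite derive_mx ?mxE //; apply: diff_derivable; exact: df.
Qed.

(** [Ck] speaks of derivatives in fixed directions, while the direction ['D_v f x] varies with [x];
    it is therefore expanded in the standard basis. *)
Lemma C1_comp (V W : normedModType R) n (U : set V) (U' : set 'rV[R]_n)
    (f : V -> 'rV[R]_n) (g : 'rV[R]_n -> W) :
  open U -> (forall x, U x -> U' (f x)) ->
  Ck 1 U f -> Ck 1 U' g -> Ck 1 U (g \o f).
Proof.
move=> oU UU' hf hg; have [df Df] := hf; have [dg Dg] := hg; split=> [x Ux|v].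
  by apply: differentiable_comp; [exact: df|apply: dg; exact: UU'].
apply: (@eq_Ck _ _ _ _ (fun x => \sum_j ('D_v f x) 0 j *: 'D_(delta_mx 0 j) g (f x))) => //.
  move=> x Ux; have dfx := df x Ux; have dgx := dg (f x) (UU' _ Ux).
  rewrite [RHS](diff_comp_derive v dfx dgx) (deriveE _ dgx).
  rewrite [in RHS](row_sum_delta ('D_v f x)) linear_sum /=.
  by apply: eq_bigr => j _; rewrite linearZ /= (deriveE _ dgx).
apply: Ck_sum => // j x Ux.
have cD : ('D_v f y) 0 j @[y --> x] --> ('D_v f x) 0 j.
  exact: (@Ck_coord _ _ _ 0 U ('D_v f) 0 j oU (Df v) x Ux).
have cg : 'D_(delta_mx 0 j) g (f y) @[y --> x] --> 'D_(delta_mx 0 j) g (f x).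
  apply: (@continuous_at_comp _ _ _ f ('D_(delta_mx 0 j) g)); first exact: (Ck0 hf).
  by apply: Dg; exact: UU'.
exact: (cvgZ cD cg).
Qed.

Lemma grad_comp n m (f : 'rV[R]_n -> 'rV[R]_m) (g : 'rV[R]_m -> R) y :
  differentiable f y -> differentiable g (f y) ->
  grad (g \o f) y = grad g (f y) *m ('J f y)^T.
Proof.
move=> df dg; apply/rowP => j; rewrite mxE (diff_comp_derive _ df dg).
rewrite (derive_gradE _ dg) [RHS]mxE; apply: eq_bigr => k _.
by rewrite (deriveEjacobian _ df) -rowE !mxE mulrC.
Qed.

Lemma gradD n (f g : 'rV[R]_n -> R) y : differentiable f y -> differentiable g y ->
  grad (fun x => f x + g x) y = grad f y + grad g y.
Proof.
move=> df dg; apply/rowP => j; rewrite !mxE.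
by rewrite (@deriveD _ _ _ f g) //; exact: diff_derivable.
Qed.

Lemma gradZ n a (f : 'rV[R]_n -> R) y : differentiable f y ->
  grad (fun x => a * f x) y = a *: grad f y.
Proof.
move=> df; apply/rowP => j; rewrite !mxE.
by rewrite (@deriveZ _ _ _ f a) //; exact: diff_derivable.
Qed.

Lemma grad_cst n a y : grad (fun _ : 'rV[R]_n => a) y = 0.
Proof. by apply/rowP => j; rewrite !mxE derive_cst. Qed.

Lemma near_eq_grad n (f g : 'rV[R]_n -> R) y :
  (\forall x \near y, f x = g x) -> grad f y = grad g y.
Proof. by move=> fg; apply/rowP => j; rewrite !mxE; exact: near_eq_derive. Qed.

End Calculus.

(** * Charts *)

Lemma jacobian_comp (R : realType) a b c (f : 'rV[R]_a -> 'rV[R]_b)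
    (g : 'rV[R]_b -> 'rV[R]_c) y :
  differentiable f y -> differentiable g (f y) ->
  'J (g \o f) y = 'J f y *m 'J g (f y).
Proof.
move=> df dg; apply/row_matrixP => j; rewrite !rowE mulmxA.
rewrite -(deriveEjacobian _ df) -(deriveEjacobian _ dg) -(diff_comp_derive _ df dg).
by rewrite -deriveEjacobian //; exact: differentiable_comp.
Qed.

Lemma jacobian_near_id (R : realType) a (f : 'rV[R]_a -> 'rV[R]_a) y :
  (\forall z \near y, f z = z) -> 'J f y = 1%:M.
Proof.
move=> fid; apply/row_matrixP => j; rewrite !rowE mulmx1.
have df : differentiable f y.
  by apply: (@near_eq_differentiable _ _ _ id) => //; apply: filterS fid.
rewrite -(deriveEjacobian _ df).
rewrite (@near_eq_derive _ _ _ f id) ?derive_id //.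
Qed.

Lemma local_max_derive_le0 (R : realType) (V : normedModType R) (f : V -> R) y v :
  derivable f y v -> (\forall z \near y, f z <= f y) -> 'D_v f y <= 0.
Proof.
move=> df fmax.
have q : (fun h => h^-1 *: ((f \o shift y) (h *: v) - f y)) @ 0^'+ --> 'D_v f y.
  exact: cvg_dnbhs_at_right.
apply: (cvgr_to_le q).
have sh : (fun h : R => h *: v + y) @ 0^'+ --> y.
  rewrite -[X in _ --> X]add0r -[X in _ --> X + _](scale0r v).
  apply: cvgD; last exact: cvg_cst.
  by apply: cvgZr_tmp; exact: cvg_at_right_filter.
near=> h; rewrite /= [X in X <= _]mulrC pmulr_lle0.
  by rewrite subr_le0; near: h; exact: (sh _ fmax).
by rewrite invr_gt0; near: h; exact: nbhs_right_gt.
Unshelve. all: by end_near. Qed.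

Lemma local_max_derive (R : realType) (V : normedModType R) (f : V -> R) y v :
  differentiable f y -> (\forall z \near y, f z <= f y) -> 'D_v f y = 0.
Proof.
move=> df fmax; apply/eqP; rewrite eq_le local_max_derive_le0 //=; last exact: diff_derivable.
rewrite -oppr_le0.
have -> : - 'D_v f y = 'D_(- v) f y by rewrite !deriveE // linearN.
by apply: local_max_derive_le0 => //; exact: diff_derivable.
Qed.

Lemma local_max_grad (R : realType) n (f : 'rV[R]_n -> R) y :
  differentiable f y -> (\forall z \near y, f z <= f y) -> grad f y = 0.
Proof. by move=> df fmax; apply/rowP => j; rewrite !mxE local_max_derive. Qed.


Section Charts.
Variables (R : realType) (n : nat) (M : ptopologicalType) (A : atlas R n M).
Implicit Types (i j k : index A) (x : M).

Lemma codom_chart i x : dom i x -> codom i (chart i x).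
Proof. by exists x. Qed.

Lemma dom_ichart i y : codom i y -> dom i (ichart i y).
Proof. by case=> x ix <-; rewrite chartK. Qed.

Lemma ichartK i y : codom i y -> chart i (ichart i y) = y.
Proof. by case=> x ix <-; rewrite chartK. Qed.

Lemma near_dom i x : dom i x -> \forall y \near x, dom i y.
Proof. by move=> ix; apply: open_nbhs_nbhs; split => //; exact: open_dom. Qed.

Lemma near_codom i x : dom i x -> \forall y \near chart i x, codom i y.
Proof.
move=> ix; apply: open_nbhs_nbhs; split; first exact: open_codom.
exact: codom_chart.
Qed.

Lemma chart_cvg i x : dom i x -> chart i @ x --> chart i x.
Proof. exact: chart_continuous. Qed.

Lemma ichart_cvg i x : dom i x -> ichart i @ chart i x --> x.
Proof.
by move=> ix; rewrite -[X in _ --> X](chartK ix); exact: ichart_continuous.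
Qed.

Lemma transition_differentiable i j x : dom i x -> dom j x ->
  differentiable (chart j \o ichart i) (chart i x).
Proof. by move=> ix jx; have [h _] := @transition_smooth _ _ _ A i j 1; apply: h; exists x. Qed.

Lemma open_codomI i j : open (chart i @` (dom i `&` dom j)).
Proof.
rewrite openE => _ [x [ix jx] <-]; rewrite /interior.
have h := near_codom ix; have h' := ichart_cvg ix (near_dom jx).
near=> y; exists (ichart i y); last by rewrite ichartK //; near: y.
by split; [apply: dom_ichart; near: y|near: y].
Unshelve. all: by end_near. Qed.

Lemma transition_jacobian_id i x : dom i x -> transition_jacobian i i x = 1%:M.
Proof.
move=> ix; apply: jacobian_near_id; have h := near_codom ix.
by near=> y; rewrite /= ichartK //; near: y.
Unshelve. all: by end_near. Qed.

Lemma near_eq_jacobian a b (f g : 'rV[R]_a -> 'rV[R]_b) y :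
  (\forall z \near y, f z = g z) -> differentiable f y -> 'J f y = 'J g y.
Proof.
move=> fg /differentiableP df; have [_ e] := near_eq_is_diff fg df.
exact: (congr1 (fun h => lin1_mx h) (esym e)).
Qed.

Lemma transition_jacobian_comp i j k x : dom i x -> dom j x -> dom k x ->
  transition_jacobian i j x *m transition_jacobian j k x = transition_jacobian i k x.
Proof.
move=> ix jx kx; rewrite /transition_jacobian.
have dij := transition_differentiable ix jx.
have e : (chart j \o ichart i) (chart i x) = chart j x by rewrite /= chartK.
have djk : differentiable (chart k \o ichart j) ((chart j \o ichart i) (chart i x)).
  by rewrite e; exact: transition_differentiable.
have := jacobian_comp dij djk; rewrite e => <-.
apply: near_eq_jacobian; last exact: differentiable_comp.
have h := ichart_cvg ix (near_dom jx).
by near=> y; rewrite /= chartK //; near: y.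
Unshelve. all: by end_near. Qed.

Lemma transition_jacobianK i j x : dom i x -> dom j x ->
  transition_jacobian i j x *m transition_jacobian j i x = 1%:M.
Proof. by move=> ix jx; rewrite transition_jacobian_comp // transition_jacobian_id. Qed.

Lemma cov_coordK i (xi : cotangent A) : dom i (base xi) ->
  cov_of_coord i (chart i (base xi)) (cov_coord i xi) = xi.
Proof.
case: xi => x p /= ix; rewrite /cov_of_coord /cov_coord /= chartK //.
rewrite -mulmxA -trmx_mul transition_jacobianK ?trmx1 ?mulmx1 //.
exact: dom_chart_at.
Qed.

Lemma cov_of_coordK i y q : codom i y -> cov_coord i (cov_of_coord i y q) = q.
Proof.
move=> iy; rewrite /cov_of_coord /cov_coord /= -mulmxA -trmx_mul.
rewrite transition_jacobianK ?trmx1 ?mulmx1 //; first exact: dom_ichart.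
exact: dom_chart_at.
Qed.

Lemma cov_of_coord_chart_at x q :
  cov_of_coord (chart_at A x) (chart (chart_at A x) x) q = covector A x q.
Proof.
have h := dom_chart_at A x.
by rewrite /cov_of_coord chartK // transition_jacobian_id // trmx1 mulmx1.
Qed.

Lemma grad_ichart i j x (f : M -> R) : dom i x -> dom j x ->
  differentiable (f \o ichart i) (chart i x) ->
  grad (f \o ichart j) (chart j x) =
  grad (f \o ichart i) (chart i x) *m (transition_jacobian j i x)^T.
Proof.
move=> ix jx df; have dji := transition_differentiable jx ix.
have e : (chart i \o ichart j) (chart j x) = chart i x by rewrite /= chartK.
rewrite /transition_jacobian -{1}e -grad_comp ?e //.
apply: near_eq_grad; have h := ichart_cvg jx (near_dom ix).
by near=> y; rewrite /= chartK //; near: y.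
Unshelve. all: by end_near. Qed.

Lemma diffM_coord i x (f : M -> R) : dom i x ->
  differentiable (f \o ichart i) (chart i x) ->
  cov_of_coord i (chart i x) (grad (f \o ichart i) (chart i x)) = covector A x (diffM A f x).
Proof.
move=> ix df; rewrite /cov_of_coord chartK //; congr (covector A _ _).
by rewrite /diffM -grad_ichart //; exact: dom_chart_at.
Qed.

Lemma CkM_differentiable i x (f : M -> R) : CkM A 1 f -> dom i x ->
  differentiable (f \o ichart i) (chart i x).
Proof. by move=> /(_ i) [h _] ix; apply: h; exact: codom_chart. Qed.

Lemma CkM_differentiableM x (f : M -> R) : CkM A 1 f -> differentiableM A f x.
Proof. by move=> /CkM_differentiable; apply; exact: dom_chart_at. Qed.

Lemma CkM_continuous (k : nat) (f : M -> R) : CkM A k f -> continuous f.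
Proof.
move=> hf x; have ix := dom_chart_at A x; set i := chart_at A x in ix.
have h : (f \o ichart i) \o chart i @ x --> f x.
  rewrite -[X in _ --> f X](chartK ix).
  apply: (cvg_comp _ _ (chart_cvg ix)).
  exact: (Ck0 (hf i) (codom_chart ix)).
apply: cvg_trans h; apply: near_eq_cvg; have h' := near_dom ix.
by near=> y; rewrite /= chartK //; near: y.
Unshelve. all: by end_near. Qed.

Lemma CkM_add (k : nat) (f g : M -> R) : CkM A k f -> CkM A k g -> CkM A k (fun x => f x + g x).
Proof. by move=> hf hg i; apply: Ck_add; [exact: open_codom|exact: hf|exact: hg]. Qed.

Lemma CkM_scale (k : nat) a (f : M -> R) : CkM A k f -> CkM A k (fun x => a * f x).
Proof. by move=> hf i; apply: (@Ck_scale _ _ R); [exact: open_codom|exact: hf]. Qed.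

Lemma CkM_cst (k : nat) a : CkM A k (fun=> a).
Proof. by move=> i; exact: Ck_cst. Qed.

Lemma diffMD x (f g : M -> R) : differentiableM A f x -> differentiableM A g x ->
  diffM A (fun x => f x + g x) x = diffM A f x + diffM A g x.
Proof. exact: gradD. Qed.

Lemma diffMZ x a (f : M -> R) : differentiableM A f x ->
  diffM A (fun x => a * f x) x = a *: diffM A f x.
Proof. exact: gradZ. Qed.

Lemma diffM_cst x a : diffM A (fun=> a) x = 0.
Proof. exact: grad_cst. Qed.

Lemma local_max_diffM x (f : M -> R) : differentiableM A f x ->
  (\forall y \near x, f y <= f x) -> diffM A f x = 0.
Proof.
move=> df fmax; have ix := dom_chart_at A x; apply: local_max_grad => //.
by have := ichart_cvg ix fmax; rewrite /= chartK.
Qed.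

Lemma touching_diffM x (f g : M -> R) : differentiableM A f x -> differentiableM A g x ->
  (\forall y \near x, f y - g y <= f x - g x) -> diffM A f x = diffM A g x.
Proof.
move=> df dg fg.
have dN : differentiableM A (fun y => (-1) * g y) x by exact: (@differentiableZ _ _ R).
have d : differentiableM A (fun y => f y + (-1) * g y) x by exact: differentiableD.
have := local_max_diffM d; rewrite diffMD // diffMZ // scaleN1r => h.
apply/eqP; rewrite -subr_eq0 h //.
by apply: filterS fg => y; rewrite !mulN1r.
Qed.

End Charts.

(** * Bump functions *)

Section Plateau.
Variable R : realType.

Definition pos_sq (s : R) : R := (Num.max 0 s) ^+ 2.

Lemma is_derive_pos_sq (s : R) : is_derive s 1 pos_sq (2 * Num.max 0 s).
Proof.
have h : (fun h => h^-1 *: ((pos_sq \o shift s) (h *: (1 : R)) - pos_sq s)) @ 0^'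
    --> 2 * Num.max 0 s.
  apply/cvgrPdist_le => e e0; near=> h.
  have h0 : h != 0 by near: h; exact: nbhs_dnbhs_neq.
  have he : `|h| <= e by near: h; exact: dnbhs0_le.
  apply: le_trans he; rewrite /= /GRing.scale /= mulr1.
  have -> : 2 * Num.max 0 s - h^-1 * (pos_sq (h + s) - pos_sq s) =
      - h^-1 * (pos_sq (h + s) - pos_sq s - 2 * Num.max 0 s * h) by field.
  rewrite normrM normrN normfV ler_pdivrMl ?normr_gt0 // -normrM -expr2.
  rewrite (ger0_norm (sqr_ge0 _)) /pos_sq !maxEle ler_norml.
  by case: ifP => h1; case: ifP => h2; apply/andP; split; nra.
apply: DeriveDef; first by apply/cvg_ex; eexists; exact: h.
exact: cvg_lim.
Unshelve. all: by end_near. Qed.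

Lemma C1_pos_sq : Ck 1 setT (pos_sq : R^o -> R^o).
Proof.
split=> [x _|v x _].
  by apply/derivable1_diffP; exact: (@ex_derive _ _ _ _ _ _ _ (is_derive_pos_sq x)).
have -> : (fun x : R^o => 'D_v (pos_sq : R^o -> R^o) x) = (fun x => v * (2 * Num.max 0 x)).
  apply/funext => y; rewrite deriveE; last first.
    by apply/derivable1_diffP; exact: (@ex_derive _ _ _ _ _ _ _ (is_derive_pos_sq y)).
  rewrite deriv1E; last exact: (@ex_derive _ _ _ _ _ _ _ (is_derive_pos_sq y)).
  by rewrite derive1E (@derive_val _ _ _ _ _ _ _ (is_derive_pos_sq y)).
have h : (fun x => v * (2 * Num.max 0 x)) @ x --> v * (2 * Num.max 0 x).
  apply: cvgM; first exact: cvg_cst.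
  apply: cvgM; first exact: cvg_cst.
  by apply: continuous_max; [exact: cvg_cst|exact: cvg_id].
exact: h.
Qed.

Lemma C1_comp1 (V : normedModType R) (U : set V) (f : V -> R) (g : R -> R) :
  open U -> Ck 1 U f -> Ck 1 setT (g : R^o -> R^o) -> Ck 1 U (g \o f : V -> R).
Proof.
move=> oU [df Df] [dg Dg].
have d x : U x -> differentiable (f : V -> R^o) x by exact: df.
split=> [x Ux|v]; first exact: (differentiable_comp (d x Ux) (dg (f x) I)).
apply: (@eq_Ck _ _ _ _ _ (fun x => 'D_v f x * ('D_1 (g : R^o -> R^o) (f x)) : R)) => //.
  move=> x Ux; rewrite [RHS](diff_comp_derive v (d x Ux) (dg (f x) I)).
  have dg1 : derivable (g : R^o -> R^o) (f x) 1 by apply: diff_derivable; exact: dg.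
  by rewrite [RHS](deriveE _ (dg (f x) I)) (deriv1E dg1) derive1E.
apply: Ck_mul => //; first exact: Df.
move=> x Ux; apply: (@continuous_at_comp _ _ _ f ('D_1 (g : R^o -> R^o))).
  exact: (differentiable_continuous (d x Ux)).
exact: Dg.
Qed.

(** A C^1 truncation: the identity up to 1, slope [2 - s] on [1, 2], the constant 3/2 from 2 on. *)
Definition plateau (s : R) : R := s - pos_sq (s - 1) / 2 + pos_sq (s - 2) / 2.

Lemma plateau_lt1 s : plateau s < 1 -> s < 1 /\ plateau s = s.
Proof.
rewrite /plateau /pos_sq !maxEle; case: ifP => h1; case: ifP => h2 h; split; nra.
Qed.

Lemma plateau_ge2 s : 2 <= s -> plateau s = 3 / 2.
Proof.
rewrite /plateau /pos_sq !maxEle; case: ifP => h1; case: ifP => h2 h; nra.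
Qed.

Lemma plateau_ge0 s : 0 <= s -> 0 <= plateau s.
Proof.
rewrite /plateau /pos_sq !maxEle; case: ifP => h1; case: ifP => h2 h; nra.
Qed.

Lemma plateauE s : s <= 1 -> plateau s = s.
Proof.
rewrite /plateau /pos_sq !maxEle; case: ifP => h1; case: ifP => h2 h; nra.
Qed.

(** The Euclidean square replaces the norm of row vectors, which is a sup norm and not
    differentiable. *)
Definition sqdist n (z y : 'rV[R]_n) : R := \sum_j (y 0 j - z 0 j) ^+ 2.

Lemma sqdist_ge0 n (z y : 'rV[R]_n) : 0 <= sqdist z y.
Proof. by apply: sumr_ge0 => j _; exact: sqr_ge0. Qed.

Lemma sqdistxx n (z : 'rV[R]_n) : sqdist z z = 0.
Proof. by rewrite /sqdist big1 // => j _; rewrite subrr expr0n. Qed.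

Lemma sqdistC n (z y : 'rV[R]_n) : sqdist z y = sqdist y z.
Proof. by apply: eq_bigr => j _; rewrite -sqrrN opprB. Qed.

Lemma sqdist_norm n (z y : 'rV[R]_n) r : 0 <= r -> sqdist z y <= r ^+ 2 -> `|y - z| <= r.
Proof.
move=> r0 h; rewrite /Num.Def.normr /= mx_normrE; apply: bigmax_le => // -[i j] _ /=.
rewrite ord1 !mxE -(ler_pXn2r (n := 2)) ?nnegrE // -normrX ger0_norm ?sqr_ge0 //.
apply: le_trans h; rewrite /sqdist (bigD1 j) //= lerDl.
by apply: sumr_ge0 => k _; exact: sqr_ge0.
Qed.

Lemma Ck_id (V : normedModType R) k (U : set V) : Ck k U (id : V -> V).
Proof.
case: k => [|k] /=; first by move=> x _; exact: cvg_id.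
split=> [x _|v]; first by [].
have -> : (fun x : V => 'D_v id x) = (fun=> v) by apply/funext => x; exact: derive_id.
exact: Ck_cst.
Qed.

Lemma C1_sqdist n (z : 'rV[R]_n) : Ck 1 setT (sqdist z).
Proof.
have o : open [set: 'rV[R]_n] by exact: openT.
have c (j : 'I_n) : Ck 1 setT (fun y : 'rV[R]_n => y 0 j - z 0 j).
  apply: Ck_add => //; last exact: Ck_cst.
  by apply: (@Ck_coord _ _ _ _ _ _ id) => //; exact: Ck_id.
apply: Ck_sum => [|j]; first exact: o.
under eq_fun do rewrite expr2; apply: Ck_mul; [exact: o|exact: c|exact: c].
Qed.

Lemma grad_sqdist n (z y : 'rV[R]_n) : grad (sqdist z) y = 2 *: (y - z).
Proof.
apply/rowP => j; rewrite !mxE.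
have dc (k : 'I_n) : is_derive y (delta_mx 0 j) (fun y : 'rV[R]_n => y 0 k - z 0 k) ((k == j)%:R).
  have d : derivable (fun y : 'rV[R]_n => y) y (delta_mx 0 j) by exact: derivable_id.
  have dk : is_derive y (delta_mx 0 j) (fun y : 'rV[R]_n => y 0 k) ((k == j)%:R).
    apply: DeriveDef; first by have /derivable_mxP := d; exact.
    have := derive_mx d; rewrite derive_id => /rowP/(_ k).
    by rewrite !mxE eqxx /= => <-.
  by apply: is_derive_eq; rewrite subr0.
have -> : sqdist z = \sum_(k < n) ((fun y : 'rV[R]_n => y 0 k - z 0 k) ^+ 2).
  apply/funext => x; rewrite fct_sumE; apply: eq_bigr => k _.
  by rewrite exprfctE.
rewrite derive_sum //.
rewrite (bigD1 j) //= big1 ?addr0.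
  rewrite deriveX; last exact: (@ex_derive _ _ _ _ _ _ _ (dc j)).
  by rewrite (@derive_val _ _ _ _ _ _ _ (dc j)) eqxx expr1 /GRing.scale /= mulr1 mulr_natl.
move=> k kj; rewrite deriveX; last exact: (@ex_derive _ _ _ _ _ _ _ (dc k)).
by rewrite (@derive_val _ _ _ _ _ _ _ (dc k)) (negbTE kj) scaler0.
Qed.

Lemma C1_plateau : Ck 1 setT (plateau : R^o -> R^o).
Proof.
have o : open [set: R^o] by exact: openT.
have sh a : Ck 1 setT ((fun s => s - a) : R^o -> R).
  by apply: Ck_add => //; [exact: Ck_id|exact: Ck_cst].
have p a : Ck 1 setT ((fun s => pos_sq (s - a)) : R^o -> R).
  exact: (@C1_comp1 _ _ (fun s => s - a) pos_sq o (sh a) C1_pos_sq).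
have -> : (plateau : R^o -> R^o) = (fun s => (s - 0) + (- 2^-1) *: (pos_sq (s - 1) : R^o) + 2^-1 *: (pos_sq (s - 2) : R^o)).
  by apply/funext => s; rewrite /plateau /GRing.scale /= subr0 mulNr ![2^-1 * _]mulrC.
apply: Ck_add; [exact: o| |by apply: Ck_scale; [exact: o|exact: p]].
apply: Ck_add; [exact: o|exact: sh|by apply: Ck_scale; [exact: o|exact: p]].
Qed.

End Plateau.

Lemma Ck_setU (R : realType) (V W : normedModType R) k (U U' : set V) (f : V -> W) :
  Ck k U f -> Ck k U' f -> Ck k (U `|` U') f.
Proof.
elim: k f => [|k IH] f /=; first by move=> h h' x [/h|/h'].
move=> [df Df] [df' Df']; split=> [x [/df|/df']|v] //.
by apply: IH; [exact: Df|exact: Df'].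
Qed.

Section Bump.
Variables (R : realType) (n : nat) (M : ptopologicalType) (A : atlas R n M).
Hypothesis hausM : hausdorff_space M.
Implicit Types (i j : index A) (x y : M) (z : 'rV[R]_n) (r : R).

(** Radius [2 * r] leaves a margin: the well built on this ball is already constant from distance
    [sqrt 2 * r] on. *)
Definition chart_ball i z r := forall y : 'rV[R]_n, sqdist z y <= (2 * r) ^+ 2 -> codom i y.

(* Near [z] this is the squared distance to [z] in the chart, divided by [r ^+ 2];
   [3 / 2] is the value of [plateau] far away, so that the extension is C^1. *)
Definition well i z r x : R :=
  if `[< dom i x >] then plateau (sqdist z (chart i x) / r ^+ 2) else 3 / 2.

Lemma sqdist_continuous z : continuous (sqdist z).
Proof. by move=> y; apply: (Ck0 (C1_sqdist z)). Qed.

Lemma closed_sqball z r : closed [set y | sqdist z y <= r].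
Proof.
have -> : [set y | sqdist z y <= r] = sqdist z @^-1` [set x | x <= r] by [].
by apply: preimage_closed; [move=> y _; exact: sqdist_continuous|exact: closed_le].
Qed.

Lemma compact_sqball z r : 0 <= r -> compact [set y | sqdist z y <= r ^+ 2].
Proof.
move=> r0; apply: bounded_closed_compact; last exact: closed_sqball.
exists (r + `|z|); split; first by rewrite num_real.
move=> b rb y /(sqdist_norm r0) h; apply: le_trans (ltW rb).
by rewrite -(subrK z y); apply: le_trans (ler_normD _ _) _; rewrite lerD2r.
Qed.

(** Each chart codomain is covered by two open sets: the overlap with [dom i], where the well is a
    composition of C^1 maps, and the complement of the image of the closed ball, where it is
    constant. That image is compact, hence closed as [M] is Hausdorff. *)
Lemma well_C1 i z r : 0 < r -> chart_ball i z r -> CkM A 1 (well i z r).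
Proof.
move=> r0 ball j.
pose B := ichart i @` [set y | sqdist z y <= (2 * r) ^+ 2].
have cB : closed B.
  apply: compact_closed => //; apply: continuous_compact.
    apply: continuous_in_subspaceT => y /set_mem yB.
    have [x ix <-] := ball y yB; exact: ichart_continuous.
  by apply: compact_sqball; rewrite mulr_ge0 // ltW.
pose U := chart j @` (dom j `&` dom i).
pose U' := codom j `&` (ichart j @^-1` ~` B).
have oU' : open U'.
  rewrite openE => _ [[x jx <-]]; rewrite /preimage /= chartK // => xB; rewrite /interior.
  have oB : \forall y \near x, (~` B) y.
    by apply: open_nbhs_nbhs; split => //; exact: closed_openC.
  apply: filterI; first exact: near_codom.
  by have := ichart_cvg jx oB.
have -> : codom j = U `|` U'.
  apply/seteqP; split => [_ [x jx <-]|y [[x [jx ix] <-]|[]//]]; last exact: codom_chart.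
  have [ix|ix] := pselect (dom i x); first by left; exists x.
  right; split; first exact: codom_chart.
  rewrite /preimage /= chartK // => -[y yB yx]; apply: ix; rewrite -yx.
  by apply: dom_ichart; exact: ball.
pose G (y : 'rV[R]_n) := plateau (sqdist z y / r ^+ 2).
have GC : Ck 1 setT G.
  have NC : Ck 1 setT (fun y : 'rV[R]_n => sqdist z y / r ^+ 2).
    under eq_fun do rewrite mulrC.
    by apply: (@Ck_scale _ _ R); [exact: openT|exact: C1_sqdist].
  exact: (C1_comp1 openT NC (@C1_plateau R)).
apply: Ck_setU.
  apply: (@eq_Ck _ _ _ _ _ (G \o (chart i \o ichart j))); first exact: open_codomI.
    by move=> _ [x [jx ix] <-]; rewrite /= /well chartK // asboolT.
  apply: (@C1_comp _ _ _ _ _ setT) => //; first exact: open_codomI.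
  exact: transition_smooth.
apply: (@eq_Ck R 'rV[R]_n R _ _ (fun=> 3 / 2)) => //; last exact: Ck_cst.
move=> y [_ yB]; rewrite /= /well; case: asboolP => // iy; apply/esym/plateau_ge2.
rewrite ler_pdivlMr ?exprn_gt0 //; apply/ltW; rewrite ltNge; apply/negP => h.
apply: yB; exists (chart i (ichart j y)); last by rewrite chartK.
by rewrite /=; apply: le_trans h _; rewrite exprMn ler_wpM2r ?exprn_ge0 ?(ltW r0) //; lra.
Qed.

Lemma well_ge0 i z r x : 0 <= well i z r x.
Proof.
rewrite /well; case: ifP => _; last lra.
by apply: plateau_ge0; rewrite divr_ge0 ?sqdist_ge0 ?sqr_ge0.
Qed.

Lemma well_center i r x : dom i x -> well i (chart i x) r x = 0.
Proof. by move=> ix; rewrite /well asboolT // sqdistxx mul0r plateauE. Qed.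

Lemma well_lt1 i z r x : well i z r x < 1 ->
  [/\ dom i x, well i z r x = sqdist z (chart i x) / r ^+ 2
    & sqdist z (chart i x) / r ^+ 2 < 1].
Proof.
rewrite /well; case: asboolP => ix; last lra.
by move=> /plateau_lt1[h ->].
Qed.

Lemma well_eq0 i x r y : 0 < r -> dom i x -> well i (chart i x) r y = 0 -> y = x.
Proof.
move=> r0 ix h; have [|iy e _] := @well_lt1 i (chart i x) r y; first by rewrite h.
move: e; rewrite h => /esym/eqP; rewrite mulf_eq0 invr_eq0 expf_eq0 /= (gt_eqF r0) orbF.
rewrite /sqdist psumr_eq0; last by move=> j _; exact: sqr_ge0.
move=> /allP e; rewrite -(chartK iy) -(chartK ix); congr (ichart i _).
apply/rowP => j; have := e j; rewrite mem_index_enum => /(_ isT) /=.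
by rewrite expf_eq0 /= subr_eq0 => /eqP.
Qed.

Lemma well_grad i z r x : 0 < r -> chart_ball i z r -> well i z r x < 1 ->
  grad (well i z r \o ichart i) (chart i x) = (2 / r ^+ 2) *: (chart i x - z).
Proof.
move=> r0 ball wx; have wC := well_C1 r0 ball; have [ix _ _] := well_lt1 wx.
have wx' : \forall y \near x, well i z r y < 1.
  have cw : well i z r @ x --> well i z r x by exact: (CkM_continuous wC).
  by apply: (cvgr_lt _ cw).
have wy := ichart_cvg ix wx'; have iy := near_codom ix.
rewrite (@near_eq_grad _ _ _ (fun y : 'rV[R]_n => (r ^+ 2)^-1 * sqdist z y)).
  rewrite gradZ; last by have [h _] := C1_sqdist z; exact: h.
  by rewrite grad_sqdist scalerA mulrC.
near=> y; rewrite /=.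
have [] : well i z r (ichart i y) < 1 by near: y; exact: wy.
have yi : codom i y by near: y.
by move=> /well_lt1[_ -> _]; rewrite ichartK // mulrC.
Unshelve. all: by end_near. Qed.

(** The sublevel sets of a well form a basis of neighbourhoods of its centre. *)
Lemma well_nbhs i x r (O : set M) : 0 < r -> dom i x -> nbhs x O ->
  exists2 e, 0 < e <= 1 & forall y, well i (chart i x) r y < e -> O y.
Proof.
move=> r0 ix xO; have := ichart_cvg ix xO => /nbhs_ballP[d /= d0 hd].
pose e := Num.min 1 ((d / 2) ^+ 2 / r ^+ 2).
exists e.
  by rewrite lt_min ltr01 /= ge_min lexx /= andbT divr_gt0 ?exprn_gt0 // divr_gt0.
move=> y ye; have [|iy ey _] := @well_lt1 i (chart i x) r y.
  by apply: lt_le_trans ye _; rewrite ge_min lexx.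
rewrite -(chartK iy); apply: hd; rewrite -ball_normE /= distrC.
have d2 : 0 <= d / 2 by lra.
apply: le_lt_trans (_ : d / 2 < d); last lra.
apply: sqdist_norm => //; rewrite -(@ler_pM2r _ (r ^+ 2)^-1) ?invr_gt0 ?exprn_gt0 //.
by rewrite -ey ltW // (lt_le_trans ye) // ge_min lexx orbT.
Qed.

(** One radius serves all centres near [x]; [subsolution_cone] needs the vertex to vary. With
    [r = d / 4] the points reached lie within [3 * r < d] of [chart i x]. *)
Lemma chart_ball_near i x (O : set M) : dom i x -> nbhs x O -> exists2 r, 0 < r &
  forall z, sqdist (chart i x) z <= r ^+ 2 -> forall y : 'rV[R]_n,
    sqdist z y <= (2 * r) ^+ 2 ->
    codom i y /\ O (ichart i y).
Proof.
move=> ix xO.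
have : nbhs (chart i x) (codom i `&` (ichart i @^-1` O)).
  by apply: filterI; [exact: near_codom|exact: (ichart_cvg ix xO)].
move=> /nbhs_ballP[d /= d0 hd].
exists (d / 4); first lra.
move=> z hz y hy; apply: (hd y); rewrite -ball_normE /= distrC.
have -> : y - chart i x = (y - z) + (z - chart i x) by rewrite addrA subrK.
apply: le_lt_trans (ler_normD _ _) _.
have h1 : `|y - z| <= 2 * (d / 4) by apply: sqdist_norm => //; lra.
have h2 : `|z - chart i x| <= d / 4 by apply: sqdist_norm => //; lra.
lra.
Qed.

End Bump.

(** * Lipschitz functions for the Riemannian distance *)

(** A nonnegative integral is a supremum over the simple functions below, so monotonicity holds for
    arbitrary functions, such as the speed of a curve. *)
Lemma ge0_integral_le (d : measure_display) (T : measurableType d) (R : realType)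
    (mu : {measure set T -> \bar R}) (D : set T) (f g : T -> \bar R) :
  (forall x, D x -> 0 <= f x)%E -> (forall x, D x -> f x <= g x)%E ->
  (\int[mu]_(x in D) f x <= \int[mu]_(x in D) g x)%E.
Proof.
move=> f0 fg; have g0 x : D x -> (0 <= g x)%E.
  by move=> Dx; exact: le_trans (f0 x Dx) (fg x Dx).
rewrite !ge0_integralE //; apply: le_ereal_sup => _ [h hf <-]; exists h => // x.
apply: le_trans (hf x) _; rewrite /patch; case: ifPn => // xD.
by apply: fg; rewrite inE in xD.
Qed.

Section Segments.
Variable R : realType.

(** A C^1 passage from 0 to 1 that is constant outside [0, 1] and has slope at most 2. It turns a
    chart segment into a C^1 curve defined on the whole line and staying on the segment. *)
Definition ramp (t : R) : R := 2 * pos_sq t + (- 4) * pos_sq (t - 1 / 2) + 2 * pos_sq (t - 1).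

Lemma ramp0 : ramp 0 = 0.
Proof. by rewrite /ramp /pos_sq !maxEle; do 3?case: ifP => ?; nra. Qed.

Lemma ramp1 : ramp 1 = 1.
Proof. by rewrite /ramp /pos_sq !maxEle; do 3?case: ifP => ?; nra. Qed.

Lemma ramp_itv t : 0 <= ramp t <= 1.
Proof.
rewrite /ramp /pos_sq !maxEle; case: ifP => h1; case: ifP => h2; case: ifP => h3;
  apply/andP; split; nra.
Qed.

Definition dramp (t : R) : R :=
  4 * Num.max 0 t - 8 * Num.max 0 (t - 1 / 2) + 4 * Num.max 0 (t - 1).

Lemma dramp_itv t : 0 <= dramp t <= 2.
Proof.
rewrite /dramp !maxEle; case: ifP => h1; case: ifP => h2; case: ifP => h3;
  apply/andP; split; nra.
Qed.

Lemma C1_ramp : Ck 1 setT (ramp : R^o -> R^o).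
Proof.
have o : open [set: R^o] by exact: openT.
have p a : Ck 1 setT ((fun s => pos_sq (s - a)) : R^o -> R).
  apply: (@C1_comp1 _ _ _ (fun s => s - a) (@pos_sq R) o _ (@C1_pos_sq R)).
  by apply: Ck_add => //; [exact: Ck_id|exact: Ck_cst].
have -> : (ramp : R^o -> R^o) = (fun t => 2 *: (pos_sq (t - 0) : R^o) +
    (- 4) *: (pos_sq (t - 1 / 2) : R^o) + 2 *: (pos_sq (t - 1) : R^o)).
  by apply/funext => t; rewrite subr0.
have pa (b a : R) : Ck 1 [set: R^o] (fun t => b *: (pos_sq (t - a) : R^o)).
  by apply: Ck_scale; [exact: o|exact: p].
by apply: Ck_add; [exact: o|apply: Ck_add; [exact: o| |]|]; exact: pa.
Qed.

Lemma is_derive_ramp (t : R) : is_derive t 1 ramp (dramp t).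
Proof.
have p (a : R) : is_derive t 1 (fun s => pos_sq (s - a)) (2 * Num.max 0 (t - a)).
  have h := is_derive_pos_sq (t - a).
  have e : is_derive t (1 : R) (fun s : R => s - a) 1.
    by apply: is_derive_eq; rewrite subr0.
  have := @is_derive1_comp R (@pos_sq R) (fun s => s - a) t _ _ h e.
  by rewrite mulr1.
have -> : ramp = (2 *: (fun s => pos_sq (s - 0)) + (- 4) *: (fun s => pos_sq (s - 1 / 2)) +
    2 *: (fun s => pos_sq (s - 1)) : R -> R).
  by apply/funext => s; rewrite /ramp !fctE subr0.
have h := is_deriveD (is_deriveD (is_deriveZ 2 (p 0)) (is_deriveZ (- 4) (p (1 / 2))))
  (is_deriveZ 2 (p 1)).
apply: (is_derive_eq h).
rewrite /dramp subr0 /GRing.scale /=.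
by move: (Num.max 0 t) (Num.max 0 (t - 1 / 2)) (Num.max 0 (t - 1)) => a b c; lra.
Qed.

End Segments.

Lemma Ck_scalel (R : realType) (V W : normedModType R) k (U : set V) (a : V -> R) (w : W) :
  open U -> Ck k U a -> Ck k U (fun x => a x *: w).
Proof.
move=> oU; elim: k a => [|k IH] a /=.
  move=> ca x Ux; have cx : a @ x --> a x by exact: ca.
  exact: cvgZr_tmp cx.
move=> [da Da]; split=> [x Ux|v]; first by apply: differentiableZl; exact: da.
apply: (eq_Ck oU _ (IH _ (Da v))) => x Ux.
have d := da x Ux; have dz := differentiableZl w d.
by rewrite (deriveE _ d) (deriveE _ dz) (diffZl w d).
Qed.

Lemma dotr_mulmx_le (R : realType) n (v : 'rV[R]_n) (B : 'M[R]_n) :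
  dotr (v *m B) v <= (n * n)%:R * `|B| * `|v| ^+ 2.
Proof.
rewrite /dotr mxE.
have vj j : `|v 0 j| <= `|v|.
  rewrite [leRHS]/Num.Def.normr /= mx_normrE.
  exact: (le_bigmax 0 (fun ij : 'I_1 * 'I_n => `|v ij.1 ij.2|) (0, j)).
have Bjk j k : `|B j k| <= `|B|.
  rewrite [leRHS]/Num.Def.normr /= mx_normrE.
  exact: (le_bigmax 0 (fun ij : 'I_n * 'I_n => `|B ij.1 ij.2|) (j, k)).
have h k : (v *m B) 0 k * v^T k 0 <= n%:R * (`|B| * `|v| ^+ 2).
  rewrite !mxE mulr_suml -[X in X%:R]card_ord mulr_natl -sumr_const.
  apply: ler_sum => j _; apply: le_trans (ler_norm _) _.
  rewrite !normrM expr2 [leRHS]mulrCA mulrA; apply: ler_pM => //.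
  by apply: ler_pM.
apply: le_trans (ler_sum _ (fun k _ => h k)) _.
by rewrite sumr_const card_ord -[X in X <= _]mulr_natl natrM !mulrA.
Qed.

Section Lipschitz.
Variables (R : realType) (n : nat) (M : ptopologicalType) (A : atlas R n M).
Variable g : riemannian_metric A.
Implicit Types (i j : index A) (x y : M).

Section Segment.
Variables (i : index A) (y0 y1 : 'rV[R]_n).
Hypothesis seg : forall s, 0 <= s <= 1 -> codom i (y0 + s *: (y1 - y0)).
Let L (t : R^o) := y0 + ramp t *: (y1 - y0).
Let c (t : R) : M := ichart i (L t).

Let codomL t : codom i (L t).
Proof. by apply: seg; exact: ramp_itv. Qed.

Let L_C1 : Ck 1 setT L.
Proof.
have o : open [set: R^o] by exact: openT.
by apply: Ck_add => //; [exact: Ck_cst|apply: Ck_scalel => //; exact: C1_ramp].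
Qed.

Let dL (t : R) : is_derive (t : R^o) 1 L (dramp t *: (y1 - y0)).
Proof.
have [dd _] := L_C1; have h := dd t I.
apply: DeriveDef; first exact: diff_derivable.
have dr : differentiable (@ramp R : R^o -> R^o) t by have [d _] := @C1_ramp R; exact: d.
have dz := differentiableZl (y1 - y0) dr.
rewrite [LHS](@deriveD _ _ _ (cst y0) (fun t : R^o => ramp t *: (y1 - y0))) //; last first.
  exact: diff_derivable.
rewrite derive_cst add0r (deriveE _ dz) (diffZl _ dr); congr (_ *: _).
by rewrite -(deriveE _ dr) (@derive_val _ _ _ _ _ _ _ (is_derive_ramp t)).
Qed.

Let c_continuous : continuous c.
Proof.
move=> t; have [x ix xL] := codomL t.
have cL : L @ t --> L t by exact: (Ck0 L_C1).
have := ichart_continuous ix; rewrite xL => ci; exact: (cvg_comp _ _ cL ci).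
Qed.

Lemma segment_C1 : C1_curve A c.
Proof.
split=> // j; have oj : open (c @^-1` dom j).
  by apply: open_comp => [t _|]; [exact: c_continuous|exact: open_dom].
apply: (@C1_comp R _ _ _ _ (chart i @` (dom i `&` dom j)) L (chart j \o ichart i)).
- exact: oj.
- move=> t tj; exists (c t); last by rewrite /c ichartK.
  by split => //; exact: dom_ichart.
- by apply: Ck_sub L_C1.
- exact: transition_smooth.
Qed.

Lemma segment_speed t : tangent_norm g (c t) (velocity A c t) =
  let J := transition_jacobian i (chart_at A (c t)) (c t) in
  Num.sqrt (dotr ((dramp t *: (y1 - y0)) *m (J *m gram g (c t) *m J^T)) (dramp t *: (y1 - y0))).
Proof.
set j := chart_at A (c t).
have ji : dom j (c t) by exact: dom_chart_at.
have ii : dom i (c t) by exact: dom_ichart.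
have cL : chart i (c t) = L t by rewrite /c ichartK.
have dtr : differentiable (chart j \o ichart i) (L t).
  by rewrite -cL; exact: transition_differentiable.
have dLt : differentiable L t by have [d _] := L_C1; exact: d.
have -> : velocity A c t = (dramp t *: (y1 - y0)) *m transition_jacobian i j (c t).
  rewrite /velocity -/j derive1E.
  have -> : chart j \o c = (chart j \o ichart i) \o L by [].
  rewrite (diff_comp_derive _ dLt dtr) (deriveEjacobian _ dtr) /transition_jacobian cL.
  by rewrite (@derive_val _ _ _ _ _ _ _ (dL t)).
by rewrite /tangent_norm /dotr trmx_mul !mulmxA.
Qed.

(** The distance is at most the length of the segment run with [ramp]: the factor 2 bounds [dramp],
    and the square root comes from the entrywise bound on the quadratic form of the metric. *)
Lemma segment_dist B : (forall s, 0 <= s <= 1 ->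
    let x := ichart i (y0 + s *: (y1 - y0)) in
    let J := transition_jacobian i (chart_at A x) x in
    `|J *m gram g x *m J^T| <= B) ->
  (riemannian_dist g (ichart i y0) (ichart i y1) <=
    (2 * Num.sqrt ((n * n)%:R * B) * `|y1 - y0|)%:E)%E.
Proof.
move=> hB; have B0 : 0 <= B by apply: le_trans (hB 0 _) => //; rewrite lexx ler01.
apply: (@le_trans _ _ (curve_length g c)).
  apply: ereal_inf_lbound; exists c => //; split; first exact: segment_C1.
    by rewrite /c /L ramp0 scale0r addr0.
  by rewrite /c /L ramp1 scale1r addrC subrK.
set K := 2 * _ * _.
apply: (@le_trans _ _ (\int[@lebesgue_measure R]_(t in `[0%R, 1%R]) cst K%:E t)%E).
  apply: ge0_integral_le => t _; first by rewrite lee_fin sqrtr_ge0.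
  rewrite lee_fin segment_speed /=.
  have [d0 d2] := andP (dramp_itv t).
  have K0 : 0 <= K by rewrite /K !mulr_ge0 ?sqrtr_ge0.
  rewrite -(ger0_norm K0) -sqrtr_sqr; apply: ler_wsqrtr.
  apply: le_trans (dotr_mulmx_le _ _) _.
  have -> : K ^+ 2 = ((n * n)%:R * B) * (2 * `|y1 - y0|) ^+ 2.
    by rewrite /K !exprMn sqr_sqrtr ?mulr_ge0 //; ring.
  apply: ler_pM => //; first exact: ler_wpM2l (hB _ (ramp_itv t)).
  by rewrite ler_pXn2r ?nnegrE ?mulr_ge0 // normrZ ger0_norm // ler_wpM2r.
by rewrite integral_cst //= lebesgue_measure_itv /= lte01 oppr0 adde0 mule1.
Qed.

End Segment.

(** This links the Riemannian distance with the topology of [M]: near [x] the metric is bounded in a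
    chart, so nearby points are joined by short segments. *)
Lemma one_lipschitz_equicontinuous x (e : R) : 0 < e ->
  \forall y \near x, forall h, one_lipschitz g h -> `|h y - h x| <= e.
Proof.
move=> e0; have ix := dom_chart_at A x; set i := chart_at A x in ix.
pose G (y : 'rV[R]_n) := let z := ichart i y in
  let J := transition_jacobian i (chart_at A z) z in J *m gram g z *m J^T.
have cG : {for chart i x, continuous G}.
  exact: (Ck0 (@gram_smooth _ _ _ _ g i 0) (codom_chart ix)).
pose B := `|G (chart i x)| + 1.
have nG : \forall y \near chart i x, `|G y| <= B.
  have cn : `|G y| @[y --> chart i x] --> `|G (chart i x)|.
    have cG' : G @ chart i x --> G (chart i x) by exact: cG.
    exact: (cvg_norm cG').
  by apply: (cvgr_le _ cn); rewrite ltrDl.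
have : nbhs (chart i x) (codom i `&` [set y | `|G y| <= B]).
  by apply: filterI; [exact: near_codom|exact: nG].
move=> /nbhs_ballP[d /= d0 hd].
pose C := 2 * Num.sqrt ((n * n)%:R * B).
have C0 : 0 <= C by rewrite mulr_ge0 // sqrtr_ge0.
have dd : 0 < Num.min d (e / (C + 1)) by rewrite lt_min d0 divr_gt0 // ltr_wpDl.
have h1 : \forall y \near x, `|chart i y - chart i x| < Num.min d (e / (C + 1)).
  have /cvgrPdist_lt/(_ _ dd) := chart_cvg ix.
  by apply: filterS => y; rewrite distrC.
have h2 := near_dom ix.
near=> y; move=> h hh.
have iy : dom i y by near: y.
have : `|chart i y - chart i x| < Num.min d (e / (C + 1)) by near: y.
rewrite lt_min => /andP[yd ye].
have hseg s : 0 <= s <= 1 -> codom i (chart i x + s *: (chart i y - chart i x)) /\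
    `|G (chart i x + s *: (chart i y - chart i x))| <= B.
  move=> /andP[s0 s1]; apply: (hd (chart i x + s *: (chart i y - chart i x))).
  rewrite -ball_normE /= opprD addrA subrr sub0r normrN normrZ ger0_norm //.
  by apply: le_lt_trans yd; rewrite ler_piMl.
have := @segment_dist i (chart i x) (chart i y) (fun s hs => (hseg s hs).1) B
  (fun s hs => (hseg s hs).2).
rewrite !chartK // => /(le_trans (hh x y)); rewrite lee_fin distrC => /le_trans; apply.
rewrite -/C; apply: (@le_trans _ _ ((C + 1) * `|chart i y - chart i x|)).
  by rewrite ler_wpM2r // lerDl.
by rewrite mulrC -ler_pdivlMr ?ltW // ltr_wpDl.
Unshelve. all: by end_near. Qed.

End Lipschitz.

(** * Equilibria on a compact manifold *)

(** The k-th bit chooses between the closed sets [f k <= q k] and [f k >= q k]. Compactness makes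
    every branch converge, and separation makes its limit a single point. *)
Lemma cantor_parametrization (R : realType) (M : ptopologicalType)
    (f : nat -> M -> R) (q : nat -> R) :
  hausdorff_space M -> compact [set: M] -> (forall k, continuous (f k)) ->
  (forall x y, x != y -> exists k, f k x < q k < f k y \/ f k y < q k < f k x) ->
  exists g : cantor_space -> M, continuous g /\ forall x, exists b, g b = x.
Proof.
move=> hM cM cf sep.
pose half k (b : bool) : set M := if b then [set x | f k x <= q k] else [set x | q k <= f k x].
(* If the chosen half misses [U], the other half is taken, so that no branch dies. *)
pose refine (k : nat) (U : set M) (b : bool) : set M :=
  if `[< U `&` half k b !=set0 >] then U `&` half k b else U `&` half k (~~ b).
have halfT k x : half k true x \/ half k false x.
  by have [h|/ltW h] := leP (f k x) (q k); [left|right].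
have cl k b : closed (half k b).
  case: b.
    have -> : half k true = f k @^-1` [set x | x <= q k] by [].
    by apply: preimage_closed; [move=> x _; exact: cf|exact: closed_le].
  have -> : half k false = f k @^-1` [set x | q k <= x] by [].
  by apply: preimage_closed; [move=> x _; exact: cf|exact: closed_ge].
pose inv (U : set M) := closed U /\ U !=set0.
have [] := @tree_map_props (fun=> bool) M refine inv cM hM.
- move=> k U; rewrite eqEsubset; split => [x Ux|x [b _]]; last first.
    by rewrite /refine; case: ifP => _ [].
  have [hx|hx] := halfT k x; [exists true => //|exists false => //]; rewrite /refine.
    by rewrite ifT //; apply/asboolP; exists x.
  by rewrite ifT //; apply/asboolP; exists x.
- move=> k U b [clU [x Ux]]; rewrite /refine; case: ifPn => [/asboolP h|/asboolP h].
    by split=> //; exact: closedI.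
  split; first exact: closedI.
  exists x; split => //.
  by case: (halfT k x) b h => hx [] h //; exfalso; apply: h; exists x.
- by move=> U [].
- by split; [exact: closedT|exists point].
- by move=> U [].
- move=> x y /sep [k hk]; exists k => U b hx hy; move: hx hy; rewrite /refine.
  by case: hk => /andP[h1 h2]; case: ifP => _ [_ +] [_ +]; rewrite /half;
    case: b => /= h3 h4; lra.
- move=> f0 [cf0 sf0 _]; exists f0; split => // x.
  by have [b _ <-] := sf0 x I; exists b.
Qed.

Section Parametrization.
Variables (R : realType) (n : nat) (M : ptopologicalType) (A : atlas R n M).
Hypotheses (hausM : hausdorff_space M) (cptM : compact [set: M]).

Lemma sqdist_shift (z y : 'rV[R]_n) (a : R) j :
  sqdist (z + a *: delta_mx 0 j) y = sqdist z y - 2 * a * (y 0 j - z 0 j) + a ^+ 2.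
Proof.
rewrite /sqdist (bigD1 j) //= [in RHS](bigD1 j) //= !mxE !eqxx /=.
rewrite (eq_bigr (fun i => (y 0 i - z 0 i) ^+ 2)); last first.
  by move=> i ij; rewrite !mxE eqxx (negbTE ij) mulr0 addr0.
by ring.
Qed.

Lemma sqdist_coord (z y : 'rV[R]_n) j : (y 0 j - z 0 j) ^+ 2 <= sqdist z y.
Proof. by rewrite /sqdist (bigD1 j) //= lerDl sumr_ge0 // => i _; exact: sqr_ge0. Qed.

(* Shifting the centre of a well along a basis vector turns squared distances
   into coordinates of the chart. *)
Lemma separating_functions : exists (f : nat -> M -> R) (q : nat -> R),
  (forall k, continuous (f k)) /\
  (forall x y, x != y -> exists k, f k x < q k < f k y \/ f k y < q k < f k x).
Proof.
have /choice[r hr] : forall x : M, exists r : R, 0 < r /\ forall z,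
    sqdist (chart (chart_at A x) x) z <= r ^+ 2 -> chart_ball (chart_at A x) z r.
  move=> x; have [r r0 h] := chart_ball_near (dom_chart_at A x) (@filterT _ (nbhs x) _).
  by exists r; split => // z hz y hy; have [] := h z hz y hy.
pose c x (o : option 'I_n) :=
  chart (chart_at A x) x + (if o is Some j then (r x / 4) *: delta_mx 0 j else 0).
pose w x o := well (chart_at A x) (c x o) (r x).
have cball x o : chart_ball (chart_at A x) (c x o) (r x).
  have [r0 h] := hr x; apply: h; rewrite /c; case: o => [j|].
    rewrite /sqdist (bigD1 j) //= big1 ?addr0 => [|i ij]; last first.
      by rewrite !mxE (negbTE ij) andbF mulr0 addr0 subrr expr0n.
    by rewrite !mxE !eqxx /=; nra.
  by rewrite addr0 sqdistxx sqr_ge0.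
have cw x o : continuous (w x o).
  by move=> y; apply: CkM_continuous; apply: well_C1 => //; have [] := hr x.
have [] := (eq_ind _ (fun P => P [set: M]) cptM _ (@compact_cover M)) M setT (fun x => w x None @^-1` [set s | s < 1 / 4]).
- by move=> x _; apply: open_comp => [y _|]; [exact: cw|exact: open_lt].
- move=> x _; exists x => //=; rewrite /w /c addr0 well_center; first lra.
  exact: dom_chart_at.
move=> D _ cover.
(* A test is a centre in the finite cover, a shift of that centre, and a rational threshold;
   [pickle] enumerates these triples. *)
pose h (t : nat * option 'I_n * rat) := w (nth point (finmap.enum_fset D) t.1.1) t.1.2.
pose f k := if unpickle k is Some t then h t else fun=> 0.
pose q k := if unpickle k is Some t then ratr (t : nat * option 'I_n * rat).2 else 0 : R.
exists f, q; split => [k|x y xy].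
  rewrite /f; case: unpickle => [t|]; first exact: cw.
  by move=> x; exact: cst_continuous.
suff [k [ j]] : exists k j, h (k, j, 0%:Q) x != h (k, j, 0%:Q) y.
  have hE p : h (k, j, p) = h (k, j, 0%:Q) by [].
  rewrite neq_lt => /orP[|] /rat_in_itvoo[p]; rewrite in_itv /= => hp;
    exists (pickle (k, j, p)); rewrite /f /q pickleK hE /=; first by left.
  by right.
have [x0 /= Dx0 wx] := cover x I.
have [k _ kx0] := nthP point Dx0.
apply: contrapT => /forallNP heq.
have {}heq o : w x0 o x = w x0 o y.
  have /forallNP/(_ o)/negP := heq k; rewrite negbK => /eqP.
  by rewrite /h /= kx0.
have [r0 _] := hr x0.
pose i := chart_at A x0.
(* Within distance [r / 2] of the centre, a shift by [r / 4] keeps the squared distance below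
   [r ^+ 2]. The shifted wells are still quadratic there, and subtracting the unshifted one leaves
   an affine function of the coordinate [j]. *)
have near_center u : w x0 None u < 1 / 4 ->
    dom i u /\ forall j, w x0 (Some j) u =
      w x0 None u - (2 * r x0)^-1 * (chart i u 0 j - chart i x0 0 j) + 1 / 16.
  move=> hu; have := @well_lt1 _ _ _ _ i (c x0 None) (r x0) u.
  rewrite -/(w x0 None u) => -[|iu hw _]; first by apply: lt_trans hu _; lra.
  split => // j; rewrite {1}/w /well asboolT // plateauE ?hw /c ?addr0 sqdist_shift -/i.
    by field; rewrite gt_eqF.
  rewrite ler_pdivrMr ?exprn_gt0 // mul1r.
  have : sqdist (chart i x0) (chart i u) < r x0 ^+ 2 / 4.
    by move: hu; rewrite hw /c addr0 ltr_pdivrMr ?exprn_gt0 // -/i; lra.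
  have := sqdist_coord (chart i x0) (chart i u) j; nra.
have [ix hx] := near_center _ wx.
have [iy hy] : _ := near_center y (eq_ind _ (fun s => s < 1 / 4) wx _ (heq None)).
move/eqP: xy; apply; rewrite -(chartK ix) -(chartK iy); congr (ichart i _).
apply/rowP => j; have := heq (Some j); rewrite hx hy (heq None).
have ri : (2 * r x0)^-1 != 0 by rewrite invr_eq0 gt_eqF // mulr_gt0.
by move=> /addIr/addrI/oppr_inj/(mulfI ri)/addIr.
Qed.
End Parametrization.

(** A chaining argument: the set [Z] of points where the family stays within a bounded distance of
    its values at [point] is open and closed, hence everything. Compactness then makes the bound
    uniform. *)
Lemma compact_connected_oscillation (R : realType) (T : ptopologicalType)
    (H : set (T -> R)) : compact [set: T] -> connected [set: T] ->
  equicontinuous_family H ->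
  exists2 B, 0 <= B & forall h, H h -> forall x y, `|h x - h y| <= B.
Proof.
move=> cT conT eH.
pose Z := [set z | exists B, forall h, H h -> `|h z - h point| <= B].
have near1 x : \forall y \near x, forall h, H h -> `|h y - h x| <= 1 by exact: eH.
have Zstep x y : Z x -> (forall h, H h -> `|h y - h x| <= 1) -> Z y.
  move=> [B hB] h1; exists (B + 1) => h Hh.
  rewrite -(subrKA (h x)); apply: le_trans (ler_normD _ _) _.
  by rewrite addrC; apply: lerD; [exact: hB|exact: h1].
have ZT : Z = setT.
  apply: conT; first by exists point, 0 => h _; rewrite subrr normr0.
    exists Z; last by rewrite setTI.
    rewrite openE => x Zx; rewrite /interior /=; apply: filterS (near1 x) => y.
    exact: Zstep.
  exists Z; last by rewrite setTI.
  move=> x /(_ _ (near1 x))[y [Zy xy]]; apply: Zstep Zy _ => h Hh.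
  by rewrite distrC; exact: xy.
have [B [hB B0]] : exists B : R, (forall x h, H h -> `|h x - h point| <= B) /\ 0 <= B.
  (* Compactness in its near-covering form: each point has a neighbourhood on which all sufficiently
     large [B] work. *)
  have near_bound : \forall B \near +oo, [set: T] `<=`
      (fun B x => forall h, H h -> `|h x - h point| <= B) B.
    apply: ((iffLR (@compact_near_coveringP _ _) cT)) => x _.
    have [B hB] : Z x by rewrite ZT.
    exists ([set y | forall h, H h -> `|h y - h x| <= 1], [set b | B + 1 < b]).
      by split; [exact: near1|exists (B + 1); rewrite num_real].
    move=> [y b] /= [h1 Bb] h Hh; apply: le_trans (ltW Bb).
    rewrite -(subrKA (h x)); apply: le_trans (ler_normD _ _) _.
    by rewrite addrC; apply: lerD; [exact: hB|exact: h1].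
  have [B [/= hB B0]] := @filter_ex _ (pinfty_nbhs R) _ _
    (filterI near_bound (nbhs_pinfty_ge (num_real (0 : R)))).
  by exists B; split => // x h; exact: hB.
exists (B + B); first by rewrite addr_ge0.
move=> h Hh x y; rewrite -(subrKA (h point)); apply: le_trans (ler_normD _ _) _.
by apply: lerD; [exact: hB|rewrite distrC; exact: hB].
Qed.

Section ManifoldEquilibrium.
Variables (R : realType) (n : nat) (M : ptopologicalType) (A : atlas R n M).
Variable g : riemannian_metric A.
Hypothesis manM : closed_connected_manifold A.

Lemma one_lipschitz_equi : equicontinuous_family (one_lipschitz g).
Proof.
have [hausM _ _] := manM.
by move=> x e e0; exact: one_lipschitz_equicontinuous.
Qed.

Lemma one_lipschitz_continuous h : one_lipschitz g h -> continuous h.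
Proof. exact: equicontinuous_continuous one_lipschitz_equi. Qed.

Lemma continuous_borel_measurable (h : M -> R) : continuous h ->
  measurable_fun setT (h : borel M -> R).
Proof.
move=> ch; apply: open_preimage_measurable_fun => O oO.
by apply: sub_sigma_algebra; apply: open_comp => // x _; exact: ch.
Qed.

Lemma one_lipschitz_sub h c : one_lipschitz g h -> one_lipschitz g (fun x => h x - c).
Proof. by move=> hh x y; rewrite opprB addrA subrK; exact: hh. Qed.

(** Adding a constant does not change a difference of integrals against probabilities, so it
    suffices to test functions vanishing at [point], which are uniformly bounded. *)
Lemma d1_distribution_le (P Q : probability cantor_measurable R)
    (X : {mfun cantor_measurable >-> borel M}) e :
  (forall h, one_lipschitz g h -> h point = 0 ->
    `|Rintegral P setT (h \o X) - Rintegral Q setT (h \o X)| <= e) ->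
  (d1 g (distribution P X) (distribution Q X) <= e%:E)%E.
Proof.
have [_ cptM conM] := manM; move=> hPQ.
have [B B0 hB] := compact_connected_oscillation cptM conM one_lipschitz_equi.
apply: ub_ereal_sup => _ [h hh <-].
have mh := continuous_borel_measurable (one_lipschitz_continuous hh).
have mhX : measurable_fun setT (h \o X) by exact: measurableT_comp.
have hX t : `|(h \o X) t| <= B + `|h point|.
  rewrite /= -(subrK (h point) (h (X t))); apply: le_trans (ler_normD _ _) _.
  by rewrite lerD2r; exact: hB.
have intX (S : probability cantor_measurable R) : S.-integrable setT (EFin \o (h \o X)).
  exact: (@bounded_integrable _ _ _ S setT (h \o X) (B + `|h point|)).
have int (S : probability cantor_measurable R) :
    (\int[distribution S X]_y (h y)%:E)%E = (Rintegral S setT (h \o X))%:E.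
  rewrite integral_distribution; last 2 first.
  - exact: measurableT_comp.
  - exact: intX.
  by rewrite fineK //; exact: integrable_fin_num (intX S).
rewrite !int -EFinB lee_fin; apply: le_trans (ler_norm _) _.
have := hPQ _ (one_lipschitz_sub (h point) hh) (subrr _).
have shift (S : probability cantor_measurable R) :
    Rintegral S setT ((fun x => h x - h point) \o X) = Rintegral S setT (h \o X) - h point.
  rewrite /= RintegralB //=; last first.
    exact: (@bounded_integrable _ _ _ S setT (cst (h point)) `|h point|).
  congr (_ - _); rewrite Rintegral_cst //.
  have -> : fine (S setT) = 1 by exact: (congr1 fine (probability_setT S)).
  by rewrite mulr1.
by rewrite !shift opprB addrA subrK.
Qed.

(** The game is pulled back along the surjection [gam]: the cost at [b] is the cost at [gam b] under
    the law of [gam]. Surjectivity turns a minimum over the Cantor space into one over [M]. *)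
Theorem manifold_equilibrium (V : M -> borel_probability M R -> R) (K : R) :
  (forall m, continuous (V^~ m)) -> 0 <= K ->
  (forall m1 m2 e, 0 <= e -> (d1 g m1 m2 <= e%:E)%E ->
    forall x, `|V x m1 - V x m2| <= K * e) ->
  exists (m : borel_probability M R) (v : R),
    (forall x, v <= V x m) /\ m [set x | v < V x m] = 0%E.
Proof.
have [hausM cptM conM] := manM; move=> cV K0 lipV.
have [f [q [cf sep]]] := separating_functions A hausM cptM.
have [gam [cgam sgam]] := cantor_parametrization hausM cptM cf sep.
have mgam : measurable_fun setT (gam : cantor_measurable -> borel M).
  apply: (@measurability _ _ cantor_measurable (borel M) setT gam (@open M) erefl) => _ [W oW <-]; rewrite setTI.
  by apply: (@open_cantor_measurable R); apply: open_comp => // b _; exact: cgam.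
pose X : {mfun cantor_measurable >-> borel M} := mfun_Sub (mem_set mgam).
have [B B0 hB] := compact_connected_oscillation cptM conM one_lipschitz_equi.
(* The normalization at [point] makes the family bounded by the oscillation [B]. *)
pose fam := [set h \o gam | h in [set h | one_lipschitz g h /\ h point = 0]].
have [ | | | | | |Q [v [hv hQ]]] := @cantor_equilibrium R
  (fun b P => V (gam b) (distribution P X)) fam B K.
- by move=> P b; exact: (cvg_comp _ _ (cgam b) (cV (distribution P X) (gam b))).
- move=> b e e0; have := cgam b _ (one_lipschitz_equi (gam b) e0).
  apply: (@filterS _ (nbhs b)) => y /= hy _ [h [hh _] <-]; exact: hy.
- by move=> _ b [h [hh h0] <-]; rewrite /= -[h _]subr0 -h0; exact: hB.
- exact: B0.
- exact: K0.
- move=> P Q e e0 hPQ b; apply: lipV => //; apply: d1_distribution_le => h hh h0.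
  by apply: hPQ; exists h.
exists (distribution Q X), v; split => // x.
by have [b <-] := sgam x; exact: hv.
Qed.

End ManifoldEquilibrium.

(** * Perron's method *)

Lemma grad_continuous (R : realType) n (f : 'rV[R]_n -> R) y :
  (forall v, {for y, continuous ('D_v f)}) -> {for y, continuous (grad f)}.
Proof.
move=> h.
have hj j : (fun z => 'D_(delta_mx 0 j) f z *: (delta_mx 0 j : 'rV[R]_n)) @ y -->
    'D_(delta_mx 0 j) f y *: (delta_mx 0 j : 'rV[R]_n).
  have hh : 'D_(delta_mx 0 j) f z @[z --> y] --> 'D_(delta_mx 0 j) f y by exact: h.
  exact: cvgZr_tmp hh.
have gE z : grad f z = \sum_j 'D_(delta_mx 0 j) f z *: (delta_mx 0 j : 'rV[R]_n).
  by rewrite [LHS]row_sum_delta; apply: eq_bigr => j _; rewrite mxE.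
have : (fun z => \sum_j 'D_(delta_mx 0 j) f z *: (delta_mx 0 j : 'rV[R]_n)) @ y -->
    \sum_j 'D_(delta_mx 0 j) f y *: (delta_mx 0 j : 'rV[R]_n).
  by apply: (@cvg_big _ _ +%R 0 xpredT add_continuous _ (nbhs y)) => j _; exact: hj.
by rewrite -gE; under eq_fun do rewrite -gE.
Qed.

Lemma compact_max (R : realType) (T : ptopologicalType) (f : T -> R) :
  compact [set: T] -> continuous f -> exists x, forall y, f y <= f x.
Proof.
move=> cT cf; have [x _ h] := @compact_EVT_max T R f setT (ex_intro _ point I) cT
  (continuous_subspaceT cf).
by exists x => y; apply: h; rewrite inE.
Qed.

Lemma strict_max_gap (R : realType) (T : ptopologicalType) (f : T -> R) x (O : set T) :
  compact [set: T] -> continuous f -> (forall y, y <> x -> f y < f x) -> nbhs x O ->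
  exists2 e, 0 < e & forall y, f x - e < f y -> O y.
Proof.
move=> cT cf fx xO.
have cC : compact (~` interior O).
  by apply: subclosed_compact cT _ => //; exact/open_closedC/open_interior.
have [C0|/set0P C0] := eqVneq (~` interior O) set0.
  exists 1 => // y _; apply: interior_subset; apply: contrapT => h.
  by have : (~` interior O) y by []; rewrite C0.
have [z zO h] := compact_EVT_max C0 cC (continuous_subspaceT cf).
have zx : f z < f x by apply: fx => zx; move: zO; rewrite inE zx; apply.
exists (f x - f z); first by rewrite subr_gt0.
move=> y; rewrite opprB addrC subrK => zy; apply: interior_subset; apply: contrapT => yO.
by have := h y; rewrite inE leNgt zy => /(_ yO).
Qed.

Lemma cvg_to_pair (T : Type) (U V : topologicalType) (F : set_system T) (FF : Filter F)
    (f : T -> U) (g : T -> V) (a : U) (b : V) :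
  f @ F --> a -> g @ F --> b -> (f x, g x) @[x --> F] --> (a, b).
Proof. exact: cvg_pair. Qed.

Section Perron.
Variables (R : realType) (n : nat) (M : ptopologicalType) (A : atlas R n M).
Hypotheses (hausM : hausdorff_space M) (cptM : compact [set: M]).
Variables (H : cotangent A * R -> R) (u0 M0 : R).
Hypothesis Hcont : forall i (z : 'rV[R]_n * R * 'rV[R]_n), codom i z.1.1 ->
  {for z, continuous (fun z => local_ham H i z.1.1 z.1.2 z.2)}.
Hypothesis Hmono : forall xi s t, s <= t -> H (xi, s) <= H (xi, t).
(** Convexity and evenness enter Perron's method only through this monotonicity along rays, and
    superlinearity only through [Hcoercive]. *)
Hypothesis Hray : forall x p s t, 0 <= t <= 1 ->
  H (covector A x (t *: p), s) <= H (covector A x p, s).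
Hypothesis Hcoercive : forall x p s, p != 0 ->
  exists2 t, 0 <= t & 0 < H (covector A x (t *: p), s).
Hypothesis Hu0 : forall x, H (covector A x 0, u0) <= 0.
Hypothesis HM0 : forall x, 0 < H (covector A x 0, M0).

(** The coordinates [diffM A phi y] refer to [chart_at A y], which may jump with [y]; the covector
    they name does not, so [H] is read in one fixed chart. *)
Lemma jet_continuous (phi : M -> R) (s : M -> R) x :
  CkM A 1 phi -> {for x, continuous s} ->
  {for x, continuous (fun y => H (covector A y (diffM A phi y), s y))}.
Proof.
move=> hphi cs; have ix := dom_chart_at A x; set i := chart_at A x in ix.
pose Z y := (chart i y, s y, grad (phi \o ichart i) (chart i y)).
have ZE y : dom i y -> local_ham H i (Z y).1.1 (Z y).1.2 (Z y).2 =
    H (covector A y (diffM A phi y), s y).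
  by move=> iy; rewrite /local_ham /= diffM_coord //; exact: CkM_differentiable.
have cZ : Z @ x --> Z x.
  have cg : grad (phi \o ichart i) (chart i y) @[y --> x] --> grad (phi \o ichart i) (chart i x).
    apply: (cvg_comp _ _ (chart_cvg ix)); apply: grad_continuous => v.
    by have [_ h] := hphi i; apply: h; exact: codom_chart.
  have cs' : s @ x --> s x by exact: cs.
  exact: (cvg_to_pair _ (cvg_to_pair _ (chart_cvg ix) cs') cg).
have h : (fun y => local_ham H i (Z y).1.1 (Z y).1.2 (Z y).2) @ x -->
    H (covector A x (diffM A phi x), s x).
  by rewrite -ZE //; exact: (cvg_comp _ _ cZ (@Hcont i (Z x) (codom_chart ix))).
apply: cvg_trans h; apply: near_eq_cvg; have h' := near_dom ix.
by near=> y; apply: ZE; near: y.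
Unshelve. all: by end_near. Qed.

Lemma ham_continuous_value x p : continuous (fun s => H (covector A x p, s)).
Proof.
move=> s; pose i := chart_at A x; have ix := dom_chart_at A x.
pose Z s := (chart i x, s, p) : 'rV[R]_n * R * 'rV[R]_n.
have ZE s' : local_ham H i (Z s').1.1 (Z s').1.2 (Z s').2 = H (covector A x p, s').
  by rewrite /local_ham /= cov_of_coord_chart_at.
have cZ : Z @ s --> Z s.
  exact: (cvg_to_pair _ (cvg_to_pair _ (cvg_cst (chart i x)) (@cvg_id _ _)) (cvg_cst p)).
have : (fun s => local_ham H i (Z s).1.1 (Z s).1.2 (Z s).2) @ s --> H (covector A x p, s).
  by rewrite -(ZE s); exact: (cvg_comp _ _ cZ (@Hcont i (Z s) (codom_chart ix))).
by under eq_fun do rewrite ZE.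
Qed.

Lemma local_ray i y s q t : 0 <= t <= 1 ->
  local_ham H i y s (t *: q) <= local_ham H i y s q.
Proof. by move=> h; rewrite /local_ham /cov_of_coord -scalemxAl; exact: Hray. Qed.

(** On every ray [H] becomes positive at some point and, by [Hray], stays positive beyond.
    Compactness of the unit sphere gives one radius for all directions and all base points near
    [x]. *)
Lemma local_coercive x : let i := chart_at A x in
  exists2 K, 0 < K & \forall y \near x, forall q,
    local_ham H i (chart i y) u0 q <= 0 -> sqdist 0 q < K ^+ 2.
Proof.
move=> i; have ix := dom_chart_at A x; rewrite -/i in ix.
pose S := [set q : 'rV[R]_n | sqdist 0 q = 1].
have cS : compact S.
  apply: (subclosed_compact _ (@compact_sqball R n 0 1 ler01)).
    have -> : S = sqdist 0 @^-1` [set 1] by [].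
    apply: preimage_closed; first by move=> y _; exact: sqdist_continuous.
    exact: accessible_closed_set1 (hausdorff_accessible (@Rhausdorff R)) _.
  by move=> q /= ->; rewrite expr1n.
(* The ray of direction [q] over [yT.1] has become positive before time [yT.2]. *)
pose P (yT : 'rV[R]_n * R) q :=
  exists2 t, 0 <= t <= yT.2 & 0 < local_ham H i yT.1 u0 (t *: q).
have : \forall yT \near filter_prod (nbhs (chart i x)) (pinfty_nbhs R), S `<=` P yT.
  apply: ((compact_near_coveringP S).1 cS) => q Sq.
  have q0 : q != 0.
    by apply: contra_eq_neq Sq => ->; rewrite sqdistxx eq_sym oner_eq0.
  have [t t0 ht] := Hcoercive x u0 q0.
  have h0 : 0 < local_ham H i (chart i x) u0 (t *: q).
    by rewrite /local_ham cov_of_coord_chart_at.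
  pose Z (qy : 'rV[R]_n * 'rV[R]_n) := (qy.2, u0, t *: qy.1).
  have cZ : Z qy @[qy --> (q, chart i x)] --> Z (q, chart i x).
    have ct : t *: qy.1 @[qy --> (q, chart i x)] --> t *: q.
      by apply: cvgZl_tmp; exact: cvg_fst.
    exact: (cvg_to_pair _ (cvg_to_pair _ cvg_snd (cvg_cst u0)) ct).
  have cL : local_ham H i (Z qy).1.1 (Z qy).1.2 (Z qy).2 @[qy --> (q, chart i x)] -->
      local_ham H i (chart i x) u0 (t *: q).
    exact: (cvg_comp _ _ cZ (@Hcont i (Z (q, chart i x)) (codom_chart ix))).
  have [[U V] /= [Uq Vx] UV] := cvgr_gt _ cL _ h0.
  exists (U, V `*` [set T | t <= T]) => /=.
    split => //; exists (V, [set T | t <= T]) => //=; split => //.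
    by exists t; split => [|T /ltW //]; rewrite num_real.
  by move=> [q' [y T]] /= [Uq' [Vy tT]]; exists t => /=; [rewrite t0|exact: (UV (q', y))].
move=> [[V W] /= [Vx Wy] VW].
have [T [WT T0]] : exists T, W T /\ 0 < T.
  have : \forall T \near +oo, W T /\ 0 < T.
    by apply: filterI => //; exists 0; split => //; rewrite num_real.
  by move=> /filter_ex.
exists T => //; have xV : nbhs x (chart i @^-1` V) by exact: (chart_cvg ix Vx).
apply: filterS xV => y Vy q Lq.
rewrite ltNge; apply/negP => Tq.
have rho0 : 0 < Num.sqrt (sqdist 0 q) by rewrite sqrtr_gt0 (lt_le_trans _ Tq) // exprn_gt0.
set rho := Num.sqrt (sqdist 0 q) in rho0.
have rhoT : T <= rho by rewrite -(ler_pXn2r (n := 2)) ?nnegrE ?(ltW T0) ?(ltW rho0) // sqr_sqrtr ?sqdist_ge0.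
have Se : S (rho^-1 *: q).
  rewrite /S /sqdist /=; under eq_bigr do rewrite !mxE subr0 exprMn.
  rewrite -mulr_sumr exprVn sqr_sqrtr ?sqdist_ge0 //.
  under eq_bigr do rewrite -[q 0 _]subr0.
  have -> : \sum_i0 (q 0 i0 - 0) ^+ 2 = sqdist 0 q by apply: eq_bigr => j _; rewrite mxE.
  by rewrite mulVf // gt_eqF // (lt_le_trans _ Tq) // exprn_gt0.
have [t /andP[t0 tT]] := VW (_, _) (conj Vy WT) _ Se.
have tr : 0 <= t / rho <= 1.
  by rewrite divr_ge0 ?(ltW rho0) //= ler_pdivrMr // mul1r (le_trans tT).
rewrite /= scalerA => h; have := lt_le_trans h (local_ray i (chart i y) u0 q tr).
by rewrite ltNge Lq.
Qed.

Definition subsolutions : set (M -> R) :=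
  [set w | [/\ continuous w, forall x, u0 <= w x & viscosity_subsolution H w]].

(** At a maximum of [w] the constant 0 is a test function, and [H] is positive at zero slope from
    the value [M0] on. *)
Lemma subsolution_le w : subsolutions w -> forall x, w x <= M0.
Proof.
move=> [cw _ sw]; have [z zmax] := compact_max cptM cw => x.
apply: le_trans (zmax x) _; rewrite leNgt; apply/negP => h.
have zmax' : \forall y \near z, w y - 0 <= w z - 0 by near=> y; rewrite !subr0.
have := sw (fun=> 0) z (CkM_cst _ _) zmax'; rewrite diffM_cst; apply/negP.
by rewrite -ltNge (lt_le_trans (HM0 z)) // Hmono // ltW.
Unshelve. all: by end_near. Qed.

Lemma cst_subsolution : subsolutions (fun=> u0).
Proof.
split=> // [x|phi x hphi h]; first exact: cst_continuous.
rewrite -(touching_diffM _ (CkM_differentiableM _ hphi) h) ?diffM_cst //.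
exact: CkM_differentiableM (CkM_cst _ _).
Qed.

(** A cone argument: if [w - C * sqrt W] had its maximum away from the vertex, a test function would
    touch [w] there with slope [C / r], which coercivity forbids. As [w >= u0] and [H] increases
    with the value, the bound [K] at the value [u0] applies to all subsolutions at once. *)
Lemma subsolution_cone x : let i := chart_at A x in
  exists C r, [/\ 0 < C, 0 < r & forall c w, dom i c ->
    sqdist (chart i x) (chart i c) <= r ^+ 2 -> subsolutions w ->
    forall y, w y <= w c + C * Num.sqrt (well i (chart i c) r y)].
Proof.
move=> i; have ix := dom_chart_at A x; rewrite -/i in ix.
have [K K0 hK] := local_coercive x.
have [r r0 hr] := chart_ball_near ix hK.
(* The first summand keeps the maximum where [W < 1], so that the well is quadratic there; the
   second makes [C / r] exceed [K]; the last makes both strict. *)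
pose C := `|M0 - u0| + K * r + 1.
have Kr : 0 < K * r by exact: mulr_gt0.
have CD : M0 - u0 < C by rewrite /C; have := ler_norm (M0 - u0); lra.
have CK : K * r < C by rewrite /C; have := normr_ge0 (M0 - u0); lra.
have C0 : 0 < C by lra.
exists C, r; split => // c w ic rc Sw.
have [cw w0 sw] := Sw.
have ball : chart_ball i (chart i c) r by move=> y /(hr _ rc)[].
have wC1 := well_C1 hausM r0 ball; have cwell := CkM_continuous wC1.
pose W := well i (chart i c) r.
have cg : continuous (fun y => w y - C * Num.sqrt (W y)).
  move=> y; apply: cvgB; first exact: cw.
  apply: cvgM; first exact: cvg_cst.
  have cW : W @ y --> W y by exact: cwell.
  exact: (cvg_comp _ _ cW (@sqrt_continuous R (W y))).
have [z zmax] := compact_max cptM cg.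
have hz : C * Num.sqrt (W z) <= w z - w c.
  by have := zmax c; rewrite /W well_center // sqrtr0 mulr0; lra.
have Wz0 : 0 <= W z by exact: well_ge0.
suff Wz : W z = 0.
  have zc : z = c by exact: (well_eq0 r0 ic Wz).
  by move=> y; have := zmax y; rewrite /= zc /W well_center // sqrtr0 mulr0; lra.
apply/eqP; rewrite eq_le Wz0 andbT leNgt; apply/negP => Wz.
set sg := Num.sqrt (W z) in hz; have sg0 : 0 < sg by rewrite sqrtr_gt0.
have sgE : sg ^+ 2 = W z by rewrite sqr_sqrtr.
have sg1 : sg < 1.
  by rewrite -(ltr_pM2l C0) mulr1; have := subsolution_le Sw z; have := w0 c; lra.
have Wz1 : W z < 1 by rewrite -sgE expr2; nra.
have [iz zE _] := well_lt1 Wz1.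
pose phi y := C / (2 * sg) * W y.
have phiC : CkM A 1 phi by exact: CkM_scale.
have := sw phi z phiC; apply/not_implyP; split.
  near=> y; rewrite /phi.
  (* AM-GM: sqrt (W y) <= W y / (2 sg) + sg / 2, with equality at z *)
  have h : 2 * sg * Num.sqrt (W y) <= W y + sg ^+ 2.
    have e : Num.sqrt (W y) ^+ 2 = W y by rewrite sqr_sqrtr //; exact: well_ge0.
    by have := sqr_ge0 (Num.sqrt (W y) - sg); rewrite sqrrB e; lra.
  have {}h : C * Num.sqrt (W y) <= C / (2 * sg) * (W y + sg ^+ 2).
    rewrite -mulrA ler_pM2l // ler_pdivlMl; [lra|lra].
  have e2 : C / (2 * sg) * sg ^+ 2 = C * sg / 2 by field; rewrite gt_eqF.
  have := zmax y; rewrite -/sg -sgE; rewrite mulrDr e2 in h; rewrite e2; lra.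
apply/negP; rewrite -ltNge.
have dphi : differentiable (phi \o ichart i) (chart i z) by exact: CkM_differentiable.
have := Hmono (covector A z (diffM A phi z)) (w0 z); apply: lt_le_trans.
rewrite ltNge -(diffM_coord iz dphi); apply/negP => h.
have ballz : sqdist (chart i c) (chart i z) <= (2 * r) ^+ 2.
  have := zE; rewrite -/W -/(W z) => /esym e.
  have : sqdist (chart i c) (chart i z) <= r ^+ 2.
    by rewrite -[leRHS]mul1r -ler_pdivrMr ?exprn_gt0 // e ltW.
  by move/le_trans; apply; rewrite exprMn ler_peMl ?exprn_ge0 ?(ltW r0) //; lra.
have [_ /=] := hr _ rc _ ballz; rewrite (chartK iz) => hq.
have {hq h} := hq _ h; apply/negP; rewrite -leNgt.
(* In the chart the gradient of [phi] at [z] has Euclidean norm [C / r]. *)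
rewrite (_ : phi \o ichart i = (fun y => C / (2 * sg) * (W \o ichart i) y)) //.
rewrite (gradZ _ (CkM_differentiable wC1 iz)).
rewrite well_grad // /sqdist; under eq_bigr do rewrite !mxE subr0 !mulrA exprMn.
rewrite -mulr_sumr -/(sqdist (chart i c) (chart i z)).
have -> : sqdist (chart i c) (chart i z) = sg ^+ 2 * r ^+ 2.
  rewrite sgE; have := zE; rewrite -/W -/(W z) => ->; rewrite divfK //.
  by rewrite gt_eqF // exprn_gt0.
have -> : (C / (2 * sg) * 2 / r ^+ 2) ^+ 2 * (sg ^+ 2 * r ^+ 2) = (C / r) ^+ 2.
  by field; rewrite !gt_eqF.
rewrite ler_pXn2r ?nnegrE ?(ltW K0) ?divr_ge0 ?(ltW C0) ?(ltW r0) //.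
by rewrite ler_pdivlMr // ltW.
Unshelve. all: by end_near. Qed.

(** The cone estimate is applied with vertex at [x] and with vertex at the nearby point [y]. *)
Lemma subsolutions_equicontinuous x e : 0 < e ->
  \forall y \near x, forall w, subsolutions w -> `|w y - w x| <= e.
Proof.
move=> e0; have [C [r [C0 r0 hC]]] := subsolution_cone x.
have ix := dom_chart_at A x; set i := chart_at A x in ix hC.
have wx : (fun y => C * Num.sqrt (plateau (sqdist (chart i x) (chart i y) / r ^+ 2))) @ x --> 0.
  have <- : C * Num.sqrt (plateau (sqdist (chart i x) (chart i x) / r ^+ 2)) = 0.
    by rewrite sqdistxx mul0r plateauE // sqrtr0 mulr0.
  apply: cvgM; first exact: cvg_cst.
  have c1 : sqdist (chart i x) (chart i y) / r ^+ 2 @[y --> x] -->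
      sqdist (chart i x) (chart i x) / r ^+ 2.
    apply: cvgM; last exact: cvg_cst.
    exact: (cvg_comp _ _ (chart_cvg ix) (@sqdist_continuous _ _ (chart i x) (chart i x))).
  have c2 : plateau (sqdist (chart i x) (chart i y) / r ^+ 2) @[y --> x] -->
      plateau (sqdist (chart i x) (chart i x) / r ^+ 2).
    by apply: (cvg_comp _ _ c1); exact: (Ck0 (@C1_plateau R)).
  exact: (cvg_comp _ _ c2 (@sqrt_continuous R _)).
have d0 : (fun y => sqdist (chart i x) (chart i y)) @ x --> 0.
  rewrite -(sqdistxx (chart i x)).
  exact: (cvg_comp _ _ (chart_cvg ix) (@sqdist_continuous _ _ (chart i x) (chart i x))).
have h1 := cvgr_lt _ wx _ e0.
have h2 := cvgr_lt _ d0 _ (exprn_gt0 2 r0).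
have h3 := near_dom ix.
near=> y.
have iy : dom i y by near: y.
have yr : sqdist (chart i x) (chart i y) < r ^+ 2 by near: y; exact: h2.
have ye : C * Num.sqrt (plateau (sqdist (chart i x) (chart i y) / r ^+ 2)) < e by near: y; exact: h1.
move=> w Sw; rewrite ler_norml lerBrDl lerBlDl addrC; apply/andP; split.
  have := hC y w iy (ltW yr) Sw x; rewrite /well asboolT // sqdistC; lra.
have := hC x w ix _ Sw y; rewrite sqdistxx /well asboolT // => /(_ (sqr_ge0 _)); lra.
Unshelve. all: by end_near. Qed.

(** Equicontinuity makes this supremum continuous, so semicontinuous envelopes do not appear. *)
Definition perron x : R := sup [set w x | w in subsolutions].

Lemma perron_has_sup x : has_sup [set w x | w in subsolutions].
Proof.
split; first by exists u0; exists (fun=> u0) => //; exact: cst_subsolution.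
by exists M0 => _ [w Sw <-]; exact: subsolution_le.
Qed.

Lemma perron_ge w x : subsolutions w -> w x <= perron x.
Proof. by move=> Sw; apply: ub_le_sup; [by have [] := perron_has_sup x|exists w]. Qed.

Lemma perron_approx x e : 0 < e -> exists2 w, subsolutions w & perron x - e < w x.
Proof. by move=> e0; have [_ [w Sw <-]] := sup_adherent e0 (perron_has_sup x); exists w. Qed.

Lemma perron_continuous : continuous perron.
Proof.
move=> x; apply/cvgrPdist_le => e e0.
have e2 : 0 < e / 2 by lra.
near=> y.
have h : forall w, subsolutions w -> `|w y - w x| <= e / 2.
  by near: y; exact: subsolutions_equicontinuous.
have [w Sw hw] := perron_approx x e2; have [v Sv hv] := perron_approx y e2.
have := h w Sw; have := h v Sv; rewrite !ler_norml.
by have := perron_ge y Sw; have := perron_ge x Sv; lra.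
Unshelve. all: by end_near. Qed.

(** A steep well with zero derivative at its centre turns a local maximum into a strict global one
    without changing the slope of the test function; extrema can then be taken over the whole
    compact space. *)
Lemma strict_local_max (f : M -> R) x : continuous f ->
  (\forall y \near x, f y <= f x) ->
  exists tau, [/\ CkM A 1 tau, tau x = 0, diffM A tau x = 0
    & forall y, y <> x -> f y - tau y < f x].
Proof.
move=> cf fx; have ix := dom_chart_at A x; set i := chart_at A x in ix.
have [r r0 hr] := chart_ball_near ix (@filterT _ (nbhs x) _).
have ball : chart_ball i (chart i x) r.
  by move=> y hy; have [] := hr (chart i x) _ y hy; rewrite ?sqdistxx ?sqr_ge0.
have wC := well_C1 hausM r0 ball.
have [e /andP[e0 e1] he] := well_nbhs r0 ix fx.
have [z zmax] := compact_max cptM cf.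
have D0 : 0 <= f z - f x by rewrite subr_ge0.
(* Where the well is at least [e], the penalty [L * e] exceeds the largest possible gain
   [f z - f x]. *)
pose L := (f z - f x) / e + 1.
have L0 : 0 < L by rewrite /L ltr_wpDl // divr_ge0 // ltW.
have Wx0 := @well_center _ _ _ A i r x ix.
exists (fun y => L * well i (chart i x) r y); split.
- exact: CkM_scale.
- by rewrite Wx0 mulr0.
- rewrite diffMZ; last exact: CkM_differentiableM.
  rewrite (_ : diffM A _ x = grad (well i (chart i x) r \o ichart i) (chart i x)) //.
  by rewrite well_grad ?Wx0 // subrr !scaler0.
- move=> y yx; have [yO|ye] := ltP (well i (chart i x) r y) e.
    have W0 : 0 < well i (chart i x) r y.
      rewrite lt_neqAle well_ge0 andbT eq_sym; apply/eqP => W0; apply: yx.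
      exact: (well_eq0 r0 ix W0).
    by have := he y yO; have := mulr_gt0 L0 W0; lra.
  have := ler_wpM2l (ltW L0) ye; rewrite {1}/L mulrDl divfK ?gt_eqF // => h.
  by have := zmax y; lra.
Qed.

(** Stability under suprema: a subsolution [w] nearly attaining the supremum at [x] is touched by a
    translate of [psi] at a point near [x], where [H] is still positive. *)
Lemma perron_subsolution : viscosity_subsolution H perron.
Proof.
move=> phi x hphi phix; rewrite leNgt; apply/negP => Hx.
have cphi := CkM_continuous hphi.
have cf : continuous (fun y => perron y - phi y).
  by move=> y; apply: cvgB; [exact: perron_continuous|exact: cphi].
have [tau [tauC taux dtaux tau_lt]] := strict_local_max cf phix.
pose psi y := phi y + tau y.
have psiC : CkM A 1 psi by exact: CkM_add.
have cpsi := CkM_continuous psiC.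
have dpsi : diffM A psi x = diffM A phi x.
  by rewrite diffMD ?dtaux ?addr0 //; exact: CkM_differentiableM.
have [e e0 He] : exists2 e, 0 < e & 0 < H (covector A x (diffM A phi x), perron x - e).
  have c : (fun e => H (covector A x (diffM A phi x), perron x - e)) @ (0 : R) -->
      H (covector A x (diffM A phi x), perron x).
    have c0 : perron x - e @[e --> (0 : R)] --> perron x.
      by rewrite -[X in _ --> X]subr0; apply: cvgB; [exact: cvg_cst|exact: cvg_id].
    exact: (cvg_comp _ _ c0 (@ham_continuous_value x _ (perron x))).
  have h : \forall e \near 0^'+, 0 < H (covector A x (diffM A phi x), perron x - e).
    exact: (cvgr_gt _ (cvg_at_right_filter c) _ Hx).
  have [e []] := filter_ex (filterI h (nbhs_right_gt (0 : R))).
  by exists e.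
(* A lower bound for [w] at the contact point, independent of [w]. *)
pose s y := psi y - psi x + perron x - e.
have cs : {for x, continuous s}.
  have cs : s @ x --> s x.
    apply: cvgB; last exact: cvg_cst.
    apply: cvgD; last exact: cvg_cst.
    by apply: cvgB; [exact: cpsi|exact: cvg_cst].
  exact: cs.
have sx : s x = perron x - e by rewrite /s subrr add0r.
have xO : \forall y \near x, 0 < H (covector A y (diffM A psi y), s y).
  have c := jet_continuous psiC cs; apply: (cvgr_gt _ c).
  by rewrite dpsi sx.
have cg : continuous (fun y => perron y - psi y).
  by move=> y; apply: cvgB; [exact: perron_continuous|exact: cpsi].
have psix : psi x = phi x by rewrite /psi taux addr0.
have gx y : y <> x -> perron y - psi y < perron x - psi x.
  by move=> /tau_lt; rewrite psix /psi; lra.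
have [d d0 hd] := strict_max_gap cptM cg gx xO.
(* Precision [d] forces the contact point into the neighbourhood where [H] is positive; precision
   [e] forces [w] above [s] there. *)
have m0 : 0 < Num.min d e by rewrite lt_min d0.
have [w Sw hw] := perron_approx x m0.
have hwd : perron x - d < w x by apply: le_lt_trans hw; rewrite lerD2l lerN2 ge_min lexx.
have hwe : perron x - e < w x by apply: le_lt_trans hw; rewrite lerD2l lerN2 ge_min lexx orbT.
have [cw _ sw] := Sw.
have [y ymax] : exists y, forall z, w z - psi z <= w y - psi y.
  by apply: compact_max => // z; apply: cvgB; [exact: cw|exact: cpsi].
have yO : 0 < H (covector A y (diffM A psi y), s y).
  by apply: hd; have := perron_ge y Sw; have := ymax x; lra.
have ymax' : \forall z \near y, w z - psi z <= w y - psi y by near=> z; exact: ymax.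
have := sw psi y psiC ymax'; apply/negP; rewrite -ltNge (lt_le_trans yO) // Hmono //.
by rewrite /s; have := ymax x; lra.
Unshelve. all: by end_near. Qed.

(** If the inequality failed at [x], the test function made strict and raised by [m] would be a
    strict subsolution near [x] and lie below [perron] elsewhere; the maximum of both would be a
    subsolution exceeding the supremum at [x]. *)
Lemma perron_supersolution : viscosity_supersolution H perron.
Proof.
move=> phi x hphi phix; rewrite leNgt; apply/negP => Hx.
have cphi := CkM_continuous hphi.
have cf : continuous (fun y => phi y - perron y).
  by move=> y; apply: cvgB; [exact: cphi|exact: perron_continuous].
have fx : \forall y \near x, phi y - perron y <= phi x - perron x.
  by apply: filterS phix => y; lra.
have [tau [tauC taux dtaux tau_lt]] := strict_local_max cf fx.
pose psi y := phi y + ((-1) * tau y + (perron x - phi x)).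
have tauC' : CkM A 1 (fun y => (-1) * tau y + (perron x - phi x)).
  by apply: CkM_add; [exact: CkM_scale|exact: CkM_cst].
have psiC : CkM A 1 psi by exact: CkM_add.
have cpsi := CkM_continuous psiC.
have dpsi : diffM A psi x = diffM A phi x.
  rewrite diffMD; [|exact: CkM_differentiableM|exact: CkM_differentiableM].
  rewrite diffMD; [|exact/CkM_differentiableM/CkM_scale|exact/CkM_differentiableM/CkM_cst].
  by rewrite diffMZ ?dtaux ?scaler0 ?diffM_cst ?addr0 //; exact: CkM_differentiableM.
have psix : psi x = perron x by rewrite /psi taux; lra.
have psi_lt y : y <> x -> psi y - perron y < psi x - perron x.
  by move=> /tau_lt; rewrite psix /psi; lra.
have [e e0 He] : exists2 e, 0 < e & H (covector A x (diffM A psi x), psi x + e) < 0.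
  have c : (fun e => H (covector A x (diffM A phi x), perron x + e)) @ (0 : R) -->
      H (covector A x (diffM A phi x), perron x).
    have c0 : perron x + e @[e --> (0 : R)] --> perron x.
      by rewrite -[X in _ --> X]addr0; apply: cvgD; [exact: cvg_cst|exact: cvg_id].
    exact: (cvg_comp _ _ c0 (@ham_continuous_value x _ (perron x))).
  have h : \forall e \near 0^'+, H (covector A x (diffM A phi x), perron x + e) < 0.
    exact: (cvgr_lt _ (cvg_at_right_filter c) _ Hx).
  have [e []] := filter_ex (filterI h (nbhs_right_gt (0 : R))).
  by exists e; rewrite // dpsi psix.
have cs a : continuous (fun y => psi y + a).
  by move=> y; apply: cvgD; [exact: cpsi|exact: cvg_cst].
have xO : \forall y \near x, H (covector A y (diffM A psi y), psi y + e) < 0.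
  by have c := jet_continuous psiC (cs e x); apply: (cvgr_lt _ c).
have cg : continuous (fun y => psi y - perron y).
  by move=> y; apply: cvgB; [exact: cpsi|exact: perron_continuous].
have [d d0 hd] := strict_max_gap cptM cg psi_lt xO.
pose m := Num.min d e.
have m0 : 0 < m by rewrite lt_min d0.
have md : m <= d by rewrite ge_min lexx.
have me : m <= e by rewrite ge_min lexx orbT.
pose w y := Num.max (perron y) (psi y + m).
have wu y : perron y <= w y by rewrite le_max lexx.
have wpsi y : psi y + m <= w y by rewrite le_max lexx orbT.
suff Sw : subsolutions w by have := perron_ge x Sw; have := wpsi x; rewrite psix; lra.
split.
- by move=> y; apply: continuous_max; [exact: perron_continuous|exact: cs].
- by move=> y; apply: le_trans (wu y); exact: (perron_ge y cst_subsolution).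
(* Where [perron] realizes the maximum, [chi] tests [perron]. Otherwise [psi + m] touches [chi] from
   below at [y], which gives the slope of [psi], and [y] lies where [psi] is strict. *)
move=> chi y chiC ymax; have [uy|uy] := leP (psi y + m) (perron y).
  have wy : w y = perron y by rewrite /w max_l.
  rewrite wy; apply: perron_subsolution => //; rewrite -wy.
  by apply: filterS ymax => z; apply: le_trans; rewrite lerD2r.
have wy : w y = psi y + m by rewrite /w max_r // ltW.
have dm : differentiableM A (fun y => psi y + m) y.
  exact: (CkM_differentiableM y (CkM_add psiC (CkM_cst 1 m))).
have <- : diffM A (fun y => psi y + m) y = diffM A chi y.
  apply: touching_diffM => //; first exact: CkM_differentiableM.
  rewrite -wy; apply: filterS ymax => z; apply: le_trans; rewrite lerD2r; exact: wpsi.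
rewrite diffMD; [|exact: CkM_differentiableM|exact/CkM_differentiableM/CkM_cst].
rewrite diffM_cst addr0 wy ltW //.
apply: le_lt_trans (_ : H (covector A y (diffM A psi y), psi y + e) < 0).
  by apply: Hmono; rewrite lerD2l.
by apply: hd; rewrite psix; lra.
Unshelve. all: by end_near. Qed.

(** Steep wells produce test functions touching [w] arbitrarily near [x]. Their slope is unknown,
    but by [Hray] slope zero only lowers [H]. This gives the upper bound u <= c_m. *)
Lemma subsolution_zero_slope w x : continuous w -> viscosity_subsolution H w ->
  H (covector A x 0, w x) <= 0.
Proof.
move=> cw sw; rewrite leNgt; apply/negP => Hx.
have xO : \forall y \near x, 0 < H (covector A y 0, w y).
  have c := jet_continuous (CkM_cst 1 (0 : R)) (cw x).
  have Hx' : 0 < H (covector A x (diffM A (fun=> 0) x), w x) by rewrite diffM_cst.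
  by apply: filterS (cvgr_gt _ c _ Hx') => y; rewrite diffM_cst.
have ix := dom_chart_at A x; set i := chart_at A x in ix.
have [r r0 hr] := chart_ball_near ix (@filterT _ (nbhs x) _).
have ball : chart_ball i (chart i x) r.
  by move=> y hy; have [] := hr (chart i x) _ y hy; rewrite ?sqdistxx ?sqr_ge0.
have wC := well_C1 hausM r0 ball.
have [e /andP[e0 e1] he] := well_nbhs r0 ix xO.
have [z zmax] := compact_max cptM cw.
have D0 : 0 <= w z - w x by rewrite subr_ge0.
pose L := (w z - w x) / e + 1.
have L0 : 0 < L by rewrite /L ltr_wpDl // divr_ge0 // ltW.
pose phi y := L * well i (chart i x) r y.
have phiC : CkM A 1 phi by exact: CkM_scale.
have cphi := CkM_continuous phiC.
have [y ymax] : exists y, forall z, w z - phi z <= w y - phi y.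
  by apply: compact_max => // t; apply: cvgB; [exact: cw|exact: cphi].
have ymax' : \forall z \near y, w z - phi z <= w y - phi y by near=> t; exact: ymax.
have yO : 0 < H (covector A y 0, w y).
  apply: he; rewrite ltNge; apply/negP => ye.
  have := ler_wpM2l (ltW L0) ye; rewrite {1}/L mulrDl divfK ?gt_eqF // => h.
  have := ymax x; rewrite /phi well_center // mulr0; have := zmax y; lra.
have := sw phi y phiC ymax'; apply/negP; rewrite -ltNge (lt_le_trans yO) //.
have := @Hray y (diffM A phi y) (w y) 0; rewrite scale0r; apply.
by rewrite lexx ler01.
Unshelve. all: by end_near. Qed.

Theorem perron_solution : exists u, [/\ viscosity_solution H u, forall x, u0 <= u x
  & forall x, H (covector A x 0, u x) <= 0].
Proof.
exists perron; split.
- by split; [exact: perron_continuous|exact: perron_subsolution|exact: perron_supersolution].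
- by move=> x; exact: (perron_ge x cst_subsolution).
- move=> x; apply: subsolution_zero_slope; first exact: perron_continuous.
  exact: perron_subsolution.
Qed.

End Perron.

(** * Even convex Hamiltonians *)

Section AffineReparametrization.
Variables (R : realType) (U V W : normedModType R) (f : V -> W) (a : U -> V) (v : U) (w : V).
Hypothesis aE : forall (h : R) q, a (h *: v + q) = h *: w + a q.

Lemma derive_affine q : 'D_v (f \o a) q = 'D_w f (a q).
Proof. by rewrite /derive /=; under eq_fun do rewrite aE. Qed.

Lemma is_derive_affine q : differentiable f (a q) -> is_derive q v (f \o a) ('D_w f (a q)).
Proof.
move=> df; split; last exact: derive_affine.
have := @diff_derivable _ _ _ _ _ w df; rewrite /derivable /=.
by under [X in _ -> cvg (X @ _)]eq_fun do rewrite /= aE.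
Qed.

End AffineReparametrization.

Lemma is_derive_nondecreasing (R : realType) (f df : R -> R) (a b : R) : a <= b ->
  (forall t, a <= t <= b -> is_derive t 1 f (df t)) ->
  (forall t, a <= t <= b -> 0 <= df t) -> f a <= f b.
Proof.
move=> ab hf df0; have [||c cab fE] := @MVT_segment R f df a b ab.
- by move=> x; rewrite in_itv /= => /andP[h1 h2]; apply: hf; rewrite !ltW.
- apply: derivable_within_continuous => x; rewrite in_itv /= => h.
  by have [] := hf x h.
by rewrite -subr_ge0 fE mulr_ge0 ?subr_ge0 //; apply: df0; move: cab; rewrite in_itv.
Qed.

Lemma even_derive (R : realType) (V W : normedModType R) (f : V -> W) v :
  differentiable f 0 -> (forall x, f (- x) = f x) -> 'D_v f 0 = 0.
Proof.
move=> df fN; have fE : f \o -%R = f by apply/funext => x; exact: fN.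
have aE (h : R) x : - (h *: v + x) = h *: (- v) + (- x) by rewrite scalerN opprD.
have := @derive_affine _ _ _ _ f -%R v (- v) aE 0.
rewrite fE oppr0 (@deriveE _ _ _ f 0 v df) (@deriveE _ _ _ f 0 (- v) df) linearN.
by move=> /eqP; rewrite -addr_eq0 -mulr2n -scaler_nat scaler_eq0 pnatr_eq0 => /eqP.
Qed.

Section Hamiltonian.
Variables (R : realType) (n : nat) (M : ptopologicalType) (A : atlas R n M).
Variable g : riemannian_metric A.
Variable H : cotangent A * R -> R.
Hypotheses (H_C3 : CkH 3 H) (H_convex : ham_convex H) (H_superlinear : ham_superlinear g H).
Hypothesis H_even : ham_even H.

Let V := ('rV[R]_n * R * 'rV[R]_n)%type.
Let L i (z : V) : R^o := local_ham H i z.1.1 z.1.2 z.2.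

Lemma ham_local x q s :
  H (covector A x q, s) = L (chart_at A x) (chart (chart_at A x) x, s, q).
Proof. by rewrite /L /local_ham /= cov_of_coord_chart_at. Qed.

Lemma local_ham_differentiable i (z : V) : codom i z.1.1 -> differentiable (L i) z.
Proof. by move=> iz; have [h _] := H_C3 i; exact: h. Qed.

Lemma local_ham_derive_differentiable i (z v : V) : codom i z.1.1 ->
  differentiable ('D_v (L i)) z.
Proof. by move=> iz; have [_ /(_ v)[h _]] := H_C3 i; exact: h. Qed.

Lemma derive_ham_fiber x s (v : 'rV[R]_n) :
  'D_v (fun q => H (covector A x q, s) : R^o) =
  'D_((0, 0, v) : V) (L (chart_at A x)) \o (fun q => (chart (chart_at A x) x, s, q) : V).
Proof.
have -> : (fun q => H (covector A x q, s)) = L (chart_at A x) \o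
    (fun q => (chart (chart_at A x) x, s, q) : V).
  by apply/funext => q; exact: ham_local.
apply/funext => q; apply: (@derive_affine _ _ _ _ (L _) (fun q => (_, _, q))) => h q'.
by congr (_, _, _); rewrite /= ?scaler0 ?mulr0 add0r.
Qed.

Let slice_differentiable x s (q : 'rV[R]_n) :
  differentiable (fun q => (chart (chart_at A x) x, s, q) : V) q.
Proof.
by apply: differentiable_pair => //; apply: differentiable_pair; exact: differentiable_cst.
Qed.

Lemma ham_fiber_differentiable x s q :
  differentiable (fun q => H (covector A x q, s) : R^o) q.
Proof.
under eq_fun do rewrite ham_local.
apply: (@differentiable_comp _ _ _ _ (fun q => (_, _, q) : V) (L _)).
  exact: slice_differentiable.
by apply: local_ham_differentiable; exact/codom_chart/dom_chart_at.
Qed.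

Lemma ham_fiber_derive_differentiable x s q (v : 'rV[R]_n) :
  differentiable ('D_v (fun q => H (covector A x q, s) : R^o)) q.
Proof.
rewrite derive_ham_fiber; apply: differentiable_comp; first exact: slice_differentiable.
by apply: local_ham_derive_differentiable; exact/codom_chart/dom_chart_at.
Qed.

Lemma is_derive_ham_value xi s :
  is_derive (s : R^o) 1 (fun s => H (xi, s) : R^o) ((fun s => H (xi, s))^`()%classic s).
Proof.
case: xi => x q; rewrite derive1E.
have aE (h s' : R) : (chart (chart_at A x) x, h *: (1 : R^o) + s', q) =
    h *: ((0, 1, 0) : V) + (chart (chart_at A x) x, s', q).
  by congr (_, _, _); rewrite /= ?scaler0 add0r.
have E : (fun s => H ((x, q), s)) = L (chart_at A x) \o
    (fun s => (chart (chart_at A x) x, s, q) : V).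
  by apply/funext => s'; exact: ham_local.
rewrite E (@derive_affine _ _ _ _ (L _) (fun s => (_, s, q)) _ _ aE).
apply: (@is_derive_affine _ _ _ _ (L _) (fun s => (_, s, q)) _ _ aE).
by apply: local_ham_differentiable; exact/codom_chart/dom_chart_at.
Qed.

Lemma ham_value_increasing delta : (forall xi s, delta < (fun s => H (xi, s))^`()%classic s) ->
  forall xi s t, s <= t -> delta * (t - s) <= H (xi, t) - H (xi, s).
Proof.
move=> hd xi s t st.
suff : H (xi, s) - delta * s <= H (xi, t) - delta * t by rewrite mulrBr; lra.
apply: (@is_derive_nondecreasing _ (fun s => H (xi, s) - delta * s)
  (fun s => (fun s => H (xi, s))^`()%classic s - delta) _ _ st) => r _; last first.
  by rewrite subr_ge0 ltW.
have h := is_derive_ham_value xi r.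
have h' : is_derive r 1 (fun s => delta * s) delta.
  by apply: is_derive_eq; rewrite [_ *: 1]mulr1.
exact: is_deriveB.
Qed.

Lemma ham_even_derive x s (v : 'rV[R]_n) :
  'D_v (fun q => H (covector A x q, s) : R^o) 0 = 0.
Proof.
apply: even_derive; first exact: ham_fiber_differentiable.
by move=> q; rewrite -H_even.
Qed.

(** Along a ray the derivative vanishes at the origin by evenness and is nondecreasing by
    convexity. *)
Lemma ham_ray_nondecreasing x p s t : 0 <= t <= 1 ->
  H (covector A x (t *: p), s) <= H (covector A x p, s).
Proof.
move=> /andP[t0 t1].
have [->|p0] := eqVneq p 0; first by rewrite scaler0.
pose G q : R^o := H (covector A x q, s).
have aE (h r : R) : (h *: (1 : R^o) + r) *: p = h *: p + r *: p.
  by rewrite scalerDl -scalerA scale1r.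
have d1 (r : R) : is_derive (r : R^o) 1 (G \o (fun r : R^o => (r *: p : 'rV[R]_n))) ('D_p G (r *: p)).
  apply: (@is_derive_affine _ _ _ _ G (fun r : R^o => (r *: p : 'rV[R]_n)) _ _ aE).
  exact: ham_fiber_differentiable.
have d2 (r : R) : is_derive (r : R^o) 1 ('D_p G \o (fun r : R^o => (r *: p : 'rV[R]_n))) ('D_p ('D_p G) (r *: p)).
  apply: (@is_derive_affine _ _ _ _ ('D_p G) (fun r : R^o => (r *: p : 'rV[R]_n)) _ _ aE).
  exact: ham_fiber_derive_differentiable.
have D0 (r : R) : 0 <= r -> 0 <= 'D_p G (r *: p).
  move=> r0; have := @is_derive_nondecreasing _ _ _ 0 r r0 (fun r _ => d2 r).
  by rewrite /= scale0r ham_even_derive; apply => u _; exact/ltW/H_convex.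
have := @is_derive_nondecreasing _ _ _ t 1 t1 (fun r _ => d1 r).
by rewrite /= scale1r; apply => u /andP[ut _]; apply: D0; exact: le_trans ut.
Qed.

Lemma dHdp0 x s : dHdp H x s 0 = 0.
Proof. by apply/rowP => j; rewrite !mxE ham_even_derive. Qed.

Lemma gram_unit x : gram g x \in unitmx.
Proof.
rewrite -row_free_unit -kermx_eq0; apply/eqP/row_matrixP => i; apply/eqP.
rewrite row0; apply: contraT => /(@gram_posdef _ _ _ _ g x).
by rewrite -row_mul mulmx_ker row0 /dotr mul0mx mxE ltxx.
Qed.

Lemma cotangent_norm_gt0 x p : p != 0 -> 0 < cotangent_norm g x p.
Proof.
move=> p0; rewrite sqrtr_gt0; pose v := p *m invmx (gram g x).
have pE : p = v *m gram g x by rewrite mulmxKV // gram_unit.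
have v0 : v != 0 by apply: contraNneq p0 => v0; rewrite pE v0 mul0mx.
rewrite -/v {1}pE; have := @gram_posdef _ _ _ _ g x v v0.
by rewrite /dotr (trmx_mul v) mulmxA gram_sym.
Qed.

Lemma cotangent_normZ x t p : 0 <= t ->
  cotangent_norm g x (t *: p) = t * cotangent_norm g x p.
Proof.
move=> t0; rewrite /cotangent_norm /dotr -scalemxAl linearZ /= -scalemxAr -scalemxAl !mxE.
by rewrite mulrA -expr2 sqrtrM ?sqr_ge0 // sqrtr_sqr ger0_norm.
Qed.

Lemma ham_coercive x p s a : p != 0 ->
  exists2 t, 0 <= t & a < H (covector A x (t *: p), s).
Proof.
move=> p0; have [r hr] := H_superlinear x s 1.
have c0 := cotangent_norm_gt0 x p0; set c := cotangent_norm g x p in c0.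
pose t := (Num.max (Num.max r a) 0 + 1) / c.
have t0 : 0 <= t by rewrite divr_ge0 ?ltW // ltr_wpDl // le_max lexx orbT.
have tE : cotangent_norm g x (t *: p) = Num.max (Num.max r a) 0 + 1.
  by rewrite cotangent_normZ // -/c divfK // gt_eqF.
have tm : Num.max r a < cotangent_norm g x (t *: p).
  by rewrite tE ltr_pwDr // le_max lexx.
exists t => //; apply: lt_le_trans (hr _ _); rewrite ?mul1r.
  by apply: le_lt_trans tm; rewrite le_max lexx orbT.
by apply: le_lt_trans tm; rewrite le_max lexx.
Qed.

Lemma ham_continuous i (z : V) : codom i z.1.1 ->
  {for z, continuous (fun z : V => local_ham H i z.1.1 z.1.2 z.2)}.
Proof. by move=> iz; exact: (differentiable_continuous (local_ham_differentiable iz)). Qed.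

Lemma ham_minus_continuous (f : M -> R) i (z : V) : continuous f -> codom i z.1.1 ->
  {for z, continuous (fun z : V =>
     local_ham (fun w => H w - f (base w.1)) i z.1.1 z.1.2 z.2)}.
Proof.
move=> cf iz; have cz1 : z'.1.1 @[z' --> z] --> z.1.1.
  exact: (@cvg_comp _ _ _ fst fst _ _ _ cvg_fst cvg_fst).
have ci : ichart i @ z.1.1 --> ichart i z.1.1.
  by have := ichart_cvg (dom_ichart iz); rewrite ichartK.
have cL : (fun z : V => local_ham H i z.1.1 z.1.2 z.2) @ z -->
  local_ham H i z.1.1 z.1.2 z.2 by exact: ham_continuous.
exact: (cvgB cL (cvg_comp _ _ (cvg_comp _ _ cz1 ci) (cf _))).
Qed.

Section Monotone.
Variable delta : R.
Hypotheses (delta0 : 0 < delta)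
  (H_delta : forall xi s, delta < (fun s => H (xi, s))^`()%classic s).

Lemma ham_value_le xi s t : s <= t -> H (xi, s) <= H (xi, t).
Proof.
move=> st; have := ham_value_increasing H_delta xi st.
by rewrite -(subr_ge0 (H _)); apply: le_trans; rewrite mulr_ge0 ?subr_ge0 // ltW.
Qed.

Lemma ham_value_dist xi s t : delta * `|t - s| <= `|H (xi, t) - H (xi, s)|.
Proof.
wlog st : s t / s <= t.
  move=> h; have [st|/ltW ts] := leP s t; first exact: h.
  by rewrite distrC (distrC (H _)); exact: h.
rewrite ger0_norm ?subr_ge0 //; apply: le_trans (ler_norm _).
exact: ham_value_increasing.
Qed.

Lemma ham_value_continuous xi : continuous (fun s => H (xi, s)).
Proof.
move=> s; have [h _] := is_derive_ham_value xi s.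
by apply: differentiable_continuous; exact/derivable1_diffP.
Qed.

Lemma ham_value_surjective xi a : exists s, H (xi, s) = a.
Proof.
(* As the slope in the value is at least [delta], the level [a] is crossed within distance [b] of
   0. *)
pose b := `|a - H (xi, 0)| / delta.
have b0 : 0 <= b by rewrite divr_ge0 // ltW.
have bE : delta * b = `|a - H (xi, 0)| by rewrite /b mulrC divfK // gt_eqF.
have h1 := ham_value_increasing H_delta xi b0.
have bN : - b <= 0 by rewrite oppr_le0.
have h2 := ham_value_increasing H_delta xi bN.
have [ | | |s _ sE] := @IVT R (fun s => H (xi, s)) (- b) b a.
- by rewrite (le_trans bN).
- exact/continuous_subspaceT/ham_value_continuous.
- have := ler_norm (a - H (xi, 0)); have := ler_norm (- (a - H (xi, 0))); rewrite normrN.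
  move: h1 h2; rewrite subr0 sub0r opprK !bE => h1 h2 h3 h4.
  by rewrite ge_min le_max; apply/andP; split; apply/orP; [left|right]; lra.
by exists s.
Qed.

(** At the values [c x + e] and [c x - e] the equation fails strictly, with opposite signs. Both
    signs persist near [x], and monotonicity traps [c y] in between. *)
Lemma zero_slope_value_continuous (f c : M -> R) : continuous f ->
  (forall x, H (covector A x 0, c x) = f x) -> continuous c.
Proof.
move=> cf cE x; apply/cvgrPdist_lt => e e0.
have near_value s : H (covector A y 0, s) - f y @[y --> x] --> H (covector A x 0, s) - f x.
  apply: cvgB; last exact: cf.
  have := @jet_continuous _ _ _ _ _ ham_continuous (fun=> 0) (fun=> s) x (CkM_cst _ _)
    (@cst_continuous _ _ s x).
  by rewrite /prop_for /continuous_at; under eq_fun do rewrite diffM_cst; rewrite diffM_cst.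
have de : 0 < delta * e by rewrite mulr_gt0.
have h1 : 0 < H (covector A x 0, c x + e) - f x.
  rewrite -cE; have /(ham_value_increasing H_delta (covector A x 0)) : c x <= c x + e by lra.
  by rewrite addrAC subrr add0r; exact: lt_le_trans.
have h2 : H (covector A x 0, c x - e) - f x < 0.
  rewrite -cE; have /(ham_value_increasing H_delta (covector A x 0)) : c x - e <= c x by lra.
  by rewrite opprB addrCA subrr addr0; lra.
have n1 : \forall y \near x, 0 < H (covector A y 0, c x + e) - f y.
  exact: cvgr_gt (near_value (c x + e)) _ h1.
have n2 : \forall y \near x, H (covector A y 0, c x - e) - f y < 0.
  exact: cvgr_lt (near_value (c x - e)) _ h2.
near=> y; rewrite distrC ltr_distl.
have : 0 < H (covector A y 0, c x + e) - f y by near: y.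
have : H (covector A y 0, c x - e) - f y < 0 by near: y.
rewrite -cE subr_lt0 subr_gt0 => k2 k1; apply/andP; split; rewrite ltNge; apply/negP.
  by move=> /(ham_value_le (covector A y 0)); rewrite leNgt k2.
by move=> /(ham_value_le (covector A y 0)); rewrite leNgt k1.
Unshelve. all: by end_near. Qed.

End Monotone.

End Hamiltonian.

(** * The contact flow at a stationary point *)

Lemma differentiable_zero_bound (R : realType) (V W : normedModType R) (f : V -> W) a :
  differentiable f a -> f a = 0 ->
  exists2 C, 0 <= C & \forall z \near a, `|f z| <= C * `|z - a|.
Proof.
move=> /diff_locallyP[/linear_lipschitz[k k0 hk] /eqaddoP df] fa.
exists (k + 1); first lra.
have /nbhs_ballP[d /= d0 hd] := df 1 ltr01.
apply/nbhs_ballP; exists d => //= z; rewrite -ball_normE /= distrC => za.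
have := hd (z - a); rewrite -ball_normE /= sub0r normrN => /(_ za).
rewrite /= !fctE /= subrK fa add0r mul1r => h.
rewrite -(subrK ('d f a (z - a)) (f z)); apply: le_trans (ler_normD _ _) _.
by rewrite mulrDl mul1r addrC; apply: lerD.
Qed.

Section Gronwall.
Variable R : realType.

Lemma mean_value_bound (f df : R -> R) (a b B : R) :
  (forall s, `|s - a| <= `|b - a| -> is_derive s 1 f (df s) /\ `|df s| <= B) ->
  `|f b - f a| <= B * `|b - a|.
Proof.
move=> h.
have mvt x y : x <= y -> (forall s, x <= s <= y -> `|s - a| <= `|b - a|) ->
    `|f y - f x| <= B * `|y - x|.
  move=> xy hs; have [r|r|c cxy ->] := @MVT_segment R f df x y xy.
  - rewrite in_itv /= => /andP[h1 h2].
    by have [] := h r (hs r _); rewrite ?(ltW h1) ?(ltW h2).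
  - apply: derivable_within_continuous => s; rewrite in_itv /= => /hs hsa.
    by have [[]] := h s hsa.
  rewrite normrM ler_wpM2r //; move: cxy; rewrite in_itv /= => /hs hc.
  by have [] := h c hc.
have [ab|ba] := leP a b.
  apply: mvt => // s /andP[h1 h2].
  by rewrite !ger0_norm ?subr_ge0 // lerD2r.
rewrite distrC (distrC b a); apply: mvt; first exact: ltW.
move=> s /andP[h1 h2]; rewrite !ler0_norm ?subr_le0 ?(ltW ba) //.
by rewrite lerN2 lerD2r.
Qed.

(** A short-time form of Gronwall's lemma: at the maximum point [c] of [S], the mean value
    inequality gives [S c <= #|T|%:R * (C * eta) * S c], so [S c] vanishes. *)
Lemma gronwall_zero (T : finType) (f df : T -> R -> R) (s0 eta C : R) : 0 < eta -> 0 <= C ->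
  #|T|%:R * (C * eta) < 1 ->
  (forall k s, `|s - s0| <= eta -> is_derive (s : R) 1 (f k) (df k s)) ->
  (forall k, f k s0 = 0) ->
  (forall k s, `|s - s0| <= eta -> `|df k s| <= C * \sum_j `|f j s|) ->
  forall k s, `|s - s0| <= eta -> f k s = 0.
Proof.
move=> eta0 C0 small fd f0 dfb.
pose S s := \sum_j `|f j s|.
have itvE s : (s \in `[s0 - eta, s0 + eta]) = (`|s - s0| <= eta).
  by rewrite in_itv /= ler_distl.
have cS : {within `[s0 - eta, s0 + eta], continuous S}.
  apply: continuous_in_subspaceT => s; rewrite inE /= itvE => hs.
  apply: (@cvg_big _ _ +%R 0 xpredT add_continuous) => j _.
  have [dfj _] := fd j s hs.
  have cf : f j @ s --> f j s by apply: differentiable_continuous; exact/derivable1_diffP.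
  exact: (cvg_norm cf).
have [|c cI cmax] := @EVT_max R S (s0 - eta) (s0 + eta) _ cS; first lra.
have fb k s : `|s - s0| <= eta -> `|f k s| <= C * S c * eta.
  move=> hs; rewrite -[f k s]subr0 -(f0 k).
  apply: le_trans (@mean_value_bound (f k) (df k) s0 s (C * S c) _) _.
    move=> r hr; have {}hr := le_trans hr hs; split; first exact: fd.
    by apply: le_trans (dfb k r hr) _; rewrite ler_wpM2l // cmax // itvE.
  by rewrite ler_wpM2l // mulr_ge0 // sumr_ge0.
have Sc0 : S c <= 0.
  have : S c <= \sum_(j : T) C * S c * eta.
    by apply: ler_sum => j _; apply: fb; rewrite -itvE.
  rewrite sumr_const -mulr_natl mulrAC mulrA => h; rewrite leNgt; apply/negP => Sp.
  by move: small; rewrite -(ltr_pM2r Sp) mul1r => /(le_lt_trans h); rewrite ltxx.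
move=> k s hs; apply/eqP; rewrite -normr_le0; apply: le_trans (fb k s hs) _.
by rewrite mulrAC mulr_ge0_le0 ?mulr_ge0 // ltW.
Qed.

End Gronwall.

Lemma is_derive_coord (R : realType) (V : normedModType R) m n (f : V -> 'M[R]_(m, n))
    t v D i j : is_derive t v f D -> is_derive t v (fun s => f s i j : R^o) (D i j).
Proof.
move=> [df <-]; split; first exact: (iffLR (derivable_mxP f t v) df).
by rewrite derive_mx // mxE.
Qed.

Section CotangentTopology.
Variables (R : realType) (n : nat) (M : ptopologicalType) (A : atlas R n M).

Lemma base_continuous : continuous (base : cotangent A -> M).
Proof.
apply/continuousP => U oU; change (cotangent_open (base @^-1` U : set (cotangent A))) => i.
have -> : [set yq : 'rV[R]_n * 'rV[R]_n | codom i yq.1 /\ (base @^-1` U) (cov_of_coord i yq.1 yq.2)]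
  = fst @^-1` (codom i `&` (ichart i @^-1` U)) by [].
apply: open_comp => [yq _|]; first exact: cvg_fst.
rewrite openE => _ [[x ix <-] /=]; rewrite chartK // => Ux; rewrite /interior.
apply: filterI; first exact: near_codom.
by have := ichart_cvg ix (open_nbhs_nbhs (conj oU Ux)).
Qed.

Lemma closed_zero_section : closed [set xi : cotangent A | fiber xi = 0].
Proof.
rewrite -openC; change (cotangent_open (~` [set xi : cotangent A | fiber xi = 0])) => i.
have -> : [set yq : 'rV[R]_n * 'rV[R]_n | codom i yq.1 /\
    (~` [set xi | fiber xi = 0]) (cov_of_coord i yq.1 yq.2)] =
  (fst @^-1` codom i) `&` (snd @^-1` ~` [set 0]).
  apply/seteqP; split => -[y q] /= [iy h]; split => // q0; apply: h; rewrite /fiber /=.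
    by rewrite q0 mul0mx.
  have q0' : fiber (cov_of_coord i y q) = 0 by exact: q0.
  by have := cov_of_coordK q iy; rewrite /cov_coord q0' mul0mx => <-.
apply: openI.
  by apply: open_comp => [yq _|]; [exact: cvg_fst|exact: open_codom].
apply: open_comp => [yq _|]; first exact: cvg_snd.
by rewrite openC; exact/accessible_closed_set1/hausdorff_accessible/norm_hausdorff.
Qed.

End CotangentTopology.

Section Stationary.
Variables (R : realType) (n : nat) (M : ptopologicalType) (A : atlas R n M).
Hypothesis hausM : hausdorff_space M.
Variable H : cotangent A * R -> R.
Let V := ('rV[R]_n * R * 'rV[R]_n)%type.
Let L i (z : V) : R^o := local_ham H i z.1.1 z.1.2 z.2.
Hypothesis H_C2 : forall i, Ck 2 [set z : V | codom i z.1.1] (L i).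
Variables (x : M) (u0 : R).
Hypothesis stationary_p : forall i, dom i x -> grad (local_ham H i (chart i x) u0) 0 = 0.
Hypothesis stationary_x : forall i, dom i x ->
  grad (fun y => local_ham H i y u0 0) (chart i x) = 0.
Hypothesis H0 : H (covector A x 0, u0) = 0.

Lemma cov_coord_zero i y : cov_coord i (covector A y 0) = 0.
Proof. by rewrite /cov_coord mul0mx. Qed.

Lemma cov_of_coord_zero i : dom i x -> cov_of_coord i (chart i x) 0 = covector A x 0.
Proof.
move=> ix; have := @cov_coordK _ _ _ _ i (covector A x 0) ix.
by rewrite cov_coord_zero.
Qed.

Lemma cst_contact_ode t : contact_ode H (fun=> (covector A x 0, u0)) t.
Proof.
move=> i ix; have ix' : dom i x := ix; have q0 := cov_coord_zero i x.
move=> Li y q u Lp Lx Lu.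
have qE : q t = 0 by exact: q0.
have LpE : Lp = 0 by rewrite /Lp qE; exact: stationary_p.
have LxE : Lx = 0 by rewrite /Lx qE; exact: stationary_x.
have LE : Li (y t) (u t) (q t) = 0.
  by rewrite qE /Li /local_ham [cov_of_coord _ _ _](cov_of_coord_zero ix').
rewrite LpE LxE LE qE scaler0 !subr0 oppr0 /dotr mul0mx mxE.
by split; exact: is_derive_cst.
Qed.

Lemma stationary_flow t : contact_flow H t (covector A x 0, u0) (covector A x 0, u0).
Proof.
exists (fun=> (covector A x 0, u0)); split => //; exists 1 => // s _; split.
  exact: cst_continuous.
exact: cst_contact_ode.
Qed.

(** Position, momentum and value as one finite family of scalars, the form required by
    [gronwall_zero]. *)
Let coordinate := option ('I_n + 'I_n)%type.

Let deviation (i : index A) (z : V) (k : coordinate) : R := match k with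
  | Some (inl j) => z.1.1 0 j - chart i x 0 j
  | Some (inr j) => z.2 0 j
  | None => z.1.2 - u0
  end.

(** The contact vector field, with each partial derivative written as a directional derivative of
    the joint function [L i], so that it is visibly differentiable in all variables together. *)
Let field (i : index A) (z : V) (k : coordinate) : R := match k with
  | Some (inl j) => 'D_((0, 0, delta_mx 0 j) : V) (L i) z
  | Some (inr j) => - 'D_((delta_mx 0 j, 0, 0) : V) (L i) z
                    - 'D_((0, 1, 0) : V) (L i) z * z.2 0 j
  | None => \sum_j 'D_((0, 0, delta_mx 0 j) : V) (L i) z * z.2 0 j - L i z
  end.

Let dL_differentiable i (z v : V) : codom i z.1.1 -> differentiable ('D_v (L i)) z.
Proof. by move=> iz; have [_ /(_ v)[h _]] := H_C2 i; exact: h. Qed.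

Let L_differentiable i (z : V) : codom i z.1.1 -> differentiable (L i) z.
Proof. by move=> iz; have [h _] := H_C2 i; exact: h. Qed.

Let derive_p i (y : 'rV[R]_n) u (q : 'rV[R]_n) j :
  grad (local_ham H i y u) q 0 j = 'D_((0, 0, delta_mx 0 j) : V) (L i) (y, u, q).
Proof.
rewrite mxE; apply: (@derive_affine _ _ _ _ (L i) (fun q => (y, u, q))) => h q'.
by congr (_, _, _); rewrite /= ?scaler0 ?mulr0 add0r.
Qed.

Let derive_x i (y : 'rV[R]_n) u (q : 'rV[R]_n) j :
  grad (fun y => local_ham H i y u q) y 0 j = 'D_((delta_mx 0 j, 0, 0) : V) (L i) (y, u, q).
Proof.
rewrite mxE; apply: (@derive_affine _ _ _ _ (L i) (fun y => (y, u, q))) => h q'.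
by congr (_, _, _); rewrite /= ?scaler0 ?mulr0 add0r.
Qed.

Let derive_u i (y : 'rV[R]_n) u (q : 'rV[R]_n) :
  (fun s => local_ham H i y s q)^`()%classic u = 'D_((0, 1, 0) : V) (L i) (y, u, q).
Proof.
rewrite derive1E; apply: (@derive_affine _ _ _ _ (L i) (fun s => (y, s, q))) => h q'.
by congr (_, _, _); rewrite /= ?scaler0 ?mulr0 add0r.
Qed.

Let coord_differentiable (z : V) j : differentiable (fun z : V => z.2 0 j : R^o) z.
Proof.
have h : differentiable (snd : V -> 'rV[R]_n) z.
  by apply: linear_differentiable => x'; exact: cvg_snd.
exact: (iffLR (differentiable_mx _ _) h).
Qed.

Let field_differentiable i (z : V) k : codom i z.1.1 ->
  differentiable (fun z => field i z k : R^o) z.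
Proof.
move=> iz; case: k => [[j|j]|] /=; first exact: dL_differentiable.
  apply: (@differentiableB _ _ _ (fun z => - 'D_((delta_mx 0 j, 0, 0) : V) (L i) z)).
    by apply: (@differentiableN _ _ _ ('D_((delta_mx 0 j, 0, 0) : V) (L i))); exact: dL_differentiable.
  apply: (@derive.differentiableM _ _ ('D_((0, 1, 0) : V) (L i)) (fun z => z.2 0 j)).
    exact: dL_differentiable.
  exact: coord_differentiable.
apply: (@differentiableB _ _ _ _ (L i)); last exact: L_differentiable.
pose term j (z : V) : R^o := 'D_((0, 0, delta_mx 0 j) : V) (L i) z * z.2 0 j.
have -> : (fun z => \sum_j term j z) = \sum_j term j by apply/funext => z'; rewrite fct_sumE.
apply: differentiable_sum => j.
apply: (@derive.differentiableM _ _ ('D_((0, 0, delta_mx 0 j) : V) (L i)) (fun z => z.2 0 j)).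
  exact: dL_differentiable.
exact: coord_differentiable.
Qed.

Let field_zero i k : dom i x -> field i (chart i x, u0, 0) k = 0.
Proof.
move=> ix; case: k => [[j|j]|] /=.
- by rewrite -derive_p stationary_p // mxE.
- by rewrite -derive_x stationary_x // !mxE mulr0 subr0 oppr0.
- rewrite big1 => [|j _]; last by rewrite mxE mulr0.
  by rewrite /L /local_ham /= cov_of_coord_zero // H0 subr0.
Qed.

Let deviation_norm i (z : V) :
  `|z - ((chart i x, u0, 0) : V)| <= \sum_k `|deviation i z k|.
Proof.
have le1 k : `|deviation i z k| <= \sum_k `|deviation i z k|.
  by rewrite (bigD1 k) //= lerDl sumr_ge0.
have S0 : 0 <= \sum_k `|deviation i z k| by apply: sumr_ge0.
rewrite !prod_normE /= !ge_max; apply/andP; split; [apply/andP; split|].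
- rewrite /Num.Def.normr /= mx_normrE; apply: bigmax_le => // -[j k] _ /=.
  by rewrite ord1 !mxE; exact: (le1 (Some (inl k))).
- exact: (le1 None).
- rewrite subr0 /Num.Def.normr /= mx_normrE; apply: bigmax_le => // -[j k] _ /=.
  by rewrite ord1; exact: (le1 (Some (inr k))).
Qed.

(** The field is differentiable and vanishes at the rest point, so it grows at most linearly in the
    deviation. *)
Let field_bound i : dom i x -> exists2 C, 0 <= C &
  \forall z \near ((chart i x, u0, 0) : V), forall k,
    `|field i z k| <= C * \sum_k `|deviation i z k|.
Proof.
move=> ix; have h k : exists C, 0 <= C /\ \forall z \near ((chart i x, u0, 0) : V),
    `|field i z k| <= C * `|z - ((chart i x, u0, 0) : V)|.
  have df := @field_differentiable i (chart i x, u0, 0) k (codom_chart ix).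
  by have [C C0 hC] := differentiable_zero_bound df (field_zero k ix); exists C.
have {h} /choice[C hC] := h; exists (\sum_k C k); first by apply: sumr_ge0 => k _; case: (hC k).
have : \forall z \near ((chart i x, u0, 0) : V), forall k,
    `|field i z k| <= C k * `|z - ((chart i x, u0, 0) : V)|.
  apply: (@filter_forall _ coordinate (fun k z => `|field i z k| <= C k *
    `|z - ((chart i x, u0, 0) : V)|) (nbhs ((chart i x, u0, 0) : V))) => k.
  by case: (hC k).
apply: filterS => z hz k; apply: le_trans (hz k) _.
apply: ler_pM; rewrite ?normr_ge0 //; first by case: (hC k).
rewrite (bigD1 k) //= lerDl; apply: sumr_ge0 => j _; by case: (hC j).
Qed.

Section Curve.
Variables (c : R -> cotangent A * R) (a b : R).
Hypothesis c_ode : forall s, a < s < b -> {for s, continuous c} /\ contact_ode H c s.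

Let coords i (s : R) : V := (chart i (base (c s).1), (c s).2, cov_coord i (c s).1).

Let near_itvoo s : a < s < b -> \forall r \near s, a < r < b.
Proof.
move=> sab; have : s \in `]a, b[ by rewrite in_itv.
by move=> /near_in_itvoo; apply: filterS => r; rewrite in_itv.
Qed.

Let is_derive_deviation i s k : a < s < b -> dom i (base (c s).1) ->
  is_derive s 1 (fun s => deviation i (coords i s) k) (field i (coords i s) k).
Proof.
move=> sab si; have [_ /(_ i si)[dy dq du]] := c_ode sab.
have entry (p q : 'rV[R]_n) l j : (- p - l *: q) 0 j = - p 0 j - l * q 0 j by rewrite !mxE.
have dotrE (p q : 'rV[R]_n) : dotr p q = \sum_j p 0 j * q 0 j.
  by rewrite /dotr mxE; apply: eq_bigr => j _; rewrite mxE.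
case: k => [[j|j]|] /=.
- have h := is_derive_coord 0 j dy; rewrite derive_p in h.
  have := @is_deriveB _ _ _ _ (cst (chart i x 0 j)) _ _ _ _ h (is_derive_cst _ _ _).
  by rewrite subr0.
- by have h := is_derive_coord 0 j dq; rewrite entry derive_x derive_u in h.
- have := @is_deriveB _ _ _ _ (cst u0) _ _ _ _ du (is_derive_cst _ _ _).
  rewrite subr0 dotrE (eq_bigr (fun j =>
    'D_((0, 0, delta_mx 0 j) : V) (L i) (coords i s) * cov_coord i (c s).1 0 j)) // => j _.
  by rewrite derive_p.
Qed.

Let coords_continuous i s : a < s < b -> dom i (base (c s).1) -> coords i @ s --> coords i s.
Proof.
move=> sab si; have [_ /(_ i si)[[dy _] [dq _] [du _]]] := c_ode sab.
have cont (W : normedModType R) (f : R -> W) : derivable f s 1 -> f @ s --> f s.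
  by move=> df; apply: differentiable_continuous; exact/derivable1_diffP.
exact: (cvg_to_pair _ (cvg_to_pair _ (cont _ _ dy) (cont _ _ du)) (cont _ _ dq)).
Qed.

Let base_curve_continuous s : a < s < b -> (fun s => base (c s).1) @ s --> base (c s).1.
Proof.
move=> /c_ode[cs _]; have cs' : c @ s --> c s by exact: cs.
exact: (cvg_comp _ _ (cvg_comp _ _ cs' cvg_fst) (@base_continuous _ _ _ A (c s).1)).
Qed.

Let coords_eq i s : dom i (base (c s).1) -> dom i x -> coords i s = (chart i x, u0, 0) ->
  c s = (covector A x 0, u0).
Proof.
rewrite /coords; case: (c s) => xi u /= ixi ix [h1 -> h2]; congr (_, _).
by rewrite -(cov_coordK ixi) h1 h2 cov_of_coord_zero.
Qed.

Lemma near_stationary s0 : a < s0 < b -> c s0 = (covector A x 0, u0) ->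
  \forall s \near s0, c s = (covector A x 0, u0).
Proof.
move=> s0ab cs0; pose i := chart_at A x; have ix := dom_chart_at A x.
have [C C0 hC] := field_bound ix; rewrite -/i in ix hC.
have is0 : dom i (base (c s0).1) by rewrite cs0.
have coords0 : coords i s0 = (chart i x, u0, 0) by rewrite /coords cs0 /= cov_coord_zero.
have n1 : \forall s \near s0, a < s < b.
  exact: near_itvoo.
have n2 : \forall s \near s0, dom i (base (c s).1).
  exact: (base_curve_continuous s0ab (near_dom is0)).
have n3 : \forall s \near s0, forall k,
    `|field i (coords i s) k| <= C * \sum_k `|deviation i (coords i s) k|.
  by have := coords_continuous s0ab is0; rewrite coords0 => /(_ _ hC).
have : nbhs s0 ([set s | a < s < b] `&` ([set s | dom i (base (c s).1)] `&`
    [set s | forall k, `|field i (coords i s) k| <= C * \sum_k `|deviation i (coords i s) k|])).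
  by apply: filterI => //; exact: filterI.
move=> /nbhs_ballP[d /= d0 hd].
pose N : R := #|{: coordinate}|%:R.
have NC : 0 <= N * C by rewrite mulr_ge0.
(* The first bound keeps the curve in the chart and in the range of the linear bound; the second
   makes [N * C * eta < 1]. *)
pose eta := Num.min (d / 2) (1 / (2 * (N * C + 1))).
have eta0 : 0 < eta by rewrite lt_min !divr_gt0 // mulr_gt0 // ltr_wpDl.
have hs s : `|s - s0| <= eta -> [/\ a < s < b, dom i (base (c s).1) & forall k,
    `|field i (coords i s) k| <= C * \sum_k `|deviation i (coords i s) k|].
  move=> hs; have [|h1 [h2 h3]] := hd s; last by split.
  rewrite -ball_normE /= distrC; apply: le_lt_trans hs _.
  by apply: (@le_lt_trans _ _ (d / 2)); [rewrite ge_min lexx|lra].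
apply: filterS (nbhsx_ballx s0 eta eta0) => s; rewrite -ball_normE /= distrC => /ltW seta.
have [_ si _] := hs s seta; apply: (coords_eq si ix).
have dev0 k : deviation i (coords i s) k = 0.
  apply: (@gronwall_zero R _ (fun k s => deviation i (coords i s) k)
    (fun k s => field i (coords i s) k) s0 eta C) => //.
  - rewrite mulrA; apply: (@le_lt_trans _ _ ((N * C) * (1 / (2 * (N * C + 1))))).
      by rewrite ler_wpM2l // ge_min lexx orbT.
    by rewrite mulrA mulr1 ltr_pdivrMr ?mulr_gt0 ?ltr_wpDl //; lra.
  - by move=> k' r /hs[h1 h2 _]; exact: is_derive_deviation.
  - by move=> k'; rewrite coords0; case: k' => [[j|j]|] /=; rewrite ?subrr ?mxE.
  - by move=> k' r /hs[_ _].
have := deviation_norm i (coords i s); rewrite big1 => [|k _]; last by rewrite dev0 normr0.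
by rewrite normr_le0 subr_eq0 => /eqP.
Qed.

(** The times at which the curve rests form an open and closed subset of the interval of
    definition. *)
Lemma rest_stationary s0 s : a < s0 < b -> a < s < b -> c s0 = (covector A x 0, u0) ->
  c s = (covector A x 0, u0).
Proof.
move=> s0ab sab cs0; pose I := [set` `]a, b[].
pose T := [set s | a < s < b /\ c s = (covector A x 0, u0)].
suff TI : T = I by have : I s; [rewrite /I /= in_itv|rewrite -TI => -[]].
have TsubI : T `<=` I by move=> r [rab _]; rewrite /I /= in_itv.
have conI : connected I by apply/connected_intervalP/interval_is_interval.
apply: conI; first by exists s0.
  exists T; last by rewrite setIC; apply/esym/setIidl.
  rewrite openE => r [rab cr]; rewrite /interior /T.
  apply: filterI; last exact: near_stationary cr.
  exact: near_itvoo.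
exists (closure T); first exact: closed_closure.
apply/seteqP; split => r.
  by move=> Tr; split; [exact: TsubI|exact: subset_closure].
move=> [/= rI clr]; have rab : a < r < b by move: rI; rewrite /I /= in_itv.
pose i := chart_at A x; have ix := dom_chart_at A x.
(* The chart can be used at the limit time only once the base point is known, which comes from [M]
   being Hausdorff; the coordinates follow. *)
have br : base (c r).1 = x.
  apply: contrapT => brx.
  have oO : nbhs (base (c r).1) (~` [set x]).
    apply: open_nbhs_nbhs; split => //; rewrite openC.
    exact/accessible_closed_set1/hausdorff_accessible.
  have [r' [[_ cr'] /= h]] := clr _ (base_curve_continuous rab oO).
  by apply: h; rewrite cr'.
have ir : dom i (base (c r).1) by rewrite br.
split => //; apply: (coords_eq ir ix); apply: contrapT => cr.
have oO : nbhs (coords i r) (~` [set (chart i x, u0, 0)]).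
  apply: open_nbhs_nbhs; split => //; rewrite openC.
  exact/accessible_closed_set1/hausdorff_accessible/norm_hausdorff.
have [r' [[_ cr'] /= h]] := clr _ (coords_continuous rab ir oO).
by apply: h; rewrite /coords cr' /= cov_coord_zero.
Qed.

End Curve.

(** Together with [stationary_flow], this determines the preimage of any set under the partial flow
    among the rest points. *)
Lemma stationary_flow_from t w : contact_flow H t (covector A x 0, u0) w ->
  w = (covector A x 0, u0).
Proof.
move=> [c [c0 <- [e e0 hc]]]; apply: (rest_stationary hc _ _ c0).
  by rewrite ltrBlDr ltr_pwDr ?ge_min ?lexx // ltr_pwDr // le_max lexx.
by rewrite ltrBlDr ltr_pwDr ?ge_min ?lexx ?orbT // ltr_pwDr // le_max lexx orbT.
Qed.

End Stationary.

(** * Solutions at rest on the equilibrium set *)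

Section ConcentratedMeasure.
Context (d d' : measure_display) (T : measurableType d) (T' : measurableType d') (R : realType).
Variables (m : probability T R) (K : set T) (mK : measurable K).
Hypothesis mK1 : m K = 1%E.

(* The restriction to [K] also controls the values on non-measurable sets, such
   as preimages under the partially defined flow. *)
Definition concentrated := mrestr m mK.

HB.instance Definition _ := Measure.on concentrated.

Lemma concentrated_setT : concentrated setT = 1%E.
Proof. by rewrite /concentrated /mrestr setTI. Qed.

HB.instance Definition _ := Measure_isProbability.Build _ _ _ concentrated concentrated_setT.

Lemma concentrated_pushforward (f : T -> T') : measurable_fun setT f ->
  exists mu : probability T' R, forall B, mu B = m (f @^-1` B `&` K).
Proof.
move=> mf; pose X : {mfun T >-> T'} := mfun_Sub (mem_set mf).
by exists (distribution (concentrated : probability T R) X).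
Qed.

Lemma concentratedE B : measurable B -> m (B `&` K) = m B.
Proof.
move=> mB; have mKC : m (~` K) = 0%E by rewrite probability_setC // mK1 subee.
rewrite [RHS](measureDI _ mB mK) [X in (X + _)%E](_ : _ = 0%E) ?add0e //.
by apply: subset_measure0 mKC; [exact: measurableD|exact: measurableC|move=> x []].
Qed.

Lemma null_integral (f : T -> \bar R) : (forall x, K x -> f x = 0%E) ->
  (\int[m]_x f x = 0)%E.
Proof.
move=> f0; have mKC : m (~` K) = 0%E by rewrite probability_setC // mK1 subee.
have key (h : T -> \bar R) : (forall x, 0 <= h x)%E -> (forall x, K x -> h x = 0%E) ->
    (\int[m]_x h x = 0)%E.
  move=> h0 hK; apply/eqP; rewrite eq_le integral_ge0 // andbT.
  have <- : (\int[m]_(x in ~` K) +oo = 0)%E.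
    by apply: null_set_integral => //; exact: measurableC.
  rewrite [leRHS]integral_mkcond; apply: ge0_integral_le => // x _.
  rewrite /patch; case: ifPn; first by rewrite leey.
  by rewrite notin_setE /= => /contrapT /hK ->.
rewrite integralE (key f^\+%E) ?(key f^\-%E) ?sube0 // => x Kx.
  by rewrite funenegE f0 // oppe0 maxxx.
by rewrite funeposE f0 // maxxx.
Qed.

End ConcentratedMeasure.

Section Squeeze.
Variables (R : realType) (V : normedModType R).

(** The bound [h] has a local minimum at [a], so its differential vanishes there and [f - f a],
    caught between 0 and [h], is negligible. A viscosity solution, known only to be continuous,
    becomes differentiable at such points. *)
Lemma squeezed_is_diff (f h : V -> R) a : differentiable h a -> h a = 0 ->
  (\forall y \near a, 0 <= f y - f a <= h y) -> is_diff a f (cst 0).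
Proof.
move=> dh ha near_h.
have Dh : 'd h a = cst 0 :> (V -> R).
  apply/funext => v; rewrite -deriveE //; apply/eqP; rewrite -oppr_eq0 -deriveN.
    rewrite (@local_max_derive _ _ (- h)) //; first exact: differentiableN.
    by apply: filterS near_h => y; rewrite !fctE ha oppr0; lra.
  exact: diff_derivable.
have fE : f \o shift a = cst (f a) + cst 0 +o_ 0 id.
  apply/eqaddoP => _/posnumP[e].
  have [_ /eqaddoP/(_ _ (gt0 e)) hE] := (diff_locallyP a h).1 dh.
  have {}near_h : \forall y \near 0, 0 <= f (y + a) - f a <= h (y + a).
    have := near_h; rewrite (near_shift 0 a) /=.
    by apply: filterS => y; rewrite /= subr0.
  near=> y.
  have : `|(h \o shift a - (cst (h a) + 'd h a)) y| <= e%:num * `|id y|.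
    by near: y; exact: hE.
  rewrite Dh !fctE /= ha !addr0 subr0; apply: le_trans.
  have /andP[h0 h1] : 0 <= f (y + a) - f a <= h (y + a) by near: y.
  by rewrite !ger0_norm // (le_trans h0).
have c0 : continuous (cst 0 : V -> R) by move=> y; exact: cvg_cst.
have dfE := @diff_unique _ _ _ f (\0 : {linear V -> R}) a c0 fE.
apply: DiffDef => //; apply/diff_locallyP; rewrite dfE; split => //.
Unshelve. all: by end_near. Qed.

End Squeeze.

Lemma Ck_linear (R : realType) (U V W : normedModType R) k (p : {linear U -> V}) (S : set V)
    (f : V -> W) : continuous p -> Ck k S f -> Ck k (p @^-1` S) (f \o p).
Proof.
move=> cp; elim: k f => [|k IH] f /=.
  by move=> cf x Sx; exact: (cvg_comp _ _ (cp x) (cf _ Sx)).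
move=> [df Df]; split=> [x Sx|v].
  by apply: differentiable_comp; [exact: linear_differentiable|exact: df].
have -> : (fun x => 'D_v (f \o p) x) = (fun x => 'D_(p v) f x) \o p; last exact: IH.
by apply/funext => x; apply: derive_affine => h q; rewrite linearD linearZ.
Qed.

Section Equilibrium.
Variables (R : realType) (n : nat) (M : ptopologicalType) (A : atlas R n M).
Variable g : riemannian_metric A.
Hypotheses (hausM : hausdorff_space M) (cptM : compact [set: M]).

Lemma zero_section_continuous : continuous (fun x => covector A x 0 : cotangent A).
Proof.
apply/continuousP => U; change (cotangent_open U -> open ((fun x => covector A x 0) @^-1` U)).
move=> oU; rewrite openE => x /= Ux; rewrite /interior.
have ix := dom_chart_at A x; set i := chart_at A x in ix.
pose W := [set yq : 'rV[R]_n * 'rV[R]_n | codom i yq.1 /\ U (cov_of_coord i yq.1 yq.2)].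
have Wx : W (chart i x, 0) by split; [exact: codom_chart|rewrite cov_of_coord_zero].
have oW : open W by exact: oU.
have oW0 : open ((fun y : 'rV[R]_n => (y, 0 : 'rV[R]_n)) @^-1` W).
  apply: open_comp => // y _.
  exact: (cvg_to_pair _ (@cvg_id _ (nbhs y)) (cvg_cst _)).
have near_W : \forall y \near chart i x, U (cov_of_coord i y 0).
  by apply: filterS (open_nbhs_nbhs (conj oW0 Wx)) => y [].
have near_U := chart_cvg ix near_W; have near_dom_x := near_dom ix.
near=> y; have iy : dom i y by near: y.
rewrite /preimage /= -[covector A y 0](cov_of_coord_zero iy); near: y; exact: near_U.
Unshelve. all: by end_near. Qed.

(** The supremum of quotients controls pairs at positive distance; at distance zero the quotient
    carries no information, and the pointwise clause makes the two values equal. *)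
Lemma coupling_bound (F : M -> borel_probability M R -> R) : coupling_lipschitz g F ->
  exists2 K, 0 <= K & forall m1 m2 e, 0 <= e -> (d1 g m1 m2 <= e%:E)%E ->
    forall x, `|F x m1 - F x m2| <= K * e.
Proof.
move=> [F1]; set S := [set r | _] => F2.
have [B B0 hB] : exists2 B, 0 <= B & forall r, S r%:E -> r <= B.
  have hS r : S r%:E -> (r%:E <= ereal_sup S)%E by exact: ereal_sup_ubound.
  case E : (ereal_sup S) hS F2 => [s| |] hS // _.
    exists (Num.max s 0); first by rewrite le_max lexx orbT.
    by move=> r /hS; rewrite lee_fin => rs; rewrite le_max rs.
  by exists 0 => // r /hS; rewrite leeNy_eq.
exists B => // m1 m2 e e0 d1e x.
have [->|m12] := pselect (m1 = m2); first by rewrite subrr normr0 mulr_ge0.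
have d1_ge0 : (0 <= d1 g m1 m2)%E.
  apply: ereal_sup_ubound; exists (fun=> 0); last by rewrite !integral0 sube0.
  move=> y z; rewrite subrr normr0; apply: le_ereal_inf_tmp => _ [c _ <-].
  by apply: integral_ge0 => t _; rewrite lee_fin sqrtr_ge0.
have d1_fin : d1 g m1 m2 \is a fin_num.
  by rewrite fin_real // (lt_le_trans _ d1_ge0) // (le_lt_trans d1e) // ltry.
have [K hK] := F1 x; have := hK m1 m2; rewrite -(fineK d1_fin) -EFinM lee_fin => K12.
have d_ge0 : 0 <= fine (d1 g m1 m2) by rewrite fine_ge0.
have d_le : fine (d1 g m1 m2) <= e by rewrite -lee_fin fineK.
have [d0|d0] := eqVneq (fine (d1 g m1 m2)) 0.
  by apply: le_trans K12 _; rewrite d0 mulr0 mulr_ge0.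
apply: (@le_trans _ _ (B * fine (d1 g m1 m2))); last exact: ler_wpM2l.
rewrite -ler_pdivrMr; first by apply: hB; exists x, m1, m2.
by rewrite lt_neqAle eq_sym d0.
Qed.

Variable H : cotangent A * R -> R.
Hypotheses (H_C3 : CkH 3 H) (H_convex : ham_convex H) (H_superlinear : ham_superlinear g H).
Hypothesis H_even : ham_even H.
Variable delta : R.
Hypotheses (delta0 : 0 < delta)
  (H_delta : forall xi s, delta < (fun s => H (xi, s))^`()%classic s).
Variables (f c : M -> R) (v : R).
Hypotheses (f_C2 : CkM A 2 f) (cE : forall x, H (covector A x 0, c x) = f x).
Hypothesis c_ge : forall x, v <= c x.

Let Hf : cotangent A * R -> R := fun w => H w - f (base w.1).
Let V := ('rV[R]_n * R * 'rV[R]_n)%type.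

Let f_continuous : continuous f := CkM_continuous f_C2.

(** The coupling term is only C^2 in [x]; this order still makes the contact vector field
    differentiable. *)
Lemma ham_minus_C2 i : Ck 2 [set z : V | codom i z.1.1]
  (fun z : V => local_ham Hf i z.1.1 z.1.2 z.2 : R^o).
Proof.
pose p : {linear V -> 'rV[R]_n} := fst \o fst.
have cp : continuous p by move=> z; exact: (@cvg_comp _ _ _ fst fst _ _ _ cvg_fst cvg_fst).
have oU : open [set z : V | codom i z.1.1].
  by apply: (@open_comp _ _ p) => [z _|]; [exact: cp|exact: open_codom].
pose fi : V -> R^o := (f \o ichart i) \o p; pose Hi (z : V) : R^o := local_ham H i z.1.1 z.1.2 z.2.
have fi_C2 : Ck 2 [set z : V | codom i z.1.1] fi by exact: (Ck_linear cp (f_C2 i)).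
have Hi_C2 : Ck 2 [set z : V | codom i z.1.1] Hi by exact: (CkS (H_C3 i)).
have := Ck_add oU Hi_C2 (Ck_scale (-1) oU fi_C2).
by apply: eq_Ck => // z _; rewrite scaleN1r.
Qed.

Let slice_p i y u : codom i y -> differentiable (local_ham Hf i y u : _ -> R^o) 0.
Proof.
move=> iy; pose L (z : V) : R^o := local_ham Hf i z.1.1 z.1.2 z.2.
have [dL _] := ham_minus_C2 i.
apply: (@differentiable_comp _ _ _ _ (fun q => (y, u, q) : V) L); last exact: dL.
by apply: differentiable_pair => //; exact: differentiable_cst.
Qed.

Let slice_x i y u : codom i y -> differentiable (fun y => local_ham Hf i y u 0 : R^o) y.
Proof.
move=> iy; pose L (z : V) : R^o := local_ham Hf i z.1.1 z.1.2 z.2.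
have [dL _] := ham_minus_C2 i.
apply: (@differentiable_comp _ _ _ _ (fun y => (y, u, 0) : V) L); last exact: dL.
apply: differentiable_pair; last exact: differentiable_cst.
by apply: differentiable_pair => //; exact: differentiable_cst.
Qed.

Let local_zero i y : local_ham Hf i y v 0 = H (covector A (ichart i y) 0, v) - f (ichart i y).
Proof. by rewrite /local_ham /Hf /cov_of_coord mul0mx. Qed.

Let gap_le0 x : H (covector A x 0, v) - f x <= 0.
Proof. by rewrite subr_le0 -cE; exact: (ham_value_le H_C3 delta0 H_delta). Qed.

Let gap_eq0 x : c x = v -> H (covector A x 0, v) - f x = 0.
Proof. by move=> cx; rewrite -cE cx subrr. Qed.

Lemma contact_stationary_p x i : dom i x -> grad (local_ham Hf i (chart i x) v) 0 = 0.
Proof.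
move=> ix; apply/rowP => j; rewrite !mxE; apply: even_derive.
  by apply: slice_p; exact: codom_chart.
move=> q; rewrite /local_ham /Hf /cov_of_coord mulNmx /=; congr (_ - _).
by rewrite -H_even.
Qed.

(** By [c_ge] the function [H (y, 0, v) - f y] is nonpositive, and it vanishes at [x]: an interior
    maximum. *)
Lemma contact_stationary_x x i : c x = v -> dom i x ->
  grad (fun y => local_ham Hf i y v 0) (chart i x) = 0.
Proof.
move=> cx ix; apply: local_max_grad; first by apply: slice_x; exact: codom_chart.
by near=> y; rewrite !local_zero chartK // (gap_eq0 cx); exact: gap_le0.
Unshelve. all: by end_near. Qed.

Lemma solution_at_rest : exists2 u, viscosity_solution Hf u & forall x, c x = v ->
  [/\ u x = v, differentiableM A u x & diffM A u x = 0].
Proof.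
have c_continuous : continuous c by exact: (zero_slope_value_continuous H_C3 delta0 H_delta).
(* The constant [c z + 1], above the maximum of [c], serves as the strict upper barrier for Perron's
   method. *)
have [z zmax] := compact_max cptM c_continuous.
have [ | | | | | |u [u_visc u_ge u_le]] :=
  @perron_solution _ _ _ A hausM cptM Hf v (c z + 1).
- by move=> i w iw; exact: (ham_minus_continuous H_C3 f_continuous).
- by move=> xi s t st; rewrite lerD2r; exact: (ham_value_le H_C3 delta0 H_delta).
- move=> x p s t t01; rewrite lerD2r.
  exact: (ham_ray_nondecreasing H_C3 H_convex H_even).
- move=> x p s p0; have [t t0 ht] := ham_coercive H_superlinear x s (f x) p0.
  by exists t => //; rewrite subr_gt0.
- exact: gap_le0.
- move=> x; rewrite subr_gt0 -cE -subr_gt0.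
  have cz : c x <= c z + 1 by rewrite (le_trans (zmax x)) // lerDl.
  apply: lt_le_trans (ham_value_increasing H_C3 H_delta (covector A x 0) cz).
  by rewrite mulr_gt0 // subr_gt0 (le_lt_trans (zmax x)) // ltrDl.
exists u => // x cx.
have squeeze y : 0 <= u y - v <= delta^-1 * - (H (covector A y 0, v) - f y).
  rewrite subr_ge0 u_ge /= mulrC ler_pdivlMr // mulrC.
  have := ham_value_increasing H_C3 H_delta (covector A y 0) (u_ge y).
  by have := u_le y; rewrite /Hf /=; lra.
have ux : u x = v.
  by have := squeeze x; rewrite gap_eq0 // oppr0 mulr0 -eq_le eq_sym subr_eq0 => /eqP.
have ix := dom_chart_at A x; set i := chart_at A x in ix.
pose h (y : 'rV[R]_n) : R^o := delta^-1 *: - (local_ham Hf i y v 0).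
have dh : differentiable h (chart i x).
  apply: differentiableZ; apply: (@differentiableN _ _ _ (fun y => local_ham Hf i y v 0)).
  by apply: slice_x; exact: codom_chart.
have h0 : h (chart i x) = 0 by rewrite /h local_zero chartK // gap_eq0 // oppr0 scaler0.
have [ |du duE] := @squeezed_is_diff R _ (u \o ichart i) h (chart i x) dh h0.
  by near=> y; rewrite /= chartK // ux /h local_zero; exact: squeeze.
split => //; apply/rowP => j; rewrite !mxE deriveE //.
exact: (congr1 (fun h : 'rV[R]_n -> R => h (delta_mx 0 j)) duE).
Unshelve. all: by end_near. Qed.

End Equilibrium.

Theorem theorem1 (R : realType) (n : nat) (M : ptopologicalType)
    (A : atlas R n M) (hM : closed_connected_manifold A)
    (g : riemannian_metric A)
    (H : cotangent A * R -> R)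
    (hH : CkH 3 H) (hH1 : ham_convex H) (hH2 : ham_superlinear g H)
    (hH3 : ham_monotone H) (hH4 : ham_even H)
    (F : M -> borel_probability M R -> R)
    (hF1 : coupling_regular g F) (hF2 : coupling_lipschitz g F) :
  exists (u : M -> R) (m : borel_probability M R),
    [/\ viscosity_solution (ham_minus H F m) u,
        continuity_equation H u m &
        exists mu : borel_probability (cotangent A * R)%type R,
          mather_measure (ham_minus H F m) mu /\
          forall B : set (borel M), measurable B ->
            m B = pushforward mu (@proj_base R n M A) B].
Proof.
have [hausM cptM _] := hM; have [delta [lambda [delta0 _ H_bound]]] := hH3.
have H_delta xi s : delta < (fun s => H (xi, s))^`()%classic s.
  by have /andP[] := H_bound xi s.
have [F_C2 _] := hF1; have F_continuous m : continuous (F^~ m) := CkM_continuous (F_C2 m).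
(* The choice is made over pairs of a point and a level, so that [c x m] depends on [m] only through
   [F x m]. *)
have /choice[C CE] : forall xa : M * R, exists s, H (covector A xa.1 0, s) = xa.2.
  by move=> xa; exact: (ham_value_surjective hH delta0 H_delta).
pose c x m := C (x, F x m).
have cE m x : H (covector A x 0, c x m) = F x m := CE (x, F x m).
have c_continuous m : continuous (c^~ m).
  exact: (zero_slope_value_continuous hH delta0 H_delta (F_continuous m) (cE m)).
have [K K0 F_lip] := coupling_bound hF2.
have c_lip m1 m2 e : 0 <= e -> (d1 g m1 m2 <= e%:E)%E ->
    forall x, `|c x m1 - c x m2| <= K / delta * e.
  move=> e0 d12 x; rewrite mulrAC ler_pdivlMr // mulrC; apply: le_trans (F_lip _ _ _ e0 d12 x).
  by rewrite -!cE; exact: (ham_value_dist hH H_delta).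
have [m [v [c_ge cv]]] := manifold_equilibrium hM c_continuous
  (divr_ge0 K0 (ltW delta0)) c_lip.
pose Kset : set (borel M) := [set x | c x m = v].
have Kset_setC : ~` Kset = [set x | v < c x m].
  apply/seteqP; split => x /=; first by move=> /eqP; rewrite lt_neqAle c_ge andbT eq_sym.
  by move=> vc cx; rewrite cx ltxx in vc.
have mKset : measurable Kset.
  rewrite -[Kset]setCK Kset_setC; apply: measurableC; apply: sub_sigma_algebra.
  have -> : [set x | v < c x m] = (c^~ m) @^-1` [set s | v < s] by [].
  by apply: open_comp => [x _|]; [exact: c_continuous|exact: open_gt].
have mKset1 : m Kset = 1%E.
  by rewrite -[Kset]setCK probability_setC ?Kset_setC ?cv ?sube0 // -Kset_setC; exact: measurableC.
have [u u_visc u_rest] := solution_at_rest hausM cptM hH hH1 hH2 hH4 delta0 H_delta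
  (F_C2 m) (cE m) c_ge.
pose z x : cotangent A * R := (covector A x 0, v).
have z_continuous : continuous z.
  by move=> x; apply: cvg_to_pair; [exact: zero_section_continuous|exact: cvg_cst].
have mz : measurable_fun setT (z : borel M -> borel (cotangent A * R)%type).
  apply: (@measurability _ _ (borel M) (borel (cotangent A * R)%type) setT z open erefl).
  move=> _ [W oW <-]; rewrite setTI; apply: sub_sigma_algebra.
  by apply: open_comp => // x _; exact: z_continuous.
have [mu muE] := concentrated_pushforward mKset mKset1 mz.
have rest_p x i := @contact_stationary_p _ _ _ _ _ hH hH4 _ v (F_C2 m) x i.
have rest_x x (cx : c x m = v) i :=
  @contact_stationary_x _ _ _ _ _ hH _ delta0 H_delta _ _ _ (F_C2 m) (cE m) c_ge x i cx.
have rest_value x : c x m = v -> ham_minus H F m (z x) = 0.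
  by move=> cx; rewrite /ham_minus /= -cE cx subrr.
have flow_rest t x : c x m = v -> contact_flow (ham_minus H F m) t (z x) (z x).
  by move=> cx; exact: (stationary_flow (@rest_p x) (rest_x x cx) (rest_value x cx)).
have flow_from t x w : c x m = v -> contact_flow (ham_minus H F m) t (z x) w -> w = z x.
  move=> cx; exact: (stationary_flow_from hausM (ham_minus_C2 hH (F_C2 m)) (@rest_p x)
    (rest_x x cx) (rest_value x cx)).
exists u, m; split => //.
- split.
    exists (~` Kset); split; first exact: measurableC.
      by rewrite Kset_setC.
    by move=> x /= + cx; apply; have [] := u_rest x cx.
  move=> phi _; apply: (null_integral mKset mKset1) => x cx.
  have [_ _ ->] := u_rest x cx; rewrite (dHdp0 hH hH4).
  by rewrite /dotr trmx0 mulmx0 mxE.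
exists mu; split; last first.
  by move=> B mB; rewrite /pushforward muE; exact/esym/(concentratedE mKset mKset1 mB).
exists u => //; split.
  (* Negligibility asks for a measurable null superset. The set of rest points over [Kset] is
     closed, being cut out by [c = v], zero momentum and value [v]. *)
  exists (~` (z @` Kset)); split.
  - apply: sub_sigma_algebra; rewrite /= openC.
    have -> : z @` Kset = (fun w => c (base w.1) m) @^-1` [set v] `&`
        (fst @^-1` [set xi | fiber xi = 0] `&` snd @^-1` [set v]).
      apply/seteqP; split => [_ [x cx <-] //|[[x p] s] /= [cx [/= p0 ->]]].
      by exists x => //; rewrite /z; move: p0; rewrite /fiber /= => ->.
    have closed_v : closed [set v] by exact: closed_eq.
    apply: closedI; last apply: closedI; apply: preimage_closed => //.
    - move=> w _; have cb : (fun w : cotangent A * R => base w.1) @ w --> base w.1.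
        exact: (@continuous_comp _ _ _ fst base w cvg_fst (@base_continuous _ _ _ A w.1)).
      exact: (cvg_comp _ _ cb (c_continuous m (base w.1))).
    - by move=> w _; exact: cvg_fst.
    - exact: closed_zero_section.
    - by move=> w _; exact: cvg_snd.
  - rewrite muE (_ : _ `&` _ = set0) ?measure0 //.
    by apply/seteqP; split => // x [/= + cx]; apply; exists x.
  (* A rest point lies on the one-jet of [u], since [u] is differentiable over [Kset] with zero
     slope, and it is its own image under every [contact_flow (- t)]. *)
  - apply: subsetC => _ [x cx <-] t t0; exists (z x); last exact: flow_rest.
    apply: subset_closure; rewrite /= /z /=; have [-> du ->] := u_rest x cx.
    by split.
(* Only starting points over [Kset] count for [mu]. There uniqueness of the orbit gives one
   inclusion and the constant orbit the other. *)
move=> t B mB; rewrite !muE; congr (m _); apply/seteqP; split => x [/= + cx].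
  by move=> [w Bw /(flow_from _ _ _ cx) wz]; rewrite -wz.
by move=> Bz; split => //; exists (z x) => //; exact: flow_rest.
Qed.
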